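(* For integers $1\le k\le n$ let $\mu_{k,n}$ be the probability measure on the unitary group $U(n)$ defined in the context. For even $n\ge 2$, put $\nu_n=\mu_{n/2,\,n}$. For odd $n\ge 3$, put $k_+=(n+1)/2$, $k_-=(n-1)/2$ and $\nu_n=\frac12\left(\mu_{k_-,n}+\mu_{k_+,n}\right)$. Let $\sigma_n\in\widehat{U(n)}$ be the defining representation ($\sigma_n(u)=u$) and $S_n=\{\sigma_n,\overline{\sigma_n}\}$. Then there is a positive constant $\gamma<1/2$ (independent of $n$) such that for every $n\ge 4$ the symmetric central probability measure $\nu_n$ has a $(1/2,\gamma)$-spectral gap with respect to $S_n$. More precisely, for any $1/4<\gamma<1/2$, $\nu_n$ has a $(1/2,\gamma)$-spectral gap with respect to $S_n$ for all sufficiently large $n$.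
   Context: For a compact group $G$, $m_G$ is the normalized Haar measure, $\widehat G$ is the set of irreducible unitary representations $\pi:G\to U(d_\pi)$ (one representative for each unitary equivalence class), and $M(G)$ is the space of complex Radon measures. For $\mu\in M(G)$ and $\pi\in\widehat G$, $\hat\mu(\pi)=\int\overline{\pi(t)}\,\mu(dt)\in M_{d_\pi}$ (entrywise complex conjugation), where $M_d$ is the space of complex $d\times d$ matrices with the operator norm. A subset $\Lambda\subset\widehat G$ is symmetric if $\bar\pi\in\Lambda$ for all $\pi\in\Lambda$. A measure $\mu$ is central if $\mu=\delta_g*\mu*\delta_{g^{-1}}$ for all $g\in G$. Spectral gap: for $0\le\gamma<\delta\le1$, a probability measure $\mu$ on $G$ has a $(\delta,\gamma)$-spectral gap with respect to a symmetric subset $\Lambda\subset\widehat G$ if $\hat\mu(\pi)=\delta I$ for every $\pi\in\Lambda$ and $\|\hat\mu(\rho)\|\le\gamma$ for every nontrivial $\rho\in\widehat G$ with $\rho\notin\Lambda$. For $1\le k\le n$, $\Gamma(k)\subset U(n)$ is the copy of $U(k)$ embedded via $a\mapsto a\oplus I_{n-k}$, $m_{\Gamma(k)}$ is its normalized Haar measure viewed as a measure on $U(n)$, and $\mu_{k,n}=\int_{U(n)}\delta_s*m_{\Gamma(k)}*\delta_{s^{-1}}\,m_{U(n)}(ds)$. *)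

(* Defs.v *)
From HB Require Import structures.
From mathcomp Require Import all_boot all_order all_algebra.
From mathcomp Require Import complex.
From mathcomp Require Import all_classical all_reals all_analysis.

Set Implicit Arguments.
Unset Strict Implicit.
Unset Printing Implicit Defensive.

Import Order.TTheory GRing.Theory Num.Theory.
Import numFieldNormedType.Exports.

Local Open Scope classical_set_scope.
Local Open Scope ring_scope.
Local Open Scope sesquilinear_scope.

(* [R[i]] gets its topology from the library only when it is presented as an
   abstract [numClosedFieldType]. *)
Definition C (R : realType) : numClosedFieldType := R[i].

HB.mixin Record isTopologicalGroup G & Topological G & Group G := {
  mulg_continuous : continuous (fun xy : G * G => (xy.1 * xy.2)%g);
  invg_continuous : continuous (fun x : G => x^-1%g)
}.

(* Pointedness is only there because the library asks it of measurable
   spaces. *)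
#[short(type="topologicalGroupType")]
HB.structure Definition TopologicalGroup :=
  {G of isTopologicalGroup G & Group G & PointedTopological G}.

Definition borel (G : topologicalGroupType) : Type :=
  g_sigma_algebraType (@open G).

HB.instance Definition _ (G : topologicalGroupType) := Measurable.on (borel G).

Section Measures.
Context {R : realType} {G : topologicalGroupType}.

(* On a compact group a left-invariant Borel probability measure is the
   normalized Haar measure. *)
Definition is_haar (m : probability (borel G) R) : Prop :=
  forall (g : G) (A : set (borel G)), measurable A ->
    m [set (g * x)%g | x in A] = m A.

(* [convolution mu nu A] is the double integral of
   [1_A (x * y)] against [mu (dx) nu (dy)]. *)
Definition convolution (mu nu : set (borel G) -> \bar R) :
    set (borel G) -> \bar R :=
  fun A => (\int[mu]_x nu [set y : borel G | A (x * y)%g])%E.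

(* The convolution of [mu] by the Dirac masses at [g] and at [g^-1]. *)
Definition conjugate (g : G) (mu : set (borel G) -> \bar R) :
    set (borel G) -> \bar R :=
  convolution (convolution (@dirac _ (borel G) g R) mu)
              (@dirac _ (borel G) g^-1%g R).

Definition central (mu : probability (borel G) R) : Prop :=
  forall (g : G) (A : set (borel G)), measurable A -> conjugate g mu A = mu A.

Definition symmetric_measure (mu : probability (borel G) R) : Prop :=
  forall A : set (borel G), measurable A ->
    mu [set x^-1%g | x in A] = mu A.

End Measures.

Section Representations.
Context {R : realType} {G : topologicalGroupType}.

Definition unitary_rep d (pi : G -> 'M[C R]_d) : Prop :=
  [/\ forall g, pi g \is unitarymx,
      pi 1%g = 1%:M,
      forall g h, pi (g * h)%g = pi g *m pi h
    & continuous pi].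

(* The rows of [V] span a space of vectors of [C^d], written as rows: the
   action [v |-> pi g *m v] on columns is [v |-> v *m (pi g)^T] on rows. *)
Definition irreducible_rep d (pi : G -> 'M[C R]_d) : Prop :=
  [/\ unitary_rep pi, (0 < d)%N
    & forall V : 'M[C R]_d, (forall g, stablemx V (pi g)^T) ->
        V = 0 \/ row_full V].

Definition trivial_rep d (pi : G -> 'M[C R]_d) : Prop :=
  forall g, pi g = 1%:M.

Definition conj_rep d (pi : G -> 'M[C R]_d) : G -> 'M[C R]_d :=
  fun g => (pi g) ^ Num.conj.

(* [u \is unitarymx] only says [u *m u^t* = 1%:M]; both conditions together
   force [d = e]. *)
Definition equivalent_rep d e (pi : G -> 'M[C R]_d) (rho : G -> 'M[C R]_e) :
    Prop :=
  exists u : 'M[C R]_(d, e),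
    [/\ u \is unitarymx, u^t* \is unitarymx
      & forall g, pi g *m u = u *m rho g].

(* A set of irreducible representations, one per equivalence class, is given by
   the collection of all the members of these classes. *)
Definition dual_subset (Lambda : forall d, set (G -> 'M[C R]_d)) : Prop :=
  (forall d (pi : G -> 'M[C R]_d), Lambda d pi -> irreducible_rep pi) /\
  (forall d e (pi : G -> 'M[C R]_d) (rho : G -> 'M[C R]_e),
     equivalent_rep pi rho -> Lambda d pi -> Lambda e rho).

Definition symmetric_subset (Lambda : forall d, set (G -> 'M[C R]_d)) : Prop :=
  forall d (pi : G -> 'M[C R]_d), Lambda d pi -> Lambda d (conj_rep pi).

Definition complex_integral (mu : probability (borel G) R) (f : G -> C R) :
    C R :=
  Complex (Rintegral mu setT (fun t => complex.Re (f t)))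
          (Rintegral mu setT (fun t => complex.Im (f t))).

Definition fourier (mu : probability (borel G) R) d (pi : G -> 'M[C R]_d) :
    'M[C R]_d :=
  \matrix_(i, j) complex_integral mu (fun t => Num.conj (pi t i j)).

End Representations.

Section OperatorNorm.
Context {R : realType}.

Definition hermitian_norm d (v : 'cV[C R]_d) : R :=
  Num.sqrt (\sum_i Normc.normc (v i 0) ^+ 2).

Definition opnorm d (A : 'M[C R]_d) : R :=
  sup [set hermitian_norm (A *m v) | v in [set v | hermitian_norm v <= 1]].

End OperatorNorm.

Definition has_spectral_gap (R : realType) (G : topologicalGroupType)
    (mu : probability (borel G) R) (delta gamma : R)
    (Lambda : forall d, set (G -> 'M[C R]_d)) : Prop :=
  [/\ [/\ 0 <= gamma, gamma < delta & delta <= 1],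
      dual_subset Lambda, symmetric_subset Lambda,
      forall d (pi : G -> 'M[C R]_d), Lambda d pi ->
        fourier mu pi = (delta%:C)%C%:M
    & forall d (rho : G -> 'M[C R]_d), irreducible_rep rho ->
        ~ trivial_rep rho -> ~ Lambda d rho ->
        opnorm (fourier mu rho) <= gamma].

Section UnitaryGroup.
Variables (R : realType) (n : nat).

Definition unitary_group : Type := {u : 'M[C R]_n | u \is unitarymx}.

Implicit Types u v w : unitary_group.

Lemma unitary1_subproof : (1%:M : 'M[C R]_n) \is unitarymx.
Proof. by apply/unitarymxP; rewrite trmx1 map_mx1 mulmx1. Qed.

Definition unitary1 : unitary_group := exist _ 1%:M unitary1_subproof.

Definition unitary_mul u v : unitary_group :=
  exist _ (sval u *m sval v) (mul_unitarymx (svalP u) (svalP v)).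

Lemma unitary_inv_subproof u : (sval u)^t* \is unitarymx.
Proof. by rewrite trmxC_unitary (svalP u). Qed.

Definition unitary_inv u : unitary_group :=
  exist _ ((sval u)^t*) (unitary_inv_subproof u).

Lemma unitary_mulA : associative unitary_mul.
Proof. by move=> u v w; apply: val_inj; rewrite /= mulmxA. Qed.

Lemma unitary_mul1 : left_id unitary1 unitary_mul.
Proof. by move=> u; apply: val_inj; rewrite /= mul1mx. Qed.

Lemma unitary_mulr1 : right_id unitary1 unitary_mul.
Proof. by move=> u; apply: val_inj; rewrite /= mulmx1. Qed.

Lemma unitary_mulVr : right_inverse unitary1 unitary_inv unitary_mul.
Proof. by move=> u; apply: val_inj => /=; apply/unitarymxP/(svalP u). Qed.

Lemma unitary_mulV : left_inverse unitary1 unitary_inv unitary_mul.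
Proof.
move=> u; apply: val_inj => /=; apply: mulmx1C.
by apply/unitarymxP/(svalP u).
Qed.

HB.instance Definition _ := Choice.on unitary_group.
HB.instance Definition _ := isGroup.Build unitary_group
  unitary_mulA unitary_mul1 unitary_mulr1 unitary_mulV unitary_mulVr.
HB.instance Definition _ := isPointed.Build unitary_group unitary1.
HB.instance Definition _ := Topological.copy unitary_group
  (initial_topology (fun u : unitary_group => sval u)).

Lemma sval_continuous : continuous (fun u : unitary_group => sval u).
Proof. exact: initial_continuous. Qed.

Lemma continuous_mx (T : topologicalType) (f : T -> 'M[C R]_n) :
  (forall i j, continuous (fun x => f x i j)) -> continuous f.
Proof.
move=> cf x A [P P_fx sPA].
have H : \forall y \near x, forall i j, P i j (f y i j).
  apply: filter_forall => i; apply: filter_forall => j; exact: (cf i j x _ (P_fx i j)).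
by apply: filterS H => y Py; apply: sPA.
Qed.

Lemma entry_continuous i j : continuous (fun u : unitary_group => sval u i j).
Proof.
have c : continuous (fun M : 'M[C R]_n => M i j) by exact: coord_continuous.
move=> u; exact: (continuous_comp (@sval_continuous u) (c (sval u))).
Qed.

Lemma conj_continuous : continuous (@Num.conj (C R)).
Proof.
move=> z A [e e0 sA]; exists e => // w /= zw; apply: sA => /=.
by rewrite -rmorphB norm_conjC.
Qed.

Lemma unitary_mul_continuous :
  continuous (fun uv : unitary_group * unitary_group => (uv.1 * uv.2)%g).
Proof.
apply: continuous_comp_initial; apply: continuous_mx => i j uv /=.
under eq_fun do rewrite mxE.
apply: cvg_big; first exact: pseudometric_normed_Zmodule.add_continuous.
move=> k _; apply: cvgM.
- apply: (@continuous_comp _ _ _ fst (fun u : unitary_group => sval u i k)).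
    exact: cvg_fst.
  exact: entry_continuous.
- apply: (@continuous_comp _ _ _ snd (fun u : unitary_group => sval u k j)).
    exact: cvg_snd.
  exact: entry_continuous.
Qed.

Lemma unitary_inv_continuous : continuous (fun u : unitary_group => u^-1%g).
Proof.
apply: continuous_comp_initial; apply: continuous_mx => i j u /=.
under eq_fun do rewrite !mxE.
exact: (continuous_comp (@entry_continuous j i u) (@conj_continuous _)).
Qed.

HB.instance Definition _ := isTopologicalGroup.Build unitary_group
  unitary_mul_continuous unitary_inv_continuous.

End UnitaryGroup.

Section SpectralGapMeasures.
Variable R : realType.

Lemma embed_subproof k n (e : (k + (n - k) = n)%N) (a : unitary_group R k) :
  castmx (e, e) (block_mx (sval a) 0 0 1%:M) \is unitarymx.
Proof.
move: (n - k)%N e => m e; case: _ / e; rewrite castmx_id.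
apply/unitarymxP.
rewrite tr_block_mx map_block_mx mulmx_block !trmx0 !map_mx0 trmx1 map_mx1.
rewrite !mulmx0 !mul0mx !addr0 add0r mulmx1 (unitarymxP (svalP a)).
by rewrite -scalar_mx_block.
Qed.

Definition embed k n (le_kn : (k <= n)%N) (a : unitary_group R k) :
    unitary_group R n :=
  exist _ (castmx (subnKC le_kn, subnKC le_kn) (block_mx (sval a) 0 0 1%:M))
          (embed_subproof (subnKC le_kn) a).

Variable haar : forall n, probability (borel (unitary_group R n)) R.

Definition haar_Gamma k n (le_kn : (k <= n)%N) :
    set (borel (unitary_group R n)) -> \bar R :=
  pushforward (haar k)
    (embed le_kn : borel (unitary_group R k) -> borel (unitary_group R n)).

Definition mu_ k n (le_kn : (k <= n)%N) :
    set (borel (unitary_group R n)) -> \bar R :=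
  fun A => (\int[haar n]_s conjugate s (haar_Gamma le_kn) A)%E.

Lemma half_le n : (n./2 <= n)%N.
Proof. by rewrite leq_half_double -addnn ltnW // ltnS leq_addr. Qed.

Lemma half_succ_le n : (n.+1./2 <= n)%N.
Proof. by rewrite -uphalfE leq_uphalf_double -addnn leq_addr. Qed.

Definition nu_ n : set (borel (unitary_group R n)) -> \bar R :=
  if odd n then
    fun A => ((2^-1)%:E * (mu_ (half_le n) A + mu_ (half_succ_le n) A))%E
  else mu_ (half_le n).

Definition sigma n : unitary_group R n -> 'M[C R]_n := fun u => sval u.

(* The union of the equivalence classes of [sigma n] and of its conjugate. *)
Definition S_ n : forall d, set (unitary_group R n -> 'M[C R]_d) :=
  fun d => [set pi | equivalent_rep pi (@sigma n) \/
                     equivalent_rep pi (conj_rep (@sigma n))].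

End SpectralGapMeasures.

Arguments nu_ {R} haar n _.
Arguments mu_ {R} haar k n le_kn _.
Arguments S_ R n d _ : clear implicits.

(* Main.v *)
Require Import Defs.
From HB Require Import structures.
From mathcomp Require Import all_boot all_order all_algebra perm.
From mathcomp Require Import complex.
From mathcomp Require Import all_classical all_reals all_analysis.
From mathcomp Require Import measurable_realfun.
From mathcomp Require Import ring lra zify.
(** The Fourier coefficient of a central measure [nu] at an irreducible
    representation [rho] of dimension [d] is a scalar matrix, by Schur's lemma; the
    scalar is the integral of the trace of [rho], divided by [d]. For the mean over
    the conjugates of the Haar measure of [Gamma k], that integral is the trace of
    the average of [rho] over [Gamma k]: this average is a projection, and its trace
    is the dimension of the space of vectors fixed by [Gamma k]. For the defining
    representation it is [n - k], so averaging the values for the two halves of [n]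
    gives [1/2]. For all the other nontrivial [rho] the fixed vectors have to be
    bounded by a little more than [d / 4] on average.

    In a basis of weight vectors for the diagonal torus, a vector fixed by [Gamma k]
    only involves weights in [Z^n] which vanish on the first [k] coordinates. Weight
    multiplicities are invariant under permutations of the coordinates, so the number
    of such basis vectors is the sum over the basis of the probability that a random
    [k]-subset falls among the zero coordinates of the weight ([bin_vanishing]). With
    two nonzero coordinates or more, this probability averages to at most [1/4] over
    the two values of [k]; it averages to [1/2] for weights with one nonzero
    coordinate, and to at most [1] for the weight [0] ([vanishing_halves_le]).

    It remains to see that the exceptional weights are rare. Scalar
    matrices act by scalars, by Schur's lemma, so the sum [N] of the coordinates is the
    same for all the weights; replacing [rho] by its conjugate, one may assume
    [N >= 0].
    - For [N = 0] the exceptional weight is [0]. A vector of weight [0] killed by all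
      raising operators spans a trivial subrepresentation. Hence the [n - 1] simple
      raising operators embed the weight space of [0] into those of [n - 1] roots; as
      all [n (n - 1)] roots have the same multiplicity, the weight [0] takes up at most
      [d / (n + 1)] dimensions.
    - For [N > 1] the exceptional weights are the [N e_i], and the operator [E_21]
      embeds the weight space of [N e_1] into that of [(N - 1) e_1 + e_2], which has
      [n (n - 1) / 2] or more images under permutations.
    - For [N = 1] a vector of weight [e_1] killed by the raising operators generates a
      copy of the defining representation, which is excluded; the simple raising
      operators then embed the weight space of [e_1] into those of [2 e_1 - e_2] and of
      [n - 2] weights of the shape [e_1 + e_2 - e_3].
    Altogether ([weighted_gap]) the Fourier scalar is at most
    [(n + 4) / (4 (n + 1))], which is [2/5] for [n = 4] and decreases to [1/4].

    These arguments take place in the derived representation of the Lie algebra.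
    As [rho] is merely continuous, it has to be differentiated by hand: along the torus
    [rho] is given by integer powers, because continuous characters of the line are
    exponentials
    ([character_line]), and the spectral theorem then makes [rho] Lipschitz. So its
    first-order expansion at [1] along a curve of unitary matrices depends on the
    velocity only ([skew_derP]), and Cayley transforms provide the curves.

    On the side of measures, the mean [mu_ k n] is the law of [s a s^-1] for
    independent Haar distributed [s] in [U(n)] and [a] in [Gamma k]; centrality and
    symmetry are read off from the invariances of Haar measure, and traces, being
    class functions, do not see [s]. *)

Set Implicit Arguments.
Unset Strict Implicit.
Unset Printing Implicit Defensive.
Import Order.TTheory GRing.Theory Num.Theory.
Import numFieldNormedType.Exports.
Local Open Scope ring_scope.
Local Open Scope sesquilinear_scope.

(** * Unitary matrices *)

Section UnitaryMatrices.
Variable K : numClosedFieldType.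

Lemma opp_mxE m n (A : 'M[K]_(m, n)) : - A = -1 *: A.
Proof. by rewrite scaleN1r. Qed.

Lemma mulrn_mxE m n (A : 'M[K]_(m, n)) k : A *+ k = k%:R *: A.
Proof. by rewrite scaler_nat. Qed.

Lemma trmxC_mul m n p (A : 'M[K]_(m, n)) (B : 'M[K]_(n, p)) :
  (A *m B)^t* = B^t* *m A^t*.
Proof. by rewrite trmx_mul map_mxM. Qed.

Lemma trmxC_add m n (A B : 'M[K]_(m, n)) : (A + B)^t* = A^t* + B^t*.
Proof. by rewrite linearD map_mxD. Qed.

Lemma trmxC_opp m n (A : 'M[K]_(m, n)) : (- A)^t* = - A^t*.
Proof. by rewrite linearN map_mxN. Qed.

Lemma trmxC_scale m n (a : K) (A : 'M[K]_(m, n)) : (a *: A)^t* = a^* *: A^t*.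
Proof. by rewrite linearZ map_mxZ. Qed.

Lemma trmxC_scalar n (a : K) : (a%:M : 'M[K]_n)^t* = (a^*)%:M.
Proof. by rewrite tr_scalar_mx map_scalar_mx. Qed.

Lemma trmxC1 n : (1%:M : 'M[K]_n)^t* = 1%:M.
Proof. by rewrite trmxC_scalar conjC1. Qed.

Lemma trmxC_diag n (z : 'rV[K]_n) : (diag_mx z)^t* = diag_mx (map_mx Num.conj z).
Proof. by rewrite tr_diag_mx map_diag_mx. Qed.

Lemma unitarymx_mulC n (u : 'M[K]_n) : u \is unitarymx -> u *m u^t* = 1%:M.
Proof. by move/unitarymxP. Qed.

Lemma unitarymx_Cmul n (u : 'M[K]_n) : u \is unitarymx -> u^t* *m u = 1%:M.
Proof. by move/unitarymxP/mulmx1C. Qed.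

Lemma unitarymxC n (u : 'M[K]_n) : u \is unitarymx -> u^t* \is unitarymx.
Proof. by rewrite trmxC_unitary. Qed.

Lemma unitarymx1 n : (1%:M : 'M[K]_n) \is unitarymx.
Proof. by apply/unitarymxP; rewrite trmxC1 mulmx1. Qed.

Lemma diag_unitarymx n (z : 'rV[K]_n) :
  (forall i, `|z 0 i| = 1) -> diag_mx z \is unitarymx.
Proof.
move=> z1; apply/unitarymxP; rewrite trmxC_diag mulmx_diag -(diag_const_mx n (1%R : K)).
by congr diag_mx; apply/rowP=> i; rewrite !mxE -normCK z1 expr1n.
Qed.

Lemma unitarymx_entry_le1 n (u : 'M[K]_n) i j :
  u \is unitarymx -> `|u i j| <= 1.
Proof.
move/unitarymx_mulC/matrixP/(_ i i); rewrite !mxE eqxx /= => h.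
rewrite -(ler_pXn2r (n := 2)) ?nnegrE ?normr_ge0 // expr1n -[X in _ <= X]h.
rewrite (bigD1 j) //= !mxE -normCK lerDl sumr_ge0 // => k _.
by rewrite !mxE -normCK exprn_ge0.
Qed.

(** A unitary matrix is normal, and its diagonal form is again unitary, so the
    eigenvalues are unimodular. *)
Lemma unitarymx_spectral n (u : 'M[K]_n) : u \is unitarymx ->
  exists s : 'M[K]_n, exists z : 'rV[K]_n,
    [/\ s \is unitarymx, forall i, `|z 0 i| = 1 & u = s^t* *m diag_mx z *m s].
Proof.
move=> uu; have nu : u \is normalmx.
  by apply/normalmxP; rewrite unitarymx_mulC // unitarymx_Cmul.
have /orthomx_spectralP := nu; set s := spectralmx u; set z := spectral_diag u.
have su : s \is unitarymx by exact: spectral_unitarymx.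
rewrite invmx_unitary // => E; exists s, z; split => // i.
have : diag_mx z = s *m u *m s^t*.
  by rewrite E !mulmxA unitarymx_mulC // mul1mx -mulmxA unitarymx_mulC // mulmx1.
move=> E2; have : diag_mx z \is unitarymx.
  by rewrite E2 !mul_unitarymx // unitarymxC.
move/unitarymx_mulC; rewrite trmxC_diag mulmx_diag => /matrixP/(_ i i).
rewrite !mxE eqxx /= !mulr1n -normCK => /eqP.
by rewrite sqrp_eq1 ?normr_ge0 // => /eqP.
Qed.

(** A skew-Hermitian matrix is normal and its diagonal form is again skew-Hermitian.
    The eigenbasis is named because derivatives are defined from it below. *)
Lemma skewmx_spectral n (Y : 'M[K]_n) (s := spectralmx Y) (z := spectral_diag Y) :
  Y^t* = - Y ->
  [/\ s \is unitarymx, forall i, (z 0 i)^* = - z 0 i & Y = s^t* *m diag_mx z *m s].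
Proof.
move=> sk; have nu : Y \is normalmx.
  by apply/normalmxP; rewrite sk mulNmx mulmxN.
have /orthomx_spectralP := nu; rewrite -/s -/z.
have su : s \is unitarymx by exact: spectral_unitarymx.
rewrite invmx_unitary // => E; split => // i.
have E2 : diag_mx z = s *m Y *m s^t*.
  by rewrite E !mulmxA unitarymx_mulC // mul1mx -mulmxA unitarymx_mulC // mulmx1.
have : (diag_mx z)^t* = - diag_mx z.
  by rewrite E2 !trmxC_mul trmxCK sk mulNmx mulmxN mulmxA.
by rewrite trmxC_diag => /matrixP/(_ i i); rewrite !mxE eqxx /= !mulr1n.
Qed.

End UnitaryMatrices.

(** * First-order expansions of curves of matrices *)

Section BigO.
Variable K : numClosedFieldType.

(** Remainders are estimated on [0 < t <= 1]: the order of a numerical closed field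
    makes such [t] real. *)
Definition bigO (k : nat) p q (F : K -> 'M[K]_(p, q)) : Prop :=
  exists2 c : K, 0 <= c &
    forall t, 0 < t <= 1 -> forall i j, `|F t i j| <= c * t ^+ k.

Lemma bigO_ext k p q (F G : K -> 'M[K]_(p, q)) :
  (forall t, 0 < t <= 1 -> F t = G t) -> bigO k F -> bigO k G.
Proof. by move=> FG [c c0 h]; exists c => // t t01 i j; rewrite -FG // h. Qed.

Lemma bigOD k p q (F G : K -> 'M[K]_(p, q)) :
  bigO k F -> bigO k G -> bigO k (fun t => F t + G t).
Proof.
move=> [c c0 h] [c' c'0 h']; exists (c + c'); first exact: addr_ge0.
move=> t t01 i j; rewrite mxE mulrDl (le_trans (ler_normD _ _)) //.
by rewrite lerD ?h ?h'.
Qed.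

Lemma bigON k p q (F : K -> 'M[K]_(p, q)) : bigO k F -> bigO k (fun t => - F t).
Proof. by move=> [c c0 h]; exists c => // t t01 i j; rewrite mxE normrN h. Qed.

Lemma bigOM k l p q r (F : K -> 'M[K]_(p, q)) (G : K -> 'M[K]_(q, r)) :
  bigO k F -> bigO l G -> bigO (k + l) (fun t => F t *m G t).
Proof.
move=> [c c0 h] [c' c'0 h']; exists (\sum_(j < q) c * c').
  by rewrite sumr_ge0 // => _ _; rewrite mulr_ge0.
move=> t t01 i j; rewrite mxE (le_trans (ler_norm_sum _ _ _)) //.
rewrite mulr_suml; apply: ler_sum => m _.
rewrite normrM exprD mulrACA ler_pM ?normr_ge0 ?h ?h' //.
Qed.

Lemma bigOW k l p q (F : K -> 'M[K]_(p, q)) : (l <= k)%N -> bigO k F -> bigO l F.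
Proof.
move=> lk [c c0 h]; exists c => // t t01 i j; rewrite (le_trans (h _ t01 _ _)) //.
case/andP: t01 => t0 t1; rewrite ler_wpM2l // -(subnKC lk) exprD ler_piMr //.
  by rewrite exprn_ge0 // ltW.
by rewrite exprn_ile1 // ltW.
Qed.

Lemma bigO_cst p q (A : 'M[K]_(p, q)) : bigO 0 (fun=> A).
Proof.
exists (\sum_i \sum_j `|A i j|).
  by rewrite sumr_ge0 // => i _; rewrite sumr_ge0.
move=> t _ i j; rewrite expr0 mulr1 (bigD1 i) //= (bigD1 j) //= -addrA lerDl.
by rewrite addr_ge0 // sumr_ge0 // => k _; rewrite sumr_ge0.
Qed.

Lemma bigOZ k p q (F : K -> 'M[K]_(p, q)) :
  bigO k F -> bigO k.+1 (fun t => t *: F t).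
Proof.
move=> [c c0 h]; exists c => // t t01 i j; case/andP: (t01) => t0 t1.
by rewrite mxE normrM gtr0_norm // exprS mulrCA ler_wpM2l ?h // ltW.
Qed.

Lemma bigO_trC k p q (F : K -> 'M[K]_(p, q)) :
  bigO k F -> bigO k (fun t => (F t)^t*).
Proof.
by move=> [c c0 h]; exists c => // t t01 i j; rewrite !mxE norm_conjC h.
Qed.

(** Dividing by [t], every entry of [A] is at most [c t] for all small [t]. *)
Lemma bigO2_linear_eq0 p q (A : 'M[K]_(p, q)) : bigO 2 (fun t => t *: A) -> A = 0.
Proof.
move=> [c c0 h]; apply/matrixP => i j; rewrite mxE; apply/eqP/contraT => Aij.
have x0 : 0 < `|A i j| by rewrite normr_gt0.
set x := `|A i j| in x0; set c' := c + x.
have c'0 : 0 < c' by rewrite ltr_wpDl.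
set t := x / (2 * c').
have t0 : 0 < t by rewrite divr_gt0 // mulr_gt0 // ltr0n.
have t1 : t <= 1.
  rewrite ler_pdivrMr ?mulr_gt0 ?ltr0n // mul1r mulr_natl mulr2n.
  by rewrite (le_trans (y := c')) ?lerDl ?lerDr // ltW.
have := h t; rewrite t0 t1 => /(_ isT i j); rewrite mxE normrM gtr0_norm //.
rewrite -/x expr2 mulrCA ler_pM2l // => le1.
have : x <= x / 2.
  rewrite (le_trans le1) // (le_trans (y := c' * t)) //.
    by rewrite ler_wpM2r ?(ltW t0) // lerDl ltW.
  by rewrite /t mulrCA invfM [_^-1 * _^-1]mulrC mulVKf // gt_eqF.
rewrite ler_pdivlMr ?ltr0n // ger_pMr // -[X in _ <= X]addr0 -[2]/(1 + 1) lerD2l.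
by rewrite ler10.
Qed.

(** First-order Taylor expansions at the identity, with a quadratic remainder: an
    algebraic form of differentiability which products and adjoints preserve. *)
Definition jet n (F : K -> 'M[K]_n) (A : 'M[K]_n) : Prop :=
  bigO 2 (fun t => F t - 1%:M - t *: A).

Lemma jet_sub1 n (F : K -> 'M[K]_n) A : jet F A -> bigO 1 (fun t => F t - 1%:M).
Proof.
move=> jF; have := bigOD (bigOW (leqnSn 1) jF) (bigOZ (bigO_cst A)).
by apply: bigO_ext => t _; rewrite subrK.
Qed.

Lemma jet_bounded n (F : K -> 'M[K]_n) A : jet F A -> bigO 0 F.
Proof.
move=> /jet_sub1 jF; have := bigOD (bigOW (leq0n 1) jF) (bigO_cst 1%:M).
by apply: bigO_ext => t _; rewrite subrK.
Qed.

Lemma jetM n (F G : K -> 'M[K]_n) A B :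
  jet F A -> jet G B -> jet (fun t => F t *m G t) (A + B).
Proof.
move=> jF jG; have h1 := bigOM jF (jet_bounded jG).
have h2 := bigOZ (bigOM (bigO_cst A) (jet_sub1 jG)).
apply: bigO_ext (bigOD (bigOD h1 jG) h2) => t _ /=.
rewrite !mulmxBl mulmxBr mul1mx mulmx1 -!scalemxAl !scalerDr !scalerN.
apply/matrixP=> i j; rewrite !mxE; ring.
Qed.

Lemma jet_unique n (F : K -> 'M[K]_n) A B : jet F A -> jet F B -> A = B.
Proof.
move=> jA jB; apply/eqP; rewrite -subr_eq0; apply/eqP/bigO2_linear_eq0.
apply: bigO_ext (bigOD jB (bigON jA)) => t _ /=.
apply/matrixP=> i j; rewrite !mxE; ring.
Qed.

Lemma jet_trC n (F : K -> 'M[K]_n) A : jet F A -> jet (fun t => (F t)^t*) (A^t*).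
Proof.
move/bigO_trC; apply: bigO_ext => t /andP[t0 _].
by rewrite !trmxC_add !trmxC_opp trmxC_scale trmxC1 geC0_conj // ltW.
Qed.

Lemma jet_conj n p (F : K -> 'M[K]_n) A (u : 'M[K]_(p, n)) v : u *m v = 1%:M ->
  jet F A -> jet (fun t => u *m F t *m v) (u *m A *m v).
Proof.
move=> uv jF; apply: bigO_ext (bigOM (bigOM (bigO_cst u) jF) (bigO_cst v)) => t _.
by rewrite !mulmxBr !mulmxBl mulmx1 uv -scalemxAr -scalemxAl.
Qed.

End BigO.

Section ScalarJets.
Variable K : numClosedFieldType.

Lemma bigO_sum k p q (I : Type) (r : seq I) (F : I -> K -> 'M[K]_(p, q)) :
  (forall i, bigO k (F i)) -> bigO k (fun t => \sum_(i <- r) F i t).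
Proof.
move=> h; elim: r => [|i r IH].
  apply: (bigO_ext (F := fun=> 0)) => [t _|]; first by rewrite big_nil.
  by exists 0 => // t _ i j; rewrite mxE normr0 mul0r.
by apply: bigO_ext (bigOD (h i) IH) => t _; rewrite big_cons.
Qed.

Lemma bigO_diag k n (f : 'I_n -> K -> K) :
  (forall i, bigO k (fun t => (f i t)%:M : 'M[K]_1)) ->
  bigO k (fun t => diag_mx (\row_i f i t)).
Proof.
move=> /fin_all_exists2[c c0 h]; exists (\sum_i c i); first exact: sumr_ge0.
move=> t t01 i j; have /(_ 0 0) := h i t t01; rewrite !mxE eqxx mulr1n => hi.
rewrite mulr_suml (bigD1 i) //= -[X in X <= _]addr0 lerD //.
  case: eqP => // _; rewrite mulr0n normr0 mulr_ge0 //.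
  by case/andP: t01 => t0 _; rewrite exprn_ge0 // ltW.
case/andP: t01 => t0 _.
by rewrite sumr_ge0 // => l _; rewrite mulr_ge0 // exprn_ge0 // ltW.
Qed.

Lemma bigO_entry k p q m (F : K -> 'M[K]_(p, q)) i j :
  bigO k F -> bigO k (fun t => (F t i j)%:M : 'M[K]_m).
Proof.
move=> [c c0 h]; exists c => // t t01 a b; rewrite mxE; case: eqP => _.
  by rewrite mulr1n h.
by rewrite mulr0n normr0 mulr_ge0 // exprn_ge0 // ltW //; case/andP: t01.
Qed.

Definition sjet (f : K -> K) (a : K) := jet (fun t => (f t)%:M : 'M[K]_1) a%:M.

Lemma sjetM f g a b : sjet f a -> sjet g b -> sjet (fun t => f t * g t) (a + b).
Proof.
rewrite /sjet => jf jg; have := jetM jf jg; rewrite -raddfD; apply: bigO_ext => t _.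
by rewrite -scalar_mxM.
Qed.

Lemma sjet1 : sjet (fun=> 1) 0.
Proof.
exists 0 => // t _ i j.
by rewrite raddf0 scaler0 subr0 subrr mxE normr0 mul0r.
Qed.

Lemma sjet_ext f g a : (forall t, 0 < t <= 1 -> f t = g t) -> sjet f a -> sjet g a.
Proof. by move=> fg; apply: bigO_ext => t t01; rewrite fg. Qed.

Lemma sjetX f a m : sjet f a -> sjet (fun t => f t ^+ m) (m%:R * a).
Proof.
move=> jf; elim: m => [|m IH]; first by rewrite mul0r; exact: sjet1.
have := sjetM jf IH; rewrite -[m.+1]add1n natrD mulrDl mul1r.
by apply: sjet_ext => t _; rewrite exprS.
Qed.

(** On the unit circle the inverse is the conjugate. *)
Lemma sjetV f a : (forall t, 0 < t <= 1 -> `|f t| = 1) -> a^* = - a ->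
  sjet f a -> sjet (fun t => (f t)^-1) (- a).
Proof.
move=> f1 sa /jet_trC; rewrite trmxC_scalar sa; apply: bigO_ext => t t01.
rewrite trmxC_scalar; congr (_%:M - _ - _).
by apply/esym/(@mulfI _ (f t)); rewrite -?normCK ?f1 ?expr1n ?divff // -normr_gt0 f1.
Qed.

Lemma sjet_exprz f a (m : int) : (forall t, 0 < t <= 1 -> `|f t| = 1) ->
  a^* = - a -> sjet f a -> sjet (fun t => exprz (f t) m) (m%:~R * a).
Proof.
move=> f1 sa jf; case: m => m; first exact: sjetX.
have h := sjetX m.+1 (sjetV f1 sa jf); rewrite [X in X%:~R]NegzE.
rewrite mulrNz mulNr -mulrN; apply: sjet_ext h => t _.
by rewrite exprVn NegzE exprnN.
Qed.

Lemma sjet_prod (I : Type) (r : seq I) (f : I -> K -> K) a :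
  (forall i, sjet (f i) (a i)) ->
  sjet (fun t => \prod_(i <- r) f i t) (\sum_(i <- r) a i).
Proof.
move=> h; elim: r => [|i r IH].
  by rewrite big_nil; apply: sjet_ext sjet1 => t _; rewrite big_nil.
by rewrite big_cons; apply: sjet_ext (sjetM (h i) IH) => t _; rewrite big_cons.
Qed.

Lemma jet_diag n (f : 'I_n -> K -> K) a : (forall i, sjet (f i) (a i)) ->
  jet (fun t => diag_mx (\row_i f i t)) (diag_mx (\row_i a i)).
Proof.
move=> h; have := @bigO_diag 2 n (fun i t => f i t - 1 - t * a i).
move=> H; apply: bigO_ext (H _) => [t _|i].
  by apply/matrixP=> i j; rewrite !mxE; case: eqP => _; rewrite ?mulr1n ?mulr0n ?mulr0 ?subr0.
by apply: bigO_ext (h i) => t _; rewrite !raddfB /= scale_scalar_mx.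
Qed.

(** The Cayley transform maps the imaginary axis into the unit circle; it
    parametrizes curves through 1 by rational functions. *)
Definition cayley (v : K) : K := (1 + v) / (1 - v).

Lemma cayley_den_ge1 (v : K) : v^* = - v -> 1 <= `|1 - v|.
Proof.
move=> sv; rewrite -(ler_pXn2r (n := 2)) ?nnegrE ?normr_ge0 // expr1n normCK.
rewrite rmorphB rmorph1 /= sv opprK.
have -> : (1 - v) * (1 + v) = 1 + v * (- v) by ring.
by rewrite -sv -normCK lerDl exprn_ge0.
Qed.

Lemma cayley_den_neq0 (v : K) : v^* = - v -> 1 - v != 0.
Proof. by move/cayley_den_ge1 => h; rewrite -normr_gt0 (lt_le_trans ltr01). Qed.

Lemma norm_cayley (v : K) : v^* = - v -> `|cayley v| = 1.
Proof.
move=> sv; rewrite normrM normfV -norm_conjC rmorphD rmorph1 /= sv divff //.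
by rewrite normr_eq0 cayley_den_neq0.
Qed.

(** The remainder is [t^2 a^2 / 2] divided by [1 - t a / 2], whose modulus is at
    least 1. *)
Lemma cayley_jet (a : K) : a^* = - a -> sjet (fun t => cayley (t * (a / 2))) a.
Proof.
move=> sa; exists (`|a| ^+ 2); first by rewrite exprn_ge0.
move=> t /andP[t0 t1] i j; rewrite !ord1 !mxE !eqxx !mulr1n.
have sv : (t * (a / 2))^* = - (t * (a / 2)).
  by rewrite !rmorphM /= sa fmorphV /= conjC_nat geC0_conj ?(ltW t0) // mulNr mulrN.
have d0 := cayley_den_neq0 sv; have d1 := cayley_den_ge1 sv.
have -> : cayley (t * (a / 2)) - 1 - t * a =
    t ^+ 2 * a ^+ 2 / 2 / (1 - t * (a / 2)).
  have E : t * a = 2 * (t * (a / 2)) by field.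
  have E2 : t ^+ 2 * a ^+ 2 / 2 = 2 * (t * (a / 2)) ^+ 2 by field.
  by rewrite E2 [X in _ - X]E /cayley; move: (t * (a / 2)) d0 => v d0; field.
rewrite -mulrA normrM normrM !normrX (gtr0_norm t0) [X in _ <= X]mulrC ler_piMr //.
  by rewrite mulr_ge0 ?exprn_ge0 // ltW.
rewrite normrM !normfV normr_nat mulr_ile1 ?invr_ge0 // invf_le1 ?ltr0n ?ler1n //.
by rewrite (lt_le_trans ltr01).
Qed.

End ScalarJets.

(** * Derived representations *)

Section Reps.
Variable K : numClosedFieldType.

(** Unitary representations of [U(n)], presented as functions of matrices so that
    matrix computations carry no proofs of unitarity. *)
Record urep n d (pi : 'M[K]_n -> 'M[K]_d) : Prop := Urep {
  urep_unitary : forall u, u \is unitarymx -> pi u \is unitarymx;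
  urepM : forall u v, u \is unitarymx -> v \is unitarymx ->
    pi (u *m v) = pi u *m pi v }.

(** The standard basis consists of weight vectors for the diagonal torus. *)
Definition weighted n d (pi : 'M[K]_n -> 'M[K]_d) (alpha : 'I_d -> 'I_n -> int) :
    Prop :=
  forall z : 'rV[K]_n, (forall i, `|z 0 i| = 1) ->
    pi (diag_mx z) = diag_mx (\row_a \prod_i exprz (z 0 i) (alpha a i)).

Lemma urep1 n d (pi : 'M[K]_n -> 'M[K]_d) : urep pi -> pi 1%:M = 1%:M.
Proof.
move=> [piu piM]; have u1 := unitarymx1 K n.
have h := unitarymx_mulC (piu _ u1).
by rewrite -{1}h -{2}(mulmx1 1%:M) piM // -mulmxA h mulmx1.
Qed.

Lemma urepV n d (pi : 'M[K]_n -> 'M[K]_d) u : urep pi -> u \is unitarymx ->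
  pi (u^t*) = (pi u)^t*.
Proof.
move=> rpi uu; have [piu piM] := rpi.
rewrite -[LHS]mulmx1 -(unitarymx_mulC (piu _ uu)) mulmxA -piM ?unitarymxC //.
by rewrite unitarymx_Cmul // urep1 // mul1mx.
Qed.

Lemma urep_conjugate n d (pi : 'M[K]_n -> 'M[K]_d) (Q : 'M[K]_d) :
  Q \is unitarymx -> urep pi -> urep (fun M => Q *m pi M *m Q^t*).
Proof.
move=> uQ [piu piM]; split=> [u uu|u v uu uv].
  by rewrite !mul_unitarymx ?unitarymxC ?piu.
by rewrite piM // !mulmxA -(mulmxA _ (Q^t*) Q) unitarymx_Cmul // mulmx1.
Qed.

Lemma norm_exprz_sub1 (z : K) (m : int) : `|z| = 1 ->
  `|exprz z m - 1| <= `|m|%:~R * `|z - 1|.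
Proof.
move=> z1; have nat_case (w : K) k : `|w| = 1 -> `|w ^+ k - 1| <= k%:R * `|w - 1|.
  move=> w1; elim: k => [|k IH]; first by rewrite subrr normr0 mul0r.
  have -> : w ^+ k.+1 - 1 = w * (w ^+ k - 1) + (w - 1) by rewrite exprS; ring.
  rewrite (le_trans (ler_normD _ _)) // normrM w1 mul1r -addn1 natrD mulrDl mul1r.
  by rewrite lerD2r.
case: m => m; first exact: nat_case.
have zi1 : `|z^-1| = 1 by rewrite normfV z1 invr1.
have z0 : z != 0 by rewrite -normr_gt0 z1.
have := nat_case z^-1 m.+1 zi1; rewrite [X in exprz z X]NegzE -exprnN exprVn.
suff -> : `|z^-1 - 1| = `|z - 1| by [].
have -> : z^-1 - 1 = - (z^-1 * (z - 1)) by field.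
by rewrite normrN normrM zi1 mul1r.
Qed.

Lemma norm_prod_sub1 (I : Type) (r : seq I) (x : I -> K) (e : I -> K) :
  (forall i, `|x i| = 1) -> (forall i, `|x i - 1| <= e i) ->
  `|\prod_(i <- r) x i - 1| <= \sum_(i <- r) e i.
Proof.
move=> x1 xe; elim: r => [|i r IH]; first by rewrite !big_nil subrr normr0.
rewrite !big_cons; set p := \prod_(j <- r) _ in IH *.
have -> : x i * p - 1 = x i * (p - 1) + (x i - 1) by ring.
by rewrite (le_trans (ler_normD _ _)) // normrM x1 mul1r addrC lerD.
Qed.

Section Weighted.
Variables (n d : nat) (pi : 'M[K]_n -> 'M[K]_d) (alpha : 'I_d -> 'I_n -> int).
Hypotheses (rpi : urep pi) (wpi : weighted pi alpha).

(** Conjugate [g] to a diagonal matrix [z]: the entries of [z - 1] are controlled by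
    those of [g - 1], and [|z^m - 1| <= |m| |z - 1|] on the unit circle. *)
Lemma rep_lipschitz : exists2 c : K, 0 <= c &
  forall g e, g \is unitarymx -> (forall i j, `|(g - 1%:M) i j| <= e) ->
  forall a b, `|(pi g - 1%:M) a b| <= c * e.
Proof.
exists (\sum_a \sum_i `|alpha a i|%:~R * (\sum_(j < n) \sum_(k < n) 1)).
  rewrite sumr_ge0 // => a _; rewrite sumr_ge0 // => i _.
  by rewrite mulr_ge0 ?ler0z // sumr_ge0 // => j _; rewrite sumr_ge0.
move=> g e gu ge; have [s [z [su z1 E]]] := unitarymx_spectral gu.
have zE : diag_mx z - 1%:M = s *m (g - 1%:M) *m s^t*.
  rewrite mulmxBr mulmxBl mulmx1 unitarymx_mulC // E !mulmxA unitarymx_mulC //.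
  by rewrite mul1mx -mulmxA unitarymx_mulC // mulmx1.
have z_bound i : `|z 0 i - 1| <= (\sum_(j < n) \sum_(k < n) 1) * e.
  have /matrixP/(_ i i) := zE; rewrite !mxE eqxx !mulr1n => ->.
  rewrite (le_trans (ler_norm_sum _ _ _)) // mulr_suml ler_sum // => j _.
  rewrite normrM mulrC -[X in _ <= X]mul1r ler_pM //.
    by rewrite !mxE norm_conjC unitarymx_entry_le1.
  rewrite mxE (le_trans (ler_norm_sum _ _ _)) // mulr_suml ler_sum // => k _.
  by rewrite normrM ler_pM // unitarymx_entry_le1.
have [piu piM] := rpi.
have uz : diag_mx z \is unitarymx by exact: diag_unitarymx.
have pis := piu _ su.
have piE : pi g - 1%:M =
    (pi s)^t* *m (diag_mx (\row_a \prod_i exprz (z 0 i) (alpha a i)) - 1%:M) *m pi s.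
  rewrite E !piM ?mul_unitarymx ?unitarymxC // urepV // wpi //.
  by rewrite mulmxBr mulmxBl mulmx1 unitarymx_Cmul.
move=> a b; rewrite piE -diag_const_mx -linearB -mulmxA mul_diag_mx mxE.
rewrite (le_trans (ler_norm_sum _ _ _)) // mulr_suml ler_sum // => c _.
rewrite !mxE normrM norm_conjC -[X in _ <= X]mul1r ler_pM ?unitarymx_entry_le1 //.
rewrite normrM -[X in _ <= X]mulr1 ler_pM ?unitarymx_entry_le1 //.
rewrite mulr_suml norm_prod_sub1 // => i.
  by case: (alpha c i) => m; rewrite ?NegzE -?exprnN ?normfV normrX z1 expr1n ?invr1.
by rewrite (le_trans (norm_exprz_sub1 _ _)) // -mulrA ler_wpM2l // ler0z.
Qed.

Lemma rep_bigO2 (g : K -> 'M[K]_n) :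
  (forall t, 0 < t <= 1 -> g t \is unitarymx) ->
  bigO 2 (fun t => g t - 1%:M) -> bigO 2 (fun t => pi (g t) - 1%:M).
Proof.
have [c c0 h] := rep_lipschitz; move=> gu [c' c'0 h'].
exists (c * c'); first exact: mulr_ge0.
by move=> t t01 a b; rewrite -mulrA h ?gu // => i j; exact: h'.
Qed.

(** The derivative of [weighted] representations along the torus. *)
Definition wdiag (z : 'rV[K]_n) : 'M[K]_d :=
  diag_mx (\row_a \sum_i (alpha a i)%:~R * z 0 i).

(** The value of the derived representation at a skew-Hermitian matrix, read off from
    one diagonalization; by [skew_derE] any other gives the same result. *)
Definition skew_der (Y : 'M[K]_n) : 'M[K]_d :=
  (pi (spectralmx Y))^t* *m wdiag (spectral_diag Y) *m pi (spectralmx Y).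

(** Cayley transforms of the eigenvalues give a curve with prescribed velocity in a
    conjugate of the torus, where the representation is explicit. *)
Lemma spectral_curve (s : 'M[K]_n) (z : 'rV[K]_n) :
  s \is unitarymx -> (forall i, (z 0 i)^* = - z 0 i) ->
  exists c : K -> 'M[K]_n, [/\ forall t, 0 < t <= 1 -> c t \is unitarymx,
    jet c (s^t* *m diag_mx z *m s) &
    jet (fun t => pi (c t)) ((pi s)^t* *m wdiag z *m pi s)].
Proof.
move=> su sz; set f := fun i t => cayley (t * (z 0 i / 2)).
have f1 i t : 0 < t <= 1 -> `|f i t| = 1.
  move=> /andP[t0 _]; apply: norm_cayley.
  by rewrite !rmorphM /= sz fmorphV /= conjC_nat geC0_conj ?(ltW t0) // mulNr mulrN.
have uf t : 0 < t <= 1 -> diag_mx (\row_i f i t) \is unitarymx.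
  by move=> t01; apply: diag_unitarymx => i; rewrite mxE f1.
have jf i : sjet (f i) (z 0 i) by exact: cayley_jet.
exists (fun t => s^t* *m diag_mx (\row_i f i t) *m s); split.
- by move=> t t01; rewrite !mul_unitarymx ?unitarymxC ?uf.
- apply: jet_conj; first exact: unitarymx_Cmul.
  suff -> : z = \row_i z 0 i by exact: jet_diag.
  by apply/rowP=> i; rewrite mxE.
have [piu piM] := rpi.
have J : jet (fun t => diag_mx (\row_a \prod_i exprz (f i t) (alpha a i))) (wdiag z).
  apply: (jet_diag (f := fun a t => \prod_i exprz (f i t) (alpha a i))) => a.
  apply: sjet_prod => i; apply: sjet_exprz => // t t01; exact: f1.
have := jet_conj (unitarymx_Cmul (piu _ su)) J; apply: bigO_ext => t t01.
rewrite !piM ?urepV ?mul_unitarymx ?unitarymxC ?uf // wpi => [|i]; last first.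
  by rewrite mxE f1.
suff -> : \row_a \prod_i exprz ((\row_i f i t) 0 i) (alpha a i) =
    \row_a \prod_i exprz (f i t) (alpha a i) by [].
by apply/rowP=> a; rewrite !mxE; apply: eq_bigr => i _; rewrite mxE.
Qed.

(** Let [c] be the curve of [spectral_curve] with the same velocity as [g]. Then
    [c^* g] is [1 + O(t^2)], hence so is its image, because the representation is
    Lipschitz; multiply by the image of [c]. *)
Lemma skew_derP (s : 'M[K]_n) (z : 'rV[K]_n) (g : K -> 'M[K]_n) :
  s \is unitarymx -> (forall i, (z 0 i)^* = - z 0 i) ->
  (forall t, 0 < t <= 1 -> g t \is unitarymx) ->
  jet g (s^t* *m diag_mx z *m s) ->
  jet (fun t => pi (g t)) ((pi s)^t* *m wdiag z *m pi s).
Proof.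
move=> su sz gu jg; have [c [cu jc jpic]] := spectral_curve su sz.
have [piu piM] := rpi.
have jh := jetM (jet_trC jc) jg.
have Z : (s^t* *m diag_mx z *m s)^t* + s^t* *m diag_mx z *m s = 0.
  rewrite !trmxC_mul trmxCK trmxC_diag mulmxA -mulmxDl -mulmxDr -linearD.
  suff -> : map_mx Num.conj z + z = 0 by rewrite linear0 mulmx0 mul0mx.
  by apply/rowP=> i; rewrite !mxE sz addNr.
rewrite Z in jh.
have hu t : 0 < t <= 1 -> (c t)^t* *m g t \is unitarymx.
  by move=> t01; rewrite mul_unitarymx ?unitarymxC ?cu ?gu.
have jph : jet (fun t => pi ((c t)^t* *m g t)) 0.
  apply: bigO_ext (rep_bigO2 hu _) => [t _|]; first by rewrite scaler0 subr0.
  by apply: bigO_ext jh => t _; rewrite scaler0 subr0.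
have := jetM jpic jph; rewrite addr0; apply: bigO_ext => t t01.
by rewrite -piM ?cu ?hu // mulmxA unitarymx_mulC ?cu // mul1mx.
Qed.

Lemma skew_derE (s : 'M[K]_n) (z : 'rV[K]_n) :
  s \is unitarymx -> (forall i, (z 0 i)^* = - z 0 i) ->
  skew_der (s^t* *m diag_mx z *m s) = (pi s)^t* *m wdiag z *m pi s.
Proof.
move=> su sz; set Y := (X in skew_der X).
have sY : Y^t* = - Y.
  rewrite /Y !trmxC_mul trmxCK trmxC_diag mulmxA -mulNmx -mulmxN -linearN.
  by congr (_ *m diag_mx _ *m _); apply/rowP=> i; rewrite !mxE sz.
have [su' sz' E] := skewmx_spectral sY; have [c [cu jc jp]] := spectral_curve su sz.
by apply: jet_unique jp; rewrite -/Y {1}E in jc; exact: (skew_derP su' sz' cu jc).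
Qed.

Lemma skew_der_jet (Y : 'M[K]_n) (g : K -> 'M[K]_n) : Y^t* = - Y ->
  (forall t, 0 < t <= 1 -> g t \is unitarymx) -> jet g Y ->
  jet (fun t => pi (g t)) (skew_der Y).
Proof.
move=> sY gu; have [su sz E] := skewmx_spectral sY; rewrite {1}E => jg.
exact: (skew_derP su sz gu jg).
Qed.

Lemma skew_curve (Y : 'M[K]_n) : Y^t* = - Y -> exists c : K -> 'M[K]_n,
  [/\ forall t, 0 < t <= 1 -> c t \is unitarymx, jet c Y &
    jet (fun t => pi (c t)) (skew_der Y)].
Proof.
move=> sY; have [su sz E] := skewmx_spectral sY.
by have [c [cu jc jp]] := spectral_curve su sz; exists c; rewrite {1}E.
Qed.

(** The product of two curves has the sum of their velocities. *)
Lemma skew_derD (Y Z : 'M[K]_n) : Y^t* = - Y -> Z^t* = - Z ->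
  skew_der (Y + Z) = skew_der Y + skew_der Z.
Proof.
move=> sY sZ; have [c [cu jc jp]] := skew_curve sY.
have [c' [cu' jc' jp']] := skew_curve sZ; have [piu piM] := rpi.
apply: jet_unique (jetM jp jp').
have ccu t : 0 < t <= 1 -> c t *m c' t \is unitarymx.
  by move=> t01; rewrite mul_unitarymx ?cu ?cu'.
have : jet (fun t => pi (c t *m c' t)) (skew_der (Y + Z)).
  by apply: skew_der_jet (jetM jc jc') => //; rewrite trmxC_add sY sZ opprD.
by apply: bigO_ext => t t01; rewrite piM ?cu ?cu'.
Qed.

Lemma skew_derZ (a : K) (Y : 'M[K]_n) : a^* = a -> Y^t* = - Y ->
  skew_der (a *: Y) = a *: skew_der Y.
Proof.
move=> ra sY; have [su sz E] := skewmx_spectral sY.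
rewrite [in LHS]E scalemxAl scalemxAr -linearZ skew_derE //; last first.
  by move=> i; rewrite mxE rmorphM /= ra sz mulrN.
rewrite /skew_der scalemxAl scalemxAr; congr (_ *m _ *m _).
rewrite /wdiag -linearZ; congr diag_mx; apply/rowP=> b; rewrite !mxE mulr_sumr.
by apply: eq_bigr => i _; rewrite mxE mulrCA.
Qed.

Lemma skew_derJ (u Y : 'M[K]_n) : u \is unitarymx -> Y^t* = - Y ->
  skew_der (u *m Y *m u^t*) = pi u *m skew_der Y *m (pi u)^t*.
Proof.
move=> uu sY; have [su sz E] := skewmx_spectral sY; have [piu piM] := rpi.
have -> : u *m Y *m u^t* = (spectralmx Y *m u^t*)^t* *m
    diag_mx (spectral_diag Y) *m (spectralmx Y *m u^t*).
  by rewrite [in LHS]E trmxC_mul trmxCK !mulmxA.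
rewrite skew_derE ?mul_unitarymx ?unitarymxC // piM ?unitarymxC // urepV //.
by rewrite trmxC_mul trmxCK /skew_der !mulmxA.
Qed.

Lemma skew_der_trC (Y : 'M[K]_n) : Y^t* = - Y ->
  (skew_der Y)^t* = - skew_der Y.
Proof.
move=> sY; have [su sz E] := skewmx_spectral sY.
rewrite /skew_der !trmxC_mul trmxCK trmxC_diag mulmxA -mulNmx -mulmxN -linearN.
congr (_ *m diag_mx _ *m _); apply/rowP=> a; rewrite !mxE rmorph_sum /= -sumrN.
by apply: eq_bigr => i _; rewrite rmorphM /= sz rmorph_int mulrN.
Qed.

Lemma skew_der_diag (z : 'rV[K]_n) : (forall i, (z 0 i)^* = - z 0 i) ->
  skew_der (diag_mx z) = wdiag z.
Proof.
move=> sz; have := skew_derE (unitarymx1 K n) sz.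
by rewrite (urep1 rpi) !trmxC1 !mul1mx !mulmx1.
Qed.

(** The skew-Hermitian part; every matrix is [skew X + 'i skew (- 'i X)], which
    is how a real-linear map on skew-Hermitian matrices is complexified. *)
Definition skew (X : 'M[K]_n) : 'M[K]_n := 2^-1 *: (X - X^t*).

Lemma skew_trC X : (skew X)^t* = - skew X.
Proof.
by rewrite trmxC_scale trmxC_add trmxC_opp trmxCK fmorphV /= conjC_nat -scalerN opprB addrC.
Qed.

Lemma skewD X Y : skew (X + Y) = skew X + skew Y.
Proof. by rewrite /skew trmxC_add -scalerDr opprD addrACA. Qed.

Lemma skewZ a X : a^* = a -> skew (a *: X) = a *: skew X.
Proof. by move=> ra; rewrite /skew trmxC_scale ra -scalerBr !scalerA mulrC. Qed.

Lemma skewN X : skew (- X) = - skew X.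
Proof. by rewrite -(scaleN1r X) -[RHS]scaleN1r skewZ // rmorphN1. Qed.

Lemma skew_trC_arg X : skew (X^t*) = - skew X.
Proof. by rewrite /skew trmxCK -scalerN opprB. Qed.

Lemma skewJ u X : skew (u *m X *m u^t*) = u *m skew X *m u^t*.
Proof.
have E : (u *m X *m u^t*)^t* = u *m X^t* *m u^t*.
  by rewrite (trmxC_mul (u *m X)) (trmxC_mul u X) trmxCK mulmxA.
by rewrite /skew E -scalemxAr -scalemxAl mulmxBr mulmxBl.
Qed.

Lemma skew_decomp X : X = skew X + 'i *: skew (- 'i *: X).
Proof.
rewrite /skew trmxC_scale rmorphN /= conjCi opprK scalerBr !scalerA.
apply/matrixP=> i j; rewrite !mxE.
have ii : 'i * 'i = -1 :> K by rewrite -expr2 sqrCi.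
have -> : 'i / 2 * (- 'i * X i j - 'i * (X j i)^*) =
  - ('i * 'i) / 2 * (X i j + (X j i)^*) :> K by ring.
by rewrite ii; field.
Qed.

(** The derived representation of the Lie algebra of all matrices, extended
    complex-linearly from the skew-Hermitian ones. *)
Definition der (X : 'M[K]_n) : 'M[K]_d :=
  skew_der (skew X) + 'i *: skew_der (skew (- 'i *: X)).

Lemma derD X Y : der (X + Y) = der X + der Y.
Proof.
rewrite /der scalerDr !skewD !skew_derD ?skew_trC //.
by rewrite scalerDr addrACA.
Qed.

Lemma derN_skew X : skew_der (- skew X) = - skew_der (skew X).
Proof. by rewrite -(scaleN1r (skew X)) -[RHS]scaleN1r skew_derZ ?skew_trC // rmorphN1. Qed.

Lemma der_real a X : a^* = a -> der (a *: X) = a *: der X.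
Proof.
move=> ra; rewrite /der skewZ // skew_derZ ?skew_trC // scalerA mulrC -scalerA.
by rewrite skewZ // skew_derZ ?skew_trC // scalerDr !scalerA [a * _]mulrC.
Qed.

Lemma der_i X : der ('i *: X) = 'i *: der X.
Proof.
rewrite /der scalerA mulNr -expr2 sqrCi opprK scale1r scalerDr scalerA -expr2 sqrCi.
have -> : 'i *: X = - (- 'i *: X) by rewrite scaleNr opprK.
by rewrite skewN derN_skew scaleN1r addrC.
Qed.

Lemma derZ a X : der (a *: X) = a *: der X.
Proof.
rewrite [a]Crect scalerDl derD -scalerA der_i !der_real ?conj_Creal ?Creal_Re ?Creal_Im //.
by rewrite scalerA -scalerDl.
Qed.

Lemma der_sum (I : Type) (r : seq I) (F : I -> 'M[K]_n) :
  der (\sum_(i <- r) F i) = \sum_(i <- r) der (F i).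
Proof.
apply: big_morph; first exact: derD.
by rewrite -[X in der X](scale0r 0) derZ scale0r.
Qed.

Lemma der_trC X : der (X^t*) = (der X)^t*.
Proof.
have E : skew (- 'i *: X^t*) = skew (- 'i *: X).
  have -> : - 'i *: X^t* = ('i *: X)^t* by rewrite trmxC_scale conjCi.
  by rewrite skew_trC_arg -skewN scaleNr.
rewrite /der trmxC_add trmxC_scale !skew_der_trC ?skew_trC // conjCi E.
by rewrite skew_trC_arg derN_skew [in RHS]scalerN [- 'i *: skew_der _]scaleNr opprK.
Qed.

Lemma derJ u X : u \is unitarymx -> der (u *m X *m u^t*) = pi u *m der X *m (pi u)^t*.
Proof.
move=> uu; rewrite /der mulmxDr mulmxDl -scalemxAr -scalemxAl -!skew_derJ ?skew_trC //.
by rewrite -!skewJ -scalemxAr -scalemxAl.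
Qed.

Lemma der_diag z : der (diag_mx z) = wdiag z.
Proof.
pose y := \row_i (2^-1 * (z 0 i - (z 0 i)^*)).
pose x := \row_i (2^-1 * (- 'i * z 0 i - 'i * (z 0 i)^*)).
have sy i : (y 0 i)^* = - y 0 i.
  by rewrite mxE rmorphM rmorphB /= conjCK fmorphV /= conjC_nat -mulrN opprB.
have sx i : (x 0 i)^* = - x 0 i.
  rewrite mxE rmorphM rmorphB !rmorphM rmorphN /= conjCK conjCi fmorphV /= conjC_nat.
  by ring.
have Ey : skew (diag_mx z) = diag_mx y.
  rewrite /skew trmxC_diag -linearB -linearZ; congr diag_mx.
  by apply/rowP=> i; rewrite !mxE.
have Ex : skew (- 'i *: diag_mx z) = diag_mx x.
  rewrite /skew -linearZ trmxC_diag -linearB -linearZ; congr diag_mx.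
  by apply/rowP=> i; rewrite !mxE rmorphM rmorphN /= conjCi opprK.
rewrite /der Ey Ex !skew_der_diag // /wdiag -linearZ -linearD; congr diag_mx.
apply/rowP=> a; rewrite !mxE mulr_sumr -big_split /=; apply: eq_bigr => i _.
rewrite !mxE; move: (alpha a i)%:~R (z 0 i) ((z 0 i)^*) => w v v'.
have ii : 'i * 'i = -1 :> K by rewrite -expr2 sqrCi.
have -> : 'i * (w * (2^-1 * (- 'i * v - 'i * v'))) = - ('i * 'i) * w / 2 * (v + v').
  by ring.
by rewrite ii; field.
Qed.

Lemma bigO_der k F : bigO k F -> bigO k (fun t => der (F t)).
Proof.
move=> oF; have := @bigO_sum K k _ _ _ (index_enum _) (fun i t =>
  \sum_j (F t i j)%:M *m der (delta_mx i j)).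
move=> H; apply: bigO_ext (H _) => [t _|i].
  rewrite [in RHS](matrix_sum_delta (F t)) der_sum; apply: eq_bigr => i _.
  by rewrite der_sum; apply: eq_bigr => j _; rewrite derZ mul_scalar_mx.
apply: bigO_sum => j; rewrite -(addn0 k).
by apply: bigOM; [exact: bigO_entry|exact: bigO_cst].
Qed.

Lemma jet_conj_bracket m (F G : K -> 'M[K]_m) A X : jet F A -> jet G (- A) ->
  bigO 2 (fun t => F t *m X *m G t - X - t *: (A *m X - X *m A)).
Proof.
move=> jF jG.
have h1 := bigOM (bigOM jF (bigO_cst X)) (jet_bounded jG).
have h2 := bigOM (bigO_cst X) jG.
have h3 := bigOZ (bigOM (bigO_cst (A *m X)) (jet_sub1 jG)).
apply: bigO_ext (bigOD (bigOD h1 h2) h3) => t _ /=.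
rewrite !(mulmxBl, mulmxBr) !mul1mx !mulmx1 -!scalemxAl -!scalemxAr mulmxN !scalerBr.
apply/matrixP=> i j; rewrite !mxE; ring.
Qed.

(** Differentiate the equivariance [derJ] along a curve of velocity [Y]. *)
Lemma der_skew_bracket Y X : Y^t* = - Y ->
  der (Y *m X - X *m Y) = skew_der Y *m der X - der X *m skew_der Y.
Proof.
move=> sY; have [c [cu jc jp]] := skew_curve sY.
have jcC := jet_trC jc; have jpC := jet_trC jp.
rewrite sY in jcC; rewrite skew_der_trC // in jpC.
have h1 := bigO_der (jet_conj_bracket X jc jcC).
have h2 := jet_conj_bracket (der X) jp jpC.
apply/eqP; rewrite -subr_eq0; apply/eqP/bigO2_linear_eq0.
apply: bigO_ext (bigOD h2 (bigON h1)) => t t01 /=.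
rewrite !opp_mxE !(derD, derZ) derJ ?cu //.
apply/matrixP=> i j; rewrite !mxE; ring.
Qed.

Lemma der_bracket X Y : der (X *m Y - Y *m X) = der X *m der Y - der Y *m der X.
Proof.
have [sA sB] := (skew_trC X, skew_trC (- 'i *: X)).
have EX : der X = skew_der (skew X) + 'i *: skew_der (skew (- 'i *: X)) by [].
have := skew_decomp X; move: (skew X) (skew (- 'i *: X)) sA sB EX => A B sA sB EX XE.
have -> : X *m Y - Y *m X = (A *m Y - Y *m A) + 'i *: (B *m Y - Y *m B).
  rewrite XE mulmxDl mulmxDr -scalemxAl -scalemxAr.
  by rewrite opprD addrACA -scalerBr.
rewrite derD derZ !der_skew_bracket // EX; move: (der Y) => DY.
by rewrite mulmxDl mulmxDr -scalemxAl -scalemxAr opprD addrACA -scalerBr.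
Qed.

End Weighted.

(** Every unitary matrix is conjugate to a diagonal one; a nonzero entry of an
    intertwiner of the derived representations links two equal weights, so the
    intertwiner commutes with the diagonal matrices. *)
Lemma der_intertwine n d e (pi : 'M[K]_n -> 'M[K]_d) alpha
    (rho : 'M[K]_n -> 'M[K]_e) beta (J : 'M[K]_(d, e)) :
  urep pi -> weighted pi alpha -> urep rho -> weighted rho beta ->
  (forall X, der pi alpha X *m J = J *m der rho beta X) ->
  forall u, u \is unitarymx -> pi u *m J = J *m rho u.
Proof.
move=> rpi wpi rrho wrho dJ u /unitarymx_spectral [s] [z] [su z1 ->].
case: (rpi) => piu piM; case: (rrho) => rhou rhoM.
have uz := diag_unitarymx z1.
rewrite !piM ?rhoM ?mul_unitarymx ?unitarymxC // !urepV //.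
set J' := pi s *m J *m (rho s)^t*.
have E1 : pi s *m J = J' *m rho s.
  by rewrite /J' -mulmxA unitarymx_Cmul ?rhou // mulmx1.
have E2 : J *m (rho s)^t* = (pi s)^t* *m J'.
  by rewrite /J' !mulmxA unitarymx_Cmul ?piu // mul1mx.
(* Conjugating by the eigenbasis turns [J] into the intertwiner [J'], and [u] into
   its diagonal form. *)
suff JJ : pi (diag_mx z) *m J' = J' *m rho (diag_mx z).
  clearbody J'; by rewrite -(mulmxA _ (pi s) J) E1 !mulmxA E2 -(mulmxA _ _ J') JJ !mulmxA.
have dJ' X : der pi alpha X *m J' = J' *m der rho beta X.
  have EX : X = s *m (s^t* *m X *m s) *m s^t*.
    by rewrite !mulmxA unitarymx_mulC // mul1mx -mulmxA unitarymx_mulC // mulmx1.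
  rewrite EX (derJ rpi) // (derJ rrho) // /J' !mulmxA.
  rewrite -[_ *m (pi s)^t* *m _]mulmxA unitarymx_Cmul ?piu // mulmx1.
  rewrite -[in RHS](mulmxA _ ((rho s)^t*)) unitarymx_Cmul ?rhou // mulmx1.
  by rewrite -2!mulmxA [in LHS](mulmxA _ J) dJ !mulmxA.
clearbody J'; rewrite wpi // wrho //; apply/matrixP=> a b.
rewrite mul_diag_mx mul_mx_diag !mxE mulrC.
have [->|J0] := eqVneq (J' a b) 0; first by rewrite !mul0r.
congr (_ * _); apply: eq_bigr => i _; congr exprz.
have /matrixP/(_ a b) := dJ' (diag_mx (delta_mx 0 i)).
rewrite (der_diag rpi wpi) (der_diag rrho wrho) mul_diag_mx mul_mx_diag !mxE.
rewrite mulrC => /(mulfI J0).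
rewrite (bigD1 i) //= big1 => [|j /negPf ji]; last by rewrite mxE ji andbF mulr0.
rewrite [in RHS](bigD1 i) //= big1 => [|j /negPf ji]; last by rewrite mxE ji andbF mulr0.
by rewrite !mxE !eqxx !mulr1 !addr0 => /intr_inj.
Qed.

End Reps.

(** * Schur's lemma *)

Section Schur.
Variable K : numClosedFieldType.

Lemma trmxC_mul_eq0 p q (A : 'M[K]_(p, q)) : A^t* *m A = 0 -> A = 0.
Proof.
move=> /matrixP A0; apply/matrixP=> i j; rewrite mxE; have := A0 j j; rewrite !mxE.
have sq k : A^t* j k * A k j = `|A k j| ^+ 2 by rewrite !mxE mulrC -normCK.
move/psumr_eq0P => H; apply/eqP.
rewrite -normr_eq0 -sqrf_eq0 -sq H // => k _.
by rewrite sq exprn_ge0.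
Qed.

(** Write [A = C B] with [C] of full column rank and [B] of full row rank; then
    [B C = 1], whose trace is the rank. *)
Lemma mxtrace_idempotent n (A : 'M[K]_n) : A *m A = A -> \tr A = (\rank A)%:R.
Proof.
move=> AA; rewrite -{1}(mulmx_base A) mxtrace_mulC.
have -> : row_base A *m col_base A = 1%:M; last by rewrite mxtrace1.
apply: (row_full_inj (col_base_full A)); apply: (row_free_inj (row_base_free A)).
have := mulmx_base A; rewrite /= mulmx1.
move: (col_base A) (row_base A) => c r E.
by rewrite E -!mulmxA E mulmxA E.
Qed.

(** The rows of [V] span the subspace, whence the transposes. *)
Definition irreducible_family (T : Type) d (f : T -> 'M[K]_d) : Prop :=
  (0 < d)%N /\
  forall V : 'M[K]_d, (forall t, stablemx V (f t)^T) -> V = 0 \/ row_full V.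

(** An eigenspace of [J] is invariant, hence everything. *)
Lemma schur_scalar T d (f : T -> 'M[K]_d) (J : 'M[K]_d) :
  irreducible_family f -> (forall t, f t *m J = J *m f t) -> exists c, J = c%:M.
Proof.
move=> [d0 irr] fJ; have [c /eigenvalueP[v vJ v0]] := eigenvalue_closed J^T d0.
exists c; have [t||V0 //] := irr (eigenspace J^T c).
- by apply: comm_mx_stable_eigenspace; rewrite /comm_mx -!trmx_mul fJ.
- move=> E0; move/eigenspaceP: vJ; rewrite E0 => /submx0null vE.
  by rewrite vE eqxx in v0.
have : (1%:M <= eigenspace J^T c)%MS by rewrite submx_full.
by move/eigenspaceP; rewrite mul1mx scalemx1 => /(congr1 trmx); rewrite trmxK tr_scalar_mx.
Qed.

(** [J J^*] and [J^* J] commute with the families, so they are scalars, with a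
    common positive value; dividing [J] by its square root makes it unitary. *)
Lemma schur_unitary T d e (f : T -> 'M[K]_d) (g : T -> 'M[K]_e) (inv : T -> T)
    (J : 'M[K]_(d, e)) :
  irreducible_family f -> irreducible_family g ->
  (forall t, f (inv t) = (f t)^t*) -> (forall t, g (inv t) = (g t)^t*) ->
  (forall t, f t *m J = J *m g t) -> J != 0 ->
  exists u : 'M[K]_(d, e),
    [/\ u \is unitarymx, u^t* \is unitarymx & forall t, f t *m u = u *m g t].
Proof.
move=> irrf irrg fV gV fJ J0.
have gJ t : g t *m J^t* = J^t* *m f t.
  have := congr1 (fun M => M^t*) (fJ (inv t)).
  by rewrite !trmxC_mul fV gV !trmxCK.
have [a aE] : exists a, J *m J^t* = a%:M.
  by apply: (schur_scalar irrf) => t; rewrite mulmxA fJ -mulmxA gJ mulmxA.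
have [b bE] : exists b, J^t* *m J = b%:M.
  by apply: (schur_scalar irrg) => t; rewrite mulmxA gJ -mulmxA fJ mulmxA.
have ab : a = b.
  have /matrixP : a%:M *m J = J *m b%:M by rewrite -aE -bE mulmxA.
  have /matrix0Pn[i [j Jij]] := J0.
  by move=> /(_ i j); rewrite mul_scalar_mx mul_mx_scalar !mxE => /(mulIf Jij).
have a0 : 0 < a.
  have /matrix0Pn[i [j Jij]] := J0.
  have /matrixP/(_ i i) := aE; rewrite !mxE eqxx mulr1n => <-.
  rewrite (bigD1 j) //= ltr_pwDl //; first by rewrite !mxE -normCK exprn_gt0 ?normr_gt0.
  by rewrite sumr_ge0 // => k _; rewrite !mxE -normCK exprn_ge0.
have sq : (sqrtC a)^-1 * ((sqrtC a)^-1)^* * a = 1.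
  rewrite geC0_conj ?invr_ge0 ?sqrtC_ge0 ?ltW // -invfM -expr2 sqrtCK mulVf //.
  by rewrite gt_eqF.
exists ((sqrtC a)^-1 *: J); split.
- apply/unitarymxP; rewrite trmxC_scale -scalemxAl -scalemxAr scalerA aE.
  by rewrite scale_scalar_mx sq.
- apply/unitarymxP; rewrite trmxCK trmxC_scale -scalemxAl -scalemxAr scalerA bE -ab.
  by rewrite scale_scalar_mx mulrC [_^* * _]mulrC mulrC sq.
- by move=> t; rewrite -scalemxAr fJ -scalemxAl.
Qed.

End Schur.

(** * Weights and raising operators *)

Section DerivedMatrixUnits.
Variable K : numClosedFieldType.
Variables (n d : nat) (pi : 'M[K]_n -> 'M[K]_d) (alpha : 'I_d -> 'I_n -> int).
Hypotheses (rpi : urep pi) (wpi : weighted pi alpha).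

Lemma der_delta_bracket (i j k l : 'I_n) (E := fun i j => der pi alpha (delta_mx i j)) :
  E i j *m E k l - E k l *m E i j =
  (j == k)%:R *: E i l - (l == i)%:R *: E k j.
Proof.
rewrite /E -(der_bracket rpi wpi) !mul_delta_mx_cond !mulrn_mxE !opp_mxE.
by rewrite (derD rpi wpi) !(derZ rpi wpi).
Qed.

Lemma der_delta_diag (i : 'I_n) (x y : 'I_d) :
  der pi alpha (delta_mx i i) x y = (alpha x i)%:~R *+ (x == y).
Proof.
have -> : delta_mx i i = diag_mx (delta_mx 0 i) :> 'M[K]_n.
  apply/matrixP=> u v; rewrite !mxE eqxx /= -mulrnA mulnb.
  by congr (_%:R); have [->|ui] := eqVneq u v; rewrite ?andbT ?andbF ?andbb //;
     case: eqP => // uE; case: eqP => // vE; rewrite uE vE eqxx in ui.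
rewrite (der_diag rpi wpi) !mxE; congr (_ *+ _).
rewrite (bigD1 i) //= big1 => [|j /negPf ji]; last by rewrite mxE ji andbF mulr0.
by rewrite !mxE !eqxx mulr1 addr0.
Qed.

Lemma der_delta_trC (i j : 'I_n) :
  (der pi alpha (delta_mx i j))^t* = der pi alpha (delta_mx j i).
Proof.
rewrite -(der_trC rpi wpi); congr der; apply/matrixP=> u v; rewrite !mxE.
by rewrite andbC rmorph_nat.
Qed.

End DerivedMatrixUnits.

Section WeightTheory.
Variable K : numClosedFieldType.
Variables (n d : nat) (E : 'I_n -> 'I_n -> 'M[K]_d) (alpha : 'I_d -> 'I_n -> int).
Hypothesis E_bracket : forall i j k l,
  E i j *m E k l - E k l *m E i j = (j == k)%:R *: E i l - (l == i)%:R *: E k j.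
Hypothesis E_diag : forall i x y, E i i x y = (alpha x i)%:~R *+ (x == y).
Hypothesis E_trC : forall i j, (E i j)^t* = E j i.

Definition has_weight (b : 'I_n -> int) (w : 'cV[K]_d) : Prop :=
  forall k, E k k *m w = (b k)%:~R *: w.

(** [E i j] is an eigenvector of the bracket with [E k k]. *)
Lemma E_shift i j b w : has_weight b w ->
  has_weight (fun k => b k + (k == i)%:Z - (k == j)%:Z) (E i j *m w).
Proof.
move=> bw k; have := E_bracket k k i j.
have -> : (k == i)%:R *: E k j = (k == i)%:R *: E i j.
  by case: eqP => [->|]; rewrite ?scale0r.
have -> : (j == k)%:R *: E i k = (k == j)%:R *: E i j.
  by rewrite eq_sym; case: eqP => [->|]; rewrite ?scale0r.
move: (E k k) (E i j) (bw k) => H F Hw /eqP; rewrite subr_eq => /eqP HF.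
rewrite mulmxA HF mulmxDl mulmxBl -mulmxA Hw -!scalemxAl -scalemxAr.
by rewrite intrB intrD scalerBl scalerDl addrC addrA.
Qed.

(** The bracket of [E i j] and its adjoint [E j i] is [E i i - E j j], which acts on
    [w] by the scalar [b i - b j]. *)
Lemma sl2_norm i j b w : i != j -> has_weight b w -> E i j *m w = 0 ->
  (E j i *m w)^t* *m (E j i *m w) = (b i - b j)%:~R *: (w^t* *m w).
Proof.
move=> ij bw w0; rewrite trmxC_mul E_trC -mulmxA (mulmxA (E i j)).
have /eqP := E_bracket i j j i; rewrite subr_eq => /eqP ->.
rewrite !eqxx !scale1r mulmxDl mulmxBl !bw -[_ *m _ *m w]mulmxA w0 mulmx0 addr0.
by rewrite -scalerBl -intrB -scalemxAr.
Qed.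

Lemma sl2_kill i j b w : i != j -> b i = b j -> has_weight b w ->
  E i j *m w = 0 -> E j i *m w = 0.
Proof.
move=> ij bij bw w0; apply: trmxC_mul_eq0.
by rewrite (sl2_norm ij bw w0) bij subrr scale0r.
Qed.

(** Otherwise the squared norm of [E j i w] would be negative. *)
Lemma sl2_inject i j b w : i != j -> b i < b j -> has_weight b w ->
  E i j *m w = 0 -> w = 0.
Proof.
move=> ij bij bw w0; apply: trmxC_mul_eq0; have N := sl2_norm ij bw w0.
have sq (A : 'cV[K]_d) : 0 <= (A^t* *m A) 0 0.
  by rewrite mxE sumr_ge0 // => k _; rewrite !mxE mulrC -normCK exprn_ge0.
have := sq (E j i *m w); rewrite N mxE; have := sq w.
move: (w^t* *m w) => Q Q0; rewrite nmulr_rge0 ?ltrz0 ?subr_lt0 // => Q0'.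
by apply/matrixP=> x y; rewrite mxE !ord1; apply/le_anti; rewrite Q0 Q0'.
Qed.

(** Weights of [n] coordinates as finite functions, so that they can be compared
    and counted. *)
Definition wt (a : 'I_d) : {ffun 'I_n -> int} := [ffun i => alpha a i].

Definition mult (b : {ffun 'I_n -> int}) : nat := #|[set a | wt a == b]|.

Definition wproj (b : {ffun 'I_n -> int}) : 'M[K]_d :=
  diag_mx (\row_a (wt a == b)%:R).

Lemma wprojK b : wproj b *m wproj b = wproj b.
Proof.
rewrite /wproj mulmx_diag; congr diag_mx; apply/rowP=> a; rewrite !mxE.
by case: eqP => _; rewrite ?mul1r ?mul0r.
Qed.

Lemma rank_wproj b : \rank (wproj b) = mult b.
Proof.
apply/eqP; rewrite -(eqr_nat K) -mxtrace_idempotent ?wprojK // mxtrace_diag.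
rewrite /mult cardE -sum1_size big_filter natr_sum; apply/eqP.
rewrite [RHS]big_mkcond /=; apply: eq_bigr => a _.
by rewrite mxE inE; case: eqP.
Qed.

Definition shift (b : {ffun 'I_n -> int}) i j : {ffun 'I_n -> int} :=
  [ffun k => b k + (k == i)%:Z - (k == j)%:Z].

Lemma E_entry i j x y : E i j x y != 0 -> wt x = shift (wt y) i j.
Proof.
move=> nz; apply/ffunP=> k; rewrite !ffunE.
have /matrixP/(_ x y) := E_bracket k k i j.
have D1 : (E k k *m E i j) x y = (alpha x k)%:~R * E i j x y.
  rewrite mxE (bigD1 x) //= big1 => [|z /negPf zx]; first by rewrite E_diag // eqxx mulr1n addr0.
  by rewrite E_diag // eq_sym zx mulr0n mul0r.
have D2 : (E i j *m E k k) x y = E i j x y * (alpha y k)%:~R.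
  rewrite mxE (bigD1 y) //= big1 => [|z /negPf zx]; first by rewrite E_diag // eqxx mulr1n addr0.
  by rewrite E_diag // zx mulr0n mulr0.
rewrite [LHS]mxE [X in _ + X = _]mxE D1 D2 [RHS]mxE [X in _ = _ + X]mxE.
rewrite [X in _ = X + _]mxE [X in _ = _ - X]mxE.
have e1 : (k == i)%:R * E k j x y = (k == i)%:R * E i j x y.
  by case: eqP => [->|]; rewrite ?mul0r.
have e2 : (j == k)%:R * E i k x y = (j == k)%:R * E i j x y.
  by case: eqP => [->|]; rewrite ?mul0r.
rewrite e1 e2 [E i j x y * _]mulrC -!mulrBl => /(mulIf nz) h.
apply/eqP; rewrite -(eqr_int K) intrB intrD -subr_eq0 [k == j]eq_sym; apply/eqP.
rewrite -[(alpha x k)%:~R](subrK (alpha y k)%:~R) h; ring.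
Qed.

Lemma wproj_E i j b : wproj (shift b i j) *m E i j = E i j *m wproj b.
Proof.
rewrite /wproj mul_diag_mx mul_mx_diag; apply/matrixP=> x y; rewrite !mxE.
have [->|/E_entry ->] := eqVneq (E i j x y) 0; first by rewrite mulr0 mul0r.
rewrite mulrC; congr (_ * _%:R); congr nat_of_bool; apply/eqP/eqP => [h|-> //].
by apply/ffunP=> k; have /ffunP/(_ k) := h; rewrite !ffunE => /addIr/addIr.
Qed.

Lemma wproj_weight b w : wproj b *m w = w -> has_weight b w.
Proof.
move=> <- k; rewrite mulmxA scalemxAl; congr (_ *m _).
rewrite /wproj mul_mx_diag; apply/matrixP=> x y; rewrite !mxE E_diag //.
have [->|] := eqVneq x y; rewrite ?mulr1n ?mulr0n ?mul0r ?mulr0 //.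
by case: (wt y =P b) => [<-|]; rewrite ?ffunE // !mulr0.
Qed.

(** The common kernel of the operators meets the weight space trivially, so the weight
    space embeds into the sum of the shifted ones, where the operators take values. *)
Lemma mult_le_shifts (b : {ffun 'I_n -> int}) (L : seq ('I_n * 'I_n)) :
  (forall w : 'cV[K]_d, has_weight b w ->
     {in L, forall x, E x.1 x.2 *m w = 0} -> w = 0) ->
  (mult b <= \sum_(x <- L) mult (shift b x.1 x.2))%N.
Proof.
move=> noHW; pose ker x := kermx (E x.2 x.1).
suff H : forall L' (W : 'M[K]_d), (W <= wproj b)%MS ->
    (\rank W <= \sum_(x <- L') mult (shift b x.1 x.2) +
       \rank (foldr (fun x V => V :&: ker x)%MS W L'))%N.
  rewrite -rank_wproj (leq_trans (H L _ (submx_refl _))) //.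
  suff -> : foldr (fun x V => V :&: ker x)%MS (wproj b) L = 0.
    by rewrite mxrank0 addn0.
  apply/eqP/rowV0P => v vS.
  have [vb vL] : (v <= wproj b)%MS /\ {in L, forall x, (v <= ker x)%MS}.
    elim: (L) vS => [|x L' IH] //=; rewrite sub_capmx => /andP[/IH[-> vL'] vx].
    by split=> // y; rewrite inE => /orP[/eqP ->|/vL'].
  rewrite -(trmxCK v); suff -> : v^t* = 0 by rewrite trmx0 map_mx0.
  apply: noHW => [|x xL].
    apply: wproj_weight; have -> : wproj b = (wproj b)^t*.
      rewrite trmxC_diag; congr diag_mx; apply/rowP=> a.
      by rewrite !mxE rmorph_nat.
    by rewrite -trmxC_mul; have /submxP[D ->] := vb; rewrite -mulmxA wprojK.
  have /sub_kermxP vx := vL x xL.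
  by rewrite -E_trC -trmxC_mul vx trmx0 map_mx0.
elim=> [|x L' IH] W Wb; first by rewrite big_nil.
rewrite big_cons /=; set V := foldr _ W L'.
have VW : (V <= wproj b)%MS.
  rewrite /V; elim: (L') => [|y L'' IH'] //=.
  exact: submx_trans (capmxSl _ _) IH'.
rewrite (leq_trans (IH W Wb)) // -/V -(mxrank_mul_ker V (E x.2 x.1)).
rewrite addnA leq_add2r [X in (_ <= X)%N]addnC leq_add2l.
have /submxP[D ->] := VW; rewrite -mulmxA.
suff -> : wproj b *m E x.2 x.1 = E x.2 x.1 *m wproj (shift b x.1 x.2).
  by rewrite mulmxA -rank_wproj mxrankM_maxr.
rewrite -wproj_E; congr (wproj _ *m _); apply/ffunP=> k; rewrite !ffunE.
by ring.
Qed.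

End WeightTheory.

(** * Highest weight vectors of weight zero and of a coordinate weight *)

Section HighestWeight.
Variable K : numClosedFieldType.
Variables (n d : nat) (E : 'I_n.+1 -> 'I_n.+1 -> 'M[K]_d).
Hypothesis E_bracket : forall i j k l,
  E i j *m E k l - E k l *m E i j = (j == k)%:R *: E i l - (l == i)%:R *: E k j.
Hypothesis E_trC : forall i j, (E i j)^t* = E j i.

Local Notation has_weight := (has_weight E).
Variable w : 'cV[K]_d.
Hypothesis w_raise : forall i j : 'I_n.+1, j = i.+1 :> nat -> E i j *m w = 0.

Lemma E_comm i j k l (v : 'cV[K]_d) :
  E i j *m (E k l *m v) =
  E k l *m (E i j *m v) + (j == k)%:R *: (E i l *m v) - (l == i)%:R *: (E k j *m v).
Proof.
have /eqP := E_bracket i j k l; rewrite subr_eq => /eqP H.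
by rewrite mulmxA H mulmxDl mulmxBl -!scalemxAl mulmxA addrC addrA.
Qed.

(** [E i j] is an iterated bracket of the simple raising operators. *)
Lemma raise_all (i j : 'I_n.+1) : (i < j)%N -> E i j *m w = 0.
Proof.
move Em : (j - i.+1)%N => m; elim: m i j Em => [|m IH] i j Em ij.
  by apply: w_raise; lia.
have jn : (j.-1 < n.+1)%N by have := ltn_ord j; lia.
pose j' := Ordinal jn; have j'j : j = j'.+1 :> nat by rewrite /=; lia.
have := E_comm i j' j' j w; rewrite eqxx scale1r.
have -> : (j == i) = false by apply/eqP => E0; rewrite E0 ltnn in ij.
rewrite scale0r subr0 (w_raise j'j) (IH i j') /=; [|lia|lia].
by rewrite !mulmx0 add0r => <-.
Qed.

Lemma weight0_killed : has_weight (fun=> 0) w -> forall i j, E i j *m w = 0.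
Proof.
move=> w0 i j; case: (ltngtP i j) => [|ji|/val_inj ->].
- exact: raise_all.
- apply: (sl2_kill E_bracket E_trC (i := j) (j := i)) w0 _ => //.
    by apply/eqP => ji'; rewrite ji' ltnn in ji.
  exact: raise_all.
by rewrite w0 scale0r.
Qed.

Hypothesis w1 : has_weight (fun k => (k == ord0)%:Z) w.

Lemma weight1_killed i j : j != ord0 -> E i j *m w = 0.
Proof.
move=> j0; case: (ltngtP i j) => [|ji|/val_inj ->].
- exact: raise_all.
- have i0 : i != ord0 by rewrite -val_eqE /= -lt0n (leq_ltn_trans _ ji).
  apply: (sl2_kill E_bracket E_trC (i := j) (j := i)) w1 _ => //.
  + by apply/eqP => ji'; rewrite ji' ltnn in ji.
  + by rewrite (negPf i0) (negPf j0).
  exact: raise_all.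
by rewrite w1 (negPf j0) scale0r.
Qed.

Lemma weight1_lower2 i k : i != ord0 -> E k ord0 *m (E i ord0 *m w) = 0.
Proof.
move=> i0; pose u := E i ord0 *m w.
have uw : has_weight (fun k => (k == ord0)%:Z + (k == i)%:Z - (k == ord0)%:Z) u.
  exact: E_shift.
rewrite -/u; have [->|k0] := eqVneq k ord0.
  by rewrite uw eqxx eq_sym (negPf i0) addr0 subrr scale0r.
have Eu : E ord0 k *m u = (k == i)%:R *: w.
  rewrite /u E_comm !(weight1_killed _ k0) mulmx0 scaler0 subr0 add0r w1 eqxx.
  by rewrite scale1r.
have [ki|ki] := eqVneq k i; last first.
  apply: (sl2_kill E_bracket E_trC (i := ord0) (j := k)) uw _ => //.
  - by rewrite eq_sym.
  - by rewrite eqxx eq_sym (negPf i0) (negPf k0) (negPf ki).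
  by rewrite Eu (negPf ki) scale0r.
(* The norm of the doubly lowered vector is computed by commuting the raising
   operator through, as in the two-dimensional representation of SU(2). *)
have h0 : E ord0 ord0 *m u = 0.
  by rewrite uw eqxx eq_sym (negPf i0) addr0 subrr scale0r.
have h1 : E i i *m u = u by rewrite uw eqxx (negPf i0) -[RHS]scale1r.
apply: trmxC_mul_eq0; rewrite trmxC_mul E_trC -mulmxA E_comm Eu ki eqxx !scale1r.
by rewrite h0 h1 -/u addr0 subrr mulmx0.
Qed.

(** The candidate intertwiner with the defining representation: it sends the basis
    vector [e_k] to the image of [w] under the operator which takes [e_0] to [e_k]. *)
Definition lowered : 'M[K]_(d, n.+1) := \matrix_(a, k) (E k ord0 *m w) a 0.

Lemma lowered_intertwine i j : E i j *m lowered = lowered *m delta_mx i j.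
Proof.
have colE k : col k lowered = E k ord0 *m w by apply/colP=> a; rewrite !mxE.
have H k : E i j *m (E k ord0 *m w) = (j == k)%:R *: (E i ord0 *m w).
  rewrite E_comm; have [->|j0] := eqVneq j ord0; last first.
    by rewrite !(weight1_killed _ j0) mulmx0 add0r scaler0 subr0.
  have [->|i0] := eqVneq i ord0; last first.
    by rewrite weight1_lower2 // add0r scale0r subr0.
  by rewrite !w1 eqxx !scale1r addrAC subrr add0r.
apply/matrixP=> a k; transitivity ((E i j *m col k lowered) a 0).
  by rewrite !mxE; apply: eq_bigr => b _; rewrite !mxE.
rewrite colE H mxE [RHS]mxE (bigD1 i) //= big1 => [|l /negPf li].
  by rewrite addr0 [delta_mx _ _ _ _]mxE [lowered _ _]mxE eqxx mulrC eq_sym.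
by rewrite [delta_mx _ _ _ _]mxE li mulr0.
Qed.

Lemma lowered_col0 : col ord0 lowered = w.
Proof.
by apply/colP=> a; rewrite mxE mxE w1 eqxx scale1r.
Qed.

End HighestWeight.

Section StandardReps.
Variable K : numClosedFieldType.

Lemma trivial_urep n : urep (fun _ : 'M[K]_n => 1%:M : 'M[K]_1).
Proof. by split=> *; rewrite ?unitarymx1 ?mulmx1. Qed.

Lemma trivial_weighted n :
  weighted (fun _ : 'M[K]_n => 1%:M : 'M[K]_1) (fun _ _ => 0).
Proof.
move=> z _; rewrite -diag_const_mx; congr diag_mx.
by apply/rowP=> a; rewrite !mxE big1.
Qed.

Lemma trivial_der n X : der (fun _ : 'M[K]_n => 1%:M : 'M[K]_1) (fun _ _ => 0) X = 0.
Proof.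
have w0 z : wdiag (fun (_ : 'I_1) (_ : 'I_n) => 0) z = 0 :> 'M[K]_1.
  rewrite /wdiag -[RHS](linear0 (@diag_mx K 1)); congr diag_mx.
  by apply/rowP=> a; rewrite !mxE big1 // => i _; rewrite mul0r.
by rewrite /der /skew_der !w0 !mulmx0 !mul0mx scaler0 addr0.
Qed.

Lemma defining_urep n : urep (@id 'M[K]_n).
Proof. by []. Qed.

Definition defining_weight n (k i : 'I_n) : int := (i == k)%:Z.

Lemma defining_weighted n : weighted (@id 'M[K]_n) (@defining_weight n).
Proof.
move=> z _; congr diag_mx; apply/rowP=> k; rewrite mxE (bigD1 k) //= big1 => [|i ik].
  by rewrite /defining_weight eqxx mulr1.
by rewrite /defining_weight (negPf ik).
Qed.

Lemma defining_der n X : der (@id 'M[K]_n) (@defining_weight n) X = X.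
Proof.
have [rs ws] := (@defining_urep n, @defining_weighted n).
have skewE (Y : 'M[K]_n) : Y^t* = - Y -> skew_der id (@defining_weight n) Y = Y.
  by move=> sY; have [c [_ jc jc']] := skew_curve rs ws sY; exact: jet_unique jc' jc.
by rewrite /der !skewE ?skew_trC // -skew_decomp.
Qed.

Lemma der_intertwine_delta n d e (pi : 'M[K]_n -> 'M[K]_d) alpha
    (rho : 'M[K]_n -> 'M[K]_e) beta (J : 'M[K]_(d, e)) :
  urep pi -> weighted pi alpha -> urep rho -> weighted rho beta ->
  (forall i j, der pi alpha (delta_mx i j) *m J = J *m der rho beta (delta_mx i j)) ->
  forall u, u \is unitarymx -> pi u *m J = J *m rho u.
Proof.
move=> rpi wpi rrho wrho H; apply: (der_intertwine rpi wpi rrho wrho) => X.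
rewrite (matrix_sum_delta X) (der_sum rpi wpi) (der_sum rrho wrho) mulmx_suml mulmx_sumr.
apply: eq_bigr => i _; rewrite (der_sum rpi wpi) (der_sum rrho wrho) mulmx_suml mulmx_sumr.
apply: eq_bigr => j _; rewrite (derZ rpi wpi) (derZ rrho wrho).
by rewrite -scalemxAl H -scalemxAr.
Qed.

End StandardReps.

(** By induction, followed by the transposition of the image of the first point with
    its target, which fixes the points already placed. *)
Lemma perm_extend (T : finType) (xs ys : seq T) :
  uniq xs -> uniq ys -> size xs = size ys ->
  exists s : {perm T}, map s xs = ys.
Proof.
elim: xs ys => [|x xs IH] [|y ys] //=; first by move=> *; exists 1%g.
move=> /andP[xxs uxs] /andP[yys uys] [sz].
have [s sE] := IH ys uxs uys sz.
exists (s * tperm (s x) y)%g; rewrite permM tpermL; congr cons.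
rewrite -sE; apply/eq_in_map => z zxs; rewrite permM tpermD //.
  by rewrite (inj_eq perm_inj); apply: contraNneq xxs => ->.
by apply: contraNneq yys => ->; rewrite -sE map_f.
Qed.

(** * Weight multiplicities under permutations *)

Section Multiplicities.
Variable K : numClosedFieldType.
Variables (n d : nat) (pi : 'M[K]_n -> 'M[K]_d) (alpha : 'I_d -> 'I_n -> int).
Hypotheses (rpi : urep pi) (wpi : weighted pi alpha).

Local Notation multw := (mult alpha).

Lemma perm_mx_unitary (s : 'S_n) : (perm_mx s : 'M[K]_n) \is unitarymx.
Proof.
apply/unitarymxP; rewrite tr_perm_mx map_perm_mx -perm_mxM mulgV.
exact: perm_mx1.
Qed.

(** Conjugation by a permutation matrix permutes the coordinates of weights. *)
Lemma mult_perm (b : {ffun 'I_n -> int}) (s : 'S_n) :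
  multw [ffun k => b (s k)] = multw b.
Proof.
pose u : 'M[K]_n := perm_mx s; have uu : u \is unitarymx by exact: perm_mx_unitary.
have uD i : u *m delta_mx (s i) (s i) *m u^t* = delta_mx i i.
  rewrite tr_perm_mx map_perm_mx -row_permE -col_permE; apply/matrixP=> k l.
  by rewrite !mxE !(inj_eq perm_inj).
have piu := urep_unitary rpi uu.
have piB i : der pi alpha (delta_mx i i) *m pi u =
    pi u *m der pi alpha (delta_mx (s i) (s i)).
  by rewrite -(uD i) (derJ rpi wpi) // -mulmxA unitarymx_Cmul // mulmx1.
have Bwt x y : pi u x y != 0 -> forall k, alpha x k = alpha y (s k).
  move=> nz k; have /matrixP/(_ x y) := piB k; rewrite !mxE.
  rewrite (bigD1 x) //= big1 => [|z /negPf zx]; last first.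
    by rewrite (der_delta_diag rpi wpi) eq_sym zx mulr0n mul0r.
  rewrite [in RHS](bigD1 y) //= big1 => [|z /negPf zx]; last first.
    by rewrite (der_delta_diag rpi wpi) zx mulr0n mulr0.
  rewrite !(der_delta_diag rpi wpi) !eqxx !addr0 mulrC => /(mulfI nz).
  exact: intr_inj.
have PB : wproj K alpha [ffun k => b (s k)] *m pi u = pi u *m wproj K alpha b.
  rewrite /wproj mul_diag_mx mul_mx_diag; apply/matrixP=> x y; rewrite !mxE.
  have [->|/Bwt H] := eqVneq (pi u x y) 0; first by rewrite mulr0 mul0r.
  rewrite mulrC; congr (_ * _%:R); congr nat_of_bool; apply/eqP/eqP => /ffunP h.
    by apply/ffunP=> k; have := h ((s^-1)%g k); rewrite !ffunE H permKV.
  by apply/ffunP=> k; have := h (s k); rewrite !ffunE H.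
have pU := unitarymx_unit piu.
rewrite -!(@rank_wproj K) -(mxrankMfree _ (B := pi u)) ?row_free_unit // PB.
by rewrite -mxrank_tr trmx_mul mxrankMfree ?mxrank_tr // row_free_unit unitmx_tr.
Qed.

(** Weights are prescribed by their nonzero coordinates, so that permuting the
    coordinates amounts to renaming the indices. *)
Definition wlin (l : seq (int * 'I_n)) : {ffun 'I_n -> int} :=
  [ffun k => \sum_(x <- l) x.1 * (k == x.2)%:Z].

Lemma mult_wlin (cs : seq int) (xs ys : seq 'I_n) :
  uniq xs -> uniq ys -> size xs = size ys ->
  multw (wlin (zip cs xs)) = multw (wlin (zip cs ys)).
Proof.
move=> uxs uys sz; have [s <-] := perm_extend uxs uys sz.
rewrite -[RHS](mult_perm _ s); congr (mult _ _); apply/ffunP=> k; rewrite !ffunE.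
elim: cs xs {uxs sz} => [|c cs IH] [|x xs] //=; rewrite ?big_nil // !big_cons IH.
by rewrite (inj_eq perm_inj).
Qed.

Lemma sum_mult (X : finType) (A : {set X}) (b : X -> {ffun 'I_n -> int}) :
  {in A &, injective b} ->
  (\sum_(x in A) multw (b x) = #|[set a | [exists x in A, wt alpha a == b x]]|)%N.
Proof.
move=> binj; rewrite -sum1_card.
rewrite [RHS]big_mkcond /= (eq_bigr (fun x => \sum_a (wt alpha a == b x))%N); last first.
  by move=> x _; rewrite /mult -sum1_card big_mkcond; apply: eq_bigr => a _; rewrite inE; case: eqP.
rewrite exchange_big /=; apply: eq_bigr => a _; rewrite inE.
case: existsP => [[x /andP[xA /eqP ax]]|nex].
  rewrite (bigD1 x) //= ax eqxx big1 // => y /andP[yA yx].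
  by apply/eqP; rewrite eqb0; apply: contraNneq yx => /binj ->.
rewrite big1 // => x xA; apply/eqP; rewrite eqb0; apply/negP => ax.
by apply: nex; exists x; rewrite xA.
Qed.

End Multiplicities.

Lemma mul_pred_bin2 n : (n * n.-1 = 2 * 'C(n, 2))%N.
Proof. by rewrite -mul_bin_diag bin1. Qed.

(** * Counting exceptional weights *)

Lemma card_offdiag n : #|[set x : 'I_n * 'I_n | x.1 != x.2]| = (n * n.-1)%N.
Proof.
rewrite -sum1_card (eq_bigl (fun x : 'I_n * 'I_n => true && (x.2 != x.1))); last first.
  by move=> x; rewrite inE eq_sym.
rewrite -(pair_big_dep xpredT (fun i j => j != i) (fun _ _ => 1%N)) /=.
rewrite (eq_bigr (fun=> n.-1)) ?sum_nat_const ?card_ord // => i _.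
by rewrite sum1_card cardC1 card_ord.
Qed.

Lemma card_ltpairs n : #|[set x : 'I_n * 'I_n | (x.1 < x.2)%N]| = 'C(n, 2).
Proof.
rewrite -sum1_card (eq_bigl (fun x : 'I_n * 'I_n => true && (x.1 < x.2)%N)); last first.
  by move=> x; rewrite inE.
rewrite -(pair_big_dep xpredT (fun i j : 'I_n => (i < j)%N) (fun _ _ => 1%N)) /=.
rewrite (exchange_big_dep xpredT) //= -bin2_sum big_mkord; apply: eq_bigr => j _.
by rewrite (big_ord_narrow (ltnW (ltn_ord j))) sum1_card card_ord.
Qed.

Lemma card_lttriples n :
  #|[set x : ('I_n * 'I_n) * 'I_n |
      [&& (x.1.1 < x.1.2)%N, x.2 != x.1.1 & x.2 != x.1.2]]| = ('C(n, 2) * n.-2)%N.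
Proof.
rewrite -sum1_card (eq_bigl (fun x : ('I_n * 'I_n) * 'I_n => (x.1.1 < x.1.2)%N &&
   ((x.2 != x.1.1) && (x.2 != x.1.2)))); last by move=> x; rewrite inE.
rewrite -(pair_big_dep (fun y : 'I_n * 'I_n => (y.1 < y.2)%N)
  (fun y k => (k != y.1) && (k != y.2)) (fun _ _ => 1%N)) /=.
rewrite (eq_bigr (fun=> n.-2)) => [|[i j] /= ij].
  by rewrite sum_nat_const -card_ltpairs; congr (_ * _)%N; apply: eq_card => x; rewrite inE.
rewrite sum1_card; have := cardC (pred2 i j); rewrite card2 card_ord.
have -> : (i != j) by apply: contraTneq ij => ->; rewrite ltnn.
move=> h; transitivity #|[predC pred2 i j]|; last by rewrite -[in RHS]h.
by apply: eq_card => k; rewrite !inE negb_or.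
Qed.

Section ZeroCount.
Variable K : numClosedFieldType.
Variables (p d : nat).
Local Notation n := p.+3.
Variables (pi : 'M[K]_n -> 'M[K]_d) (alpha : 'I_d -> 'I_n -> int).
Hypotheses (rpi : urep pi) (wpi : weighted pi alpha).

Local Notation multw := (mult alpha).
Local Notation E := (fun i j => der pi alpha (delta_mx i j)).
Local Notation wt := (wt alpha).

Definition zeros (a : 'I_d) : nat := #|[set i | alpha a i == 0]|.

Hypothesis irr :
  irreducible_family (fun u : {u : 'M[K]_n | u \is unitarymx} => pi (sval u)).

(** Such a vector is killed by the whole Lie algebra, so it is fixed by the group;
    by irreducibility it spans everything, and the representation is trivial. *)
Lemma no_weight0_highest (w : 'cV[K]_d) :
  ~ (forall u, u \is unitarymx -> pi u = 1%:M) ->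
  has_weight E (fun=> 0) w ->
  (forall i j : 'I_n, j = i.+1 :> nat -> E i j *m w = 0) -> w = 0.
Proof.
move=> ntriv w0 wr; apply/eqP/negPn/negP => wn0; apply: ntriv => u uu.
have EB := der_delta_bracket rpi wpi; have EC := der_delta_trC rpi wpi.
have Ew := weight0_killed EB EC wr w0.
have fix_w v : v \is unitarymx -> pi v *m w = w.
  have := @der_intertwine_delta _ _ _ _ _ _ _ _ w rpi wpi (trivial_urep K n)
    (@trivial_weighted K n).
  move=> h vu; rewrite (h _ v vu) ?mulmx1 // => i j.
  by rewrite trivial_der mulmx0; exact: Ew.
have [d0 /(_ <<w^T>>%MS)] := irr; case => [v||full].
- rewrite (eqmx_stable _ (genmxE w^T)) -trmx_mul fix_w //.
  exact: (svalP v).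
- move/eqP; rewrite -mxrank_eq0 mxrank_gen mxrank_eq0 -(trmx0 _) (inj_eq trmx_inj).
  by rewrite (negPf wn0).
have fullw : row_full w^T by rewrite /row_full -(genmxE w^T).
apply/trmx_inj/(row_full_inj fullw).
by rewrite -trmx_mul fix_w // trmx1 mulmx1.
Qed.

(** Such a vector is the first column of an intertwiner with the defining
    representation. *)
Lemma no_weight1_highest (w : 'cV[K]_d) :
  (forall J : 'M[K]_(d, n), (forall u, u \is unitarymx -> pi u *m J = J *m u) -> J = 0) ->
  has_weight E (fun k => (k == ord0)%:Z) w ->
  (forall i j : 'I_n, j = i.+1 :> nat -> E i j *m w = 0) -> w = 0.
Proof.
move=> nosig w1 wr.
have EB := der_delta_bracket rpi wpi; have EC := der_delta_trC rpi wpi.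
have J0 : lowered E w = 0.
  apply: nosig => u uu.
  apply: (der_intertwine_delta rpi wpi (defining_urep K n) (@defining_weighted K n)) => //.
  move=> i j; rewrite defining_der; exact: (lowered_intertwine EB EC wr w1).
have := lowered_col0 w1; rewrite J0 => <-.
by apply/colP=> a; rewrite !mxE.
Qed.

(** These label the simple raising operators. *)
Definition simple_pairs : seq ('I_n * 'I_n) :=
  [seq (inord i, inord i.+1) | i <- iota 0 p.+2].

Lemma simple_pairsP (i j : 'I_n) : j = i.+1 :> nat -> (i, j) \in simple_pairs.
Proof.
move=> ji; apply/mapP; exists (val i).
  by rewrite mem_iota /= add0n -ltnS -ji ltn_ord.
by congr pair; apply: val_inj; rewrite /= inordK ?ltn_ord // -ji ltn_ord.
Qed.

Lemma disjoint_cards (T : finType) (A B : {set T}) :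
  (forall x, x \in A -> x \in B -> False) -> (#|A| + #|B| <= #|T|)%N.
Proof.
move=> AB; rewrite -cardsUI; have -> : A :&: B = finset.set0.
  by apply/setP=> x; rewrite !inE; apply/negP => /andP[/AB].
by rewrite cards0 addn0 max_card.
Qed.

Lemma wlinE (l : seq (int * 'I_n)) k :
  wlin l k = \sum_(x <- l) x.1 * (k == x.2)%:Z.
Proof. by rewrite ffunE. Qed.

Lemma wlin2_inj (c c' : int) : c != 0 -> c' != 0 -> c != c' ->
  {in [set x : 'I_n * 'I_n | x.1 != x.2] &,
    injective (fun x => wlin (zip [:: c; c'] [:: x.1; x.2]))}.
Proof.
move=> c0 c'0 cc' [i j] [i' j']; rewrite !inE /= => ij ij' /ffunP bb.
have := bb i; have := bb j; have := bb i'; have := bb j'.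
rewrite !wlinE !big_cons !big_nil /= !eqxx ![j == i]eq_sym ![j' == i']eq_sym.
rewrite ![i' == i]eq_sym ![j' == i]eq_sym ![i' == j]eq_sym ![j' == j]eq_sym.
rewrite (negPf ij) (negPf ij').
case: (eqVneq i i') => [->|_]; case: (eqVneq j j') => [->|_] //;
case: (eqVneq i j') => _; case: (eqVneq j i') => _ /=; lia.
Qed.

Lemma zeros_all a : zeros a = n -> forall i, alpha a i = 0.
Proof.
move=> za i; have : [set i | alpha a i == 0] == finset.setT.
  by rewrite eqEcard finset.subsetT cardsT card_ord -[#|_|]/(zeros a) za leqnn.
by move=> /eqP/setP/(_ i); rewrite !inE => /eqP.
Qed.

Lemma zeros_all_but_one a : zeros a = n.-1 ->
  exists i, alpha a i != 0 /\ wt a = wlin [:: (\sum_j alpha a j, i)].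
Proof.
move=> za; have : #|~: [set i | alpha a i == 0]| == 1%N.
  by rewrite cardsCs finset.setCK card_ord -[#|_|]/(zeros a) za subSnn.
move=> /cards1P[i /setP Si]; exists i.
have ai k : (alpha a k != 0) = (k == i) by have := Si k; rewrite !inE.
split; first by rewrite ai.
apply/ffunP=> k; rewrite wlinE big_seq1 ffunE (bigD1 i) //= big1 => [|j ji].
  rewrite addr0; case: eqP => [->|/eqP ki]; first by rewrite mulr1.
  by rewrite mulr0; apply/eqP; rewrite -[_ == _]negbK ai (negPf ki).
by apply/eqP; rewrite -[_ == _]negbK ai (negPf ji).
Qed.

Lemma zero_sum_zeros a : \sum_i alpha a i = 0 -> zeros a != n.-1.
Proof.
move=> s0; apply/eqP => /zeros_all_but_one[i [ai0 /ffunP/(_ i)]].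
by rewrite wlinE big_seq1 ffunE s0 mul0r => ai; rewrite ai eqxx in ai0.
Qed.

Lemma nonzero_sum_zeros a : \sum_i alpha a i != 0 -> zeros a != n.
Proof.
by apply: contraNneq => /zeros_all ai; rewrite big1 // => i _; rewrite ai.
Qed.

Lemma uniq2 (i j : 'I_n) : i != j -> uniq [:: i; j].
Proof. by move=> ij; rewrite /= inE ij. Qed.

Let o0 : 'I_n := ord0.
Let o1 : 'I_n := inord 1.
Let o2 : 'I_n := inord 2.

Let o01 : o0 != o1. Proof. by rewrite -val_eqE /= inordK. Qed.
Let o012 : uniq [:: o0; o1; o2].
Proof. by rewrite /= !inE -!val_eqE /= !inordK. Qed.

(** With [m] the multiplicity of [0] and [M] that of a root, [m <= (n - 1) M] and
    [m + n (n - 1) M <= d]. *)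
Lemma weight0_count :
  ~ (forall u, u \is unitarymx -> pi u = 1%:M) ->
  (n.+1 * #|[set a | zeros a == n]| <= d)%N.
Proof.
move=> ntriv.
have EB := der_delta_bracket rpi wpi; have EC := der_delta_trC rpi wpi.
have ED := der_delta_diag rpi wpi.
pose z : {ffun 'I_n -> int} := [ffun=> 0].
have zle : (#|[set a | zeros a == n]| <= multw z)%N.
  apply: subset_leq_card; apply/fintype.subsetP => a; rewrite !inE => /eqP/zeros_all h.
  by apply/eqP/ffunP=> i; rewrite !ffunE h.
(* All roots have the multiplicity of [e_1 - e_2]. *)
pose M := multw (wlin (zip [:: 1; -1] [:: o0; o1])).
pose b (x : 'I_n * 'I_n) := wlin (zip [:: 1; -1] [:: x.1; x.2]).
have bM (x : 'I_n * 'I_n) : x.1 != x.2 -> multw (b x) = M.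
  by move=> x12; rewrite (mult_wlin rpi wpi _ (ys := [:: o0; o1])) ?uniq2.
(* Raising the weight 0 by the simple operators leads to [n - 1] roots. *)
have zM : (multw z <= n.-1 * M)%N.
  rewrite (leq_trans (mult_le_shifts EB ED EC (L := simple_pairs) _)) //.
    move=> w zw wk; apply: no_weight0_highest => // [k|i j ji].
      by rewrite zw ffunE.
    exact: (wk (i, j) (simple_pairsP ji)).
  rewrite big_map (eq_big_seq (fun=> M)) => [|i].
    by rewrite big_const_seq count_predT size_iota iter_addn_0 mulnC.
  rewrite mem_iota add0n /= => ip.
  rewrite -(bM (inord i, inord i.+1)).
    congr (mult _ _); apply/ffunP=> k; rewrite !ffunE !big_cons big_nil /=.
    by ring.
  by rewrite -val_eqE /= !inordK //; lia.
pose A := [set x : 'I_n * 'I_n | x.1 != x.2].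
have binj : {in A &, injective b} by exact: wlin2_inj.
have := sum_mult alpha binj; set B := [set a | _].
rewrite (eq_bigr (fun=> M)) => [|x]; last by rewrite inE => /bM.
rewrite sum_nat_const card_offdiag => BM.
have := @disjoint_cards 'I_d [set a | wt a == z] B; rewrite card_ord -BM.
rewrite -[#|[set a | wt a == z]|]/(multw z) => D.
have {}D : (multw z + n * n.-1 * M <= d)%N.
  apply: D => a; rewrite !inE => /eqP -> /existsP[[i j]]; rewrite inE /= => /andP[ij].
  move=> /eqP/ffunP/(_ i); rewrite wlinE !big_cons big_nil ffunE /= eqxx (negPf ij).
  by [].
rewrite -mulnA in D; rewrite (leq_trans _ D) // mulSn leq_add // leq_mul2l.
by rewrite (leq_trans zle) // orbT.
Qed.

(** The vectors [N e_i] form one orbit of the permutations, so they share their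
    multiplicity; a weight with a single nonzero coordinate is one of them. *)
Lemma coordinate_weights_count N : N != 0 -> (forall a, \sum_i alpha a i = N) ->
  let B := [set a | [exists x in [set: 'I_n], wt a == wlin [:: (N, x)]]] in
  #|B| = (n * multw (wlin [:: (N, o0)]))%N /\
  (#|[set a | zeros a == n.-1]| <= #|B|)%N.
Proof.
move=> N0 sN B; split.
  rewrite -(@sum_mult _ _ alpha) => [|i j _ _ /ffunP/(_ i)].
    rewrite (eq_bigr (fun=> multw (wlin [:: (N, o0)]))) => [|i _].
      by rewrite sum_nat_const cardsT card_ord.
    exact: (mult_wlin rpi wpi [:: N] (xs := [:: i]) (ys := [:: o0])).
  rewrite !wlinE !big_seq1 /= eqxx mulr1; case: (eqVneq i j) => // _.
  by move=> h; rewrite h mulr0 eqxx in N0.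
apply: subset_leq_card; apply/fintype.subsetP => a; rewrite !inE => /eqP.
move=> /zeros_all_but_one[i [_ wi]]; apply/existsP; exists i.
by rewrite inE wi sN eqxx.
Qed.

(** With [e] the multiplicity of [N e_1] and [M] that of [(N - 1) e_1 + e_2], the
    group SU(2) in the first two coordinates gives [e <= M]. The latter weight has at
    least [n (n - 1) / 2] images, so [n e + n (n - 1) M / 2 <= d]. *)
Lemma weight_ge2_count N : 1 < N -> (forall a, \sum_i alpha a i = N) ->
  (n.+1 * #|[set a | zeros a == n.-1]| <= 2 * d)%N.
Proof.
move=> N1 sN; have N0 : N != 0 by lia.
have EB := der_delta_bracket rpi wpi; have EC := der_delta_trC rpi wpi.
have ED := der_delta_diag rpi wpi.
have [] := coordinate_weights_count N0 sN; set B0 := [set a | _]; set e := multw _.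
move=> B0E le0.
pose M := multw (wlin (zip [:: N - 1; 1] [:: o0; o1])).
pose b (x : 'I_n * 'I_n) := wlin (zip [:: N - 1; 1] [:: x.1; x.2]).
have eM : (e <= M)%N.
  rewrite (leq_trans (mult_le_shifts EB ED EC (L := [:: (o1, o0)]) _)) //.
    move=> w zw wk; apply: (sl2_inject EB EC (i := o1) (j := o0) _ _ zw) => //.
    - by rewrite eq_sym.
    - by rewrite !wlinE !big_seq1 eqxx [ o1 == _]eq_sym (negPf o01) mulr0 mulr1 /=; lia.
    by apply: (wk (o1, o0)); rewrite inE.
  rewrite big_seq1 /M; apply/eq_leq; congr (mult _ _); apply/ffunP=> k.
  by rewrite !ffunE !big_cons !big_nil /=; ring.
pose A := [set x : 'I_n * 'I_n | (x.1 < x.2)%N].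
have bM (x : 'I_n * 'I_n) : x \in A -> multw (b x) = M.
  rewrite inE => x12; rewrite (mult_wlin rpi wpi _ (ys := [:: o0; o1])) ?uniq2 //.
  by apply: contraTneq x12 => ->; rewrite ltnn.
have binj : {in A &, injective b}.
  move=> [i j] [i' j']; rewrite !inE /= => ij ij' /ffunP bb.
  have ijn : i != j by apply: contraTneq ij => ->; rewrite ltnn.
  have ijn' : i' != j' by apply: contraTneq ij' => ->; rewrite ltnn.
  have mem k : b (i, j) k != 0 -> (k == i') || (k == j').
    rewrite bb !wlinE !big_cons !big_nil /=.
    by case: (eqVneq k i') => // _; case: (eqVneq k j') => // _; lia.
  have := mem i; have := mem j; rewrite !wlinE !big_cons !big_nil /= !eqxx.
  rewrite [j == i]eq_sym (negPf ijn) mulr0 !mulr1 !addr0 !add0r.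
  move=> /(_ isT) mj mi; have {mi} := mi ltac:(lia).
  move: mj => /orP[]/eqP jE /orP[]/eqP iE; subst=> //; try by rewrite eqxx in ijn.
  by have := ltn_trans ij ij'; rewrite ltnn.
have := sum_mult alpha binj; set B := [set a | _].
rewrite (eq_bigr (fun=> M)) => [|x xA]; last exact: bM.
rewrite sum_nat_const card_ltpairs => BM.
have D : (#|B0| + #|B| <= d)%N.
  have := @disjoint_cards 'I_d; rewrite card_ord; apply => a; rewrite !inE.
  move=> /existsP[k /andP[_ /eqP ->]] /existsP[[i j]]; rewrite inE /= => /andP[ij].
  have ijn : i != j by apply: contraTneq ij => ->; rewrite ltnn.
  move=> /eqP/ffunP bb; have := bb i; have := bb j.
  rewrite !wlinE !big_cons !big_nil /= !eqxx [j == i]eq_sym (negPf ijn).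
  case: (eqVneq i k) => [ik|ik]; case: (eqVneq j k) => [jk|jk] /=; try lia.
rewrite -BM B0E in D; rewrite B0E in le0.
have bin2 := mul_pred_bin2 n.
have : (n * n.-1 * e <= 2 * 'C(n, 2) * M)%N by rewrite bin2 leq_mul2l eM orbT.
move: D le0; move: #|_| 'C(n, 2) => m1 c D le0 le1.
rewrite (leq_trans (leq_mul (leqnn n.+1) le0)) // (leq_trans _ (leq_mul (leqnn 2) D)) //.
by rewrite mulnDr mulnA; move: le1; rewrite /=; nia.
Qed.

(** With [e], [Y] and [X] the multiplicities of [e_1], [2 e_1 - e_2] and
    [e_1 + e_2 - e_3], raising gives [e <= Y + (n - 2) X], and counting the images of
    these weights gives
    [n e + n (n - 1) Y + n (n - 1) (n - 2) X / 2 <= d]. *)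
Lemma weight1_count : (forall a, \sum_i alpha a i = 1) ->
  (forall J : 'M[K]_(d, n), (forall u, u \is unitarymx -> pi u *m J = J *m u) -> J = 0) ->
  (n.+1 * #|[set a | zeros a == n.-1]| <= 2 * d)%N.
Proof.
move=> sN nosig.
have EB := der_delta_bracket rpi wpi; have EC := der_delta_trC rpi wpi.
have ED := der_delta_diag rpi wpi.
have [] := coordinate_weights_count (oner_neq0 _) sN; set B0 := [set a | _]; set e := multw _.
move=> B0E le0.
pose Y := multw (wlin (zip [:: 2; -1] [:: o0; o1])).
pose X := multw (wlin (zip [:: 1; 1; -1] [:: o0; o1; o2])).
pose b (x : 'I_n * 'I_n) := wlin (zip [:: 2; -1] [:: x.1; x.2]).
pose c (x : 'I_n * 'I_n * 'I_n) := wlin (zip [:: 1; 1; -1] [:: x.1.1; x.1.2; x.2]).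
pose A := [set x : 'I_n * 'I_n | x.1 != x.2].
pose A' := [set x : ('I_n * 'I_n) * 'I_n |
      [&& (x.1.1 < x.1.2)%N, x.2 != x.1.1 & x.2 != x.1.2]].
have bY (x : 'I_n * 'I_n) : x \in A -> multw (b x) = Y.
  by rewrite inE => x12; rewrite (mult_wlin rpi wpi _ (ys := [:: o0; o1])) ?uniq2.
have cX i j k : uniq [:: i; j; k] -> multw (c (i, j, k)) = X.
  by move=> u; rewrite (mult_wlin rpi wpi _ (ys := [:: o0; o1; o2])).
have eXY : (e <= Y + n.-2 * X)%N.
  rewrite (leq_trans (mult_le_shifts EB ED EC (L := simple_pairs) _)) //.
    move=> w zw wk; apply: no_weight1_highest => // [k|i j ji].
      by rewrite zw wlinE big_seq1 /= mul1r.
    exact: (wk (i, j) (simple_pairsP ji)).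
  rewrite big_map; have -> : iota 0 p.+2 = 0%N :: iota 1 p.+1 by [].
  (* The pair [(0, 1)] raises [e_1] to [2 e_1 - e_2]; the other simple pairs raise it to
     weights of the shape [e_1 + e_2 - e_3]. *)
  rewrite big_cons leq_add //.
    rewrite -(bY (inord 0, inord 1)) ?inE -?val_eqE /= ?inordK //.
    apply/eq_leq; congr (mult _ _); apply/ffunP=> k; rewrite !ffunE !big_cons !big_nil /=.
    have -> : inord 0 = o0 :> 'I_n by apply: val_inj; rewrite /= inordK.
    by ring.
  rewrite (eq_big_seq (fun=> X)) => [|i].
    by rewrite big_const_seq count_predT size_iota iter_addn_0 mulnC.
  rewrite mem_iota => /andP[i0 ip].
  rewrite -(cX o0 (inord i) (inord i.+1)).
    congr (mult _ _); apply/ffunP=> k; rewrite !ffunE !big_cons !big_nil /=.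
    by ring.
  by rewrite /= !inE -!val_eqE /= !inordK //; lia.
have binj : {in A &, injective b} by exact: wlin2_inj.
have cinj : {in A' &, injective c}.
  move=> [[i j] k] [[i' j'] k']; rewrite !inE /= => /and3P[ij ki kj] /and3P[ij' ki' kj'] /ffunP bb.
  have ijn : i != j by apply: contraTneq ij => ->; rewrite ltnn.
  have ijn' : i' != j' by apply: contraTneq ij' => ->; rewrite ltnn.
  have kk : k = k'.
    have := bb k; rewrite !wlinE !big_cons !big_nil /= eqxx (negPf ki) (negPf kj).
    by case: (eqVneq k k') => //; do 2 case: eqP => _ //=; lia.
  subst k'; have mem l : c (i, j, k) l == 1 -> (l == i') || (l == j').
    rewrite bb !wlinE !big_cons !big_nil /=.
    case: (eqVneq l i') => // _; case: (eqVneq l j') => // _.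
    by case: (eqVneq l k).
  have := mem i; have := mem j; rewrite !wlinE !big_cons !big_nil /= !eqxx.
  rewrite [j == i]eq_sym [i == k]eq_sym [j == k]eq_sym (negPf ijn) (negPf ki) (negPf kj).
  move=> /(_ isT) mj /(_ isT); move: mj => /orP[]/eqP jE /orP[]/eqP iE; subst=> //; try by rewrite eqxx in ijn.
  by have := ltn_trans ij ij'; rewrite ltnn.
have := sum_mult alpha binj; set B := [set a | _].
rewrite (eq_bigr (fun=> Y)) => [|x xA]; last exact: bY.
rewrite sum_nat_const card_offdiag => BY.
have := sum_mult alpha cinj; set B' := [set a | _].
rewrite (eq_bigr (fun=> X)) => [|[[i j] k]]; last first.
  rewrite inE /= => /and3P[ij ki kj]; apply: cX; rewrite /= !inE negb_or.
  rewrite [i == k]eq_sym [j == k]eq_sym ki kj !andbT.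
  by apply: contraTneq ij => ->; rewrite ltnn.
rewrite sum_nat_const card_lttriples => BX.
have D : (#|B0| + #|B :|: B'| <= d)%N.
  have := @disjoint_cards 'I_d; rewrite card_ord; apply => a; rewrite !inE.
  move=> /existsP[k /andP[_ /eqP ->]] /orP[]/existsP.
    move=> [[i j]]; rewrite inE /= => /andP[ij] /eqP/ffunP/(_ i).
    rewrite !wlinE !big_cons !big_nil /= !eqxx (negPf ij).
    by case: eqP => /=; lia.
  move=> [[[i j] l]]; rewrite inE /= => /andP[/and3P[ij li lj]] /eqP/ffunP/(_ l).
  rewrite !wlinE !big_cons !big_nil /= !eqxx (negPf li) (negPf lj).
  by case: eqP => /=; lia.
have BB : #|B :|: B'| = (#|B| + #|B'|)%N.
  rewrite cardsU; have -> : B :&: B' = finset.set0; last by rewrite cards0 subn0.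
  apply/setP=> a; rewrite !inE; apply/negP => /andP[/existsP[[i j]]].
  rewrite inE /= => /andP[ij /eqP ->] /existsP[[[i' j'] k]].
  rewrite inE /= => /andP[/and3P[ij' ki kj]] /eqP/ffunP/(_ i).
  have ijn' : i' != j' by apply: contraTneq ij' => ->; rewrite ltnn.
  rewrite !wlinE !big_cons !big_nil /= !eqxx (negPf ij).
  case: (eqVneq i i') => [->|_]; first by rewrite (negPf ijn'); case: eqP => /=; lia.
  by do 2 case: eqP => _ /=; lia.
rewrite BB -BY -BX B0E in D; rewrite B0E in le0.
have bin2 := mul_pred_bin2 n.
rewrite (leq_trans (leq_mul (leqnn n.+1) le0)) // (leq_trans _ (leq_mul (leqnn 2) D)) //.
have le1 : (n * n.-1 * e <= n * n.-1 * (Y + n.-2 * X))%N by rewrite leq_mul2l eXY orbT.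
have -> : (n.+1 * (n * e) = 2 * (n * e) + n * n.-1 * e)%N by rewrite /=; ring.
rewrite mulnDr leq_add2l (leq_trans le1) // bin2; move: 'C(n, 2) n.-2 => c2 m.
have -> : (2 * (2 * c2 * Y + c2 * m * X) = 2 * c2 * (Y + m * X) + 2 * c2 * Y)%N by ring.
exact: leq_addr.
Qed.

End ZeroCount.

(** * Weights vanishing on the first coordinates *)

Section FixedWeights.
Variable K : numClosedFieldType.
Variables (n d : nat) (pi : 'M[K]_n -> 'M[K]_d) (alpha : 'I_d -> 'I_n -> int).
Hypotheses (rpi : urep pi) (wpi : weighted pi alpha).

Local Notation wt := (wt alpha).

(** The weights form a multiset which is stable under permutations of the
    coordinates. *)
Lemma card_wt_perm (P : pred {ffun 'I_n -> int}) (s : 'S_n) :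
  #|[set a | P [ffun k => wt a (s k)]]| = #|[set a | P (wt a)]|.
Proof.
pose L1 := [seq wt a | a <- enum 'I_d].
pose L2 := [seq [ffun k => wt a (s k)] | a <- enum 'I_d].
have cardL (T : eqType) (f : 'I_d -> T) (Q : pred T) :
    #|[set a | Q (f a)]| = count Q [seq f a | a <- enum 'I_d].
  rewrite count_map cardE -size_filter; congr size.
  by rewrite enumT [enum _]/enum_mem; apply: eq_filter => a; rewrite /= inE.
rewrite (cardL _ (fun a => [ffun k => wt a (s k)])) (cardL _ wt).
suff /seq.permP -> : perm_eq L2 L1 by [].
apply/allP => b _ /=; rewrite -(cardL _ wt (pred1 b)).
rewrite -(cardL _ (fun a => [ffun k => wt a (s k)]) (pred1 b)).
rewrite -[X in _ == X](mult_perm rpi wpi b (s^-1)%g); apply/eqP; apply: eq_card => a.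
rewrite !inE /=; apply/eqP/eqP => /ffunP h; apply/ffunP => k.
  by have := h ((s^-1)%g k); rewrite !ffunE permKV.
by have := h (s k); rewrite !ffunE permK.
Qed.

Definition zero_set (a : 'I_d) : {set 'I_n} := [set i | alpha a i == 0].

Definition vanishing (S : {set 'I_n}) : nat := #|[set a | S \subset zero_set a]|.

Lemma vanishing_perm (S : {set 'I_n}) (s : 'S_n) : vanishing (s @: S) = vanishing S.
Proof.
have := card_wt_perm (fun b => S \subset [set i | b i == 0]) s => h.
rewrite -[RHS](_ : #|[set a | S \subset [set i | wt a i == 0]]| = _); last first.
  apply: eq_card => a; rewrite !inE.
  suff -> : [set i | wt a i == 0] = zero_set a by [].
  by apply/setP=> i; rewrite !inE ffunE.
rewrite -h; apply: eq_card => a; rewrite !inE.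
apply/fintype.subsetP/fintype.subsetP => H i iS.
  by have := H (s i) (imset_f s iS); rewrite !inE !ffunE.
by have /imsetP[j jS ->] := iS; have := H j jS; rewrite !inE !ffunE.
Qed.

(** Sets of equal size are exchanged by a product of transpositions. *)
Lemma vanishing_card (S S' : {set 'I_n}) : #|S| = #|S'| -> vanishing S = vanishing S'.
Proof.
move Em : #|S :\: S'| => m; elim: m S Em => [|m IH] S Em SS'.
  move/eqP: Em; rewrite cards_eq0 finset.setD_eq0 => sub.
  by congr vanishing; apply/eqP; rewrite eqEcard sub SS' leqnn.
have [x] : exists x, x \in S :\: S' by apply/card_gt0P; rewrite Em.
rewrite inE => /andP[xS' xS].
have [y] : exists y, y \in S' :\: S.
  apply/card_gt0P; have := cardsID S' S; have := cardsID S S'.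
  by rewrite finset.setIC; lia.
rewrite inE => /andP[yS yS'].
have xy : x != y by apply: contraNneq yS => <-.
rewrite -(vanishing_perm S (tperm x y)).
have TS : tperm x y @: S = y |: (S :\ x).
  apply/setP=> z; apply/imsetP/idP => [[w wS ->]|].
    rewrite !inE; case: tpermP => [_|wy|/eqP wx /eqP wy]; rewrite ?eqxx //.
      by rewrite -wy wS in yS.
    by rewrite wx wS orbT.
  rewrite !inE => /orP[/eqP ->|/andP[zx zS]]; first by exists x; rewrite ?tpermL.
  exists z => //; rewrite tpermD // eq_sym //.
  by apply: contraNneq yS => <-.
apply: IH; rewrite TS.
  have -> : (y |: S :\ x) :\: S' = (S :\: S') :\ x.
    apply/setP=> z; rewrite !inE; case: (eqVneq z y) => [->|_] /=.
      by rewrite yS' /= andbF.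
    by rewrite andbCA.
  by have := cardsD1 x (S :\: S'); rewrite Em inE xS' xS; lia.
rewrite cardsU1 !inE (negPf yS) andbF /= -SS'.
by have := cardsD1 x S; rewrite xS.
Qed.

Definition initial (k : nat) : {set 'I_n} := [set i : 'I_n | (i < k)%N].

Lemma card_initial k : (k <= n)%N -> #|initial k| = k.
Proof.
move=> kn; rewrite -sum1_card (eq_bigl (fun i : 'I_n => (i < k)%N)) => [|i].
  by rewrite (big_ord_narrow kn) sum1_card card_ord.
by rewrite inE.
Qed.

(** Count the pairs of a [k]-subset and a basis vector whose weight vanishes on it;
    by symmetry all the subsets contribute equally. *)
Lemma bin_vanishing k : (k <= n)%N ->
  ('C(n, k) * vanishing (initial k) = \sum_a 'C(#|zero_set a|, k))%N.
Proof.
move=> kn; have -> : 'C(n, k) = #|[set S : {set 'I_n} | #|S| == k]|.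
  by rewrite -[in LHS](card_ord n) -card_draws.
rewrite -sum_nat_const; transitivity (\sum_(S in [set S : {set 'I_n} | #|S| == k])
    \sum_a (S \subset zero_set a : nat))%N.
  apply: eq_bigr => S; rewrite inE => /eqP Sk.
  rewrite -(@vanishing_card S) ?card_initial // /vanishing -sum1_card big_mkcond /=.
  by apply: eq_bigr => a _; rewrite inE; case: (_ \subset _).
rewrite exchange_big /=; apply: eq_bigr => a _.
rewrite -cards_draws -sum1_card [RHS]big_mkcond [LHS]big_mkcond /=.
by apply: eq_bigr => S _; rewrite !inE andbC; case: (#|S| == k); case: (_ \subset _).
Qed.

End FixedWeights.

(** [C(z, k) / C(n, k)] is the probability that a random [k]-subset of [n] points
    avoids [n - z] given ones. It decreases with the number of these, and two points
    are avoided with probability [(n - k) (n - k - 1) / (n (n - 1))]. *)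
Lemma bin_zero_bound n k z : (1 < n)%N -> (k <= n)%N -> (z <= n)%N ->
  (n * n.-1 * 'C(z, k) <=
   (if z == n then n * n.-1 else if z == n.-1 then n.-1 * (n - k)
    else (n - k) * (n - k).-1) * 'C(n, k))%N.
Proof.
case: n => [|[|m]] //= _ kn zn.
have [->//|zn'] := eqVneq z m.+2.
have b1 : (m.+2 * 'C(m.+1, k) = (m.+2 - k) * 'C(m.+2, k))%N.
  by rewrite mul_bin_down.
have b2 : (m.+1 * 'C(m, k) = (m.+1 - k) * 'C(m.+1, k))%N by rewrite mul_bin_down.
have [->|zn''] := eqVneq z m.+1.
  by rewrite [(m.+2 * m.+1)%N]mulnC -mulnA b1 mulnA.
have zm : (z <= m)%N by lia.
rewrite (leq_trans (leq_mul (leqnn _) (leq_bin2l k zm))) //.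
rewrite -mulnA b2 mulnCA b1 mulnCA mulnA leq_mul2r.
by rewrite -subn1 -subnDA addn1 subSS leqnn orbT.
Qed.

Section GapBound.
Variable K : numClosedFieldType.
Variables (p d : nat).
Local Notation n := p.+3.
Variables (pi : 'M[K]_n -> 'M[K]_d) (alpha : 'I_d -> 'I_n -> int).
Hypotheses (rpi : urep pi) (wpi : weighted pi alpha).

Let m0 := #|[set a | zeros alpha a == n]|.
Let m1 := #|[set a | zeros alpha a == n.-1]|.
Let q k := vanishing alpha (initial n k).

(** The weights with at least two nonzero coordinates contribute at most a quarter
    each on average over the two halves [h] and [h'] of [n], since
    [2 (h (h - 1) + h' (h' - 1)) <= n (n - 1)]. *)
Lemma vanishing_halves_le : (2 * (q n./2 + q n.+1./2) <= d + 3 * m0 + m1)%N.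
Proof.
have nn : (n./2 + n.+1./2 = n)%N by lia.
have nh : (n.+1./2 = n./2 \/ n.+1./2 = n./2.+1)%N by lia.
move: (n./2) (n.+1./2) nn nh => h h' nn nh.
pose g k z := (if z == n then n * n.-1 else if z == n.-1 then n.-1 * (n - k)
    else (n - k) * (n - k).-1)%N.
have gq k : (k <= n)%N -> (n * n.-1 * q k <= \sum_a g k (zeros alpha a))%N.
  move=> kn; have C0 : (0 < 'C(n, k))%N by rewrite bin_gt0.
  rewrite -(leq_pmul2r C0) -mulnA [(q k * _)%N]mulnC (bin_vanishing rpi wpi kn).
  rewrite big_distrr big_distrl /=; apply: leq_sum => a _.
  by apply: bin_zero_bound => //; rewrite -[X in (_ <= X)%N]card_ord max_card.
have h1 : (h <= n)%N by lia.
have h2 : (h' <= n)%N by lia.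
have := leq_add (gq _ h1) (gq _ h2); rewrite -big_split /= -mulnDr => H.
suff : (n * n.-1 * (2 * (q h + q h')) <= n * n.-1 * (d + 3 * m0 + m1))%N.
  by rewrite leq_pmul2l.
rewrite mulnCA (leq_trans (leq_mul (leqnn 2) H)) //.
have -> : (d + 3 * m0 + m1 = \sum_a (1 + 3 * (zeros alpha a == n) + (zeros alpha a == n.-1)))%N.
  have cE (P : pred 'I_d) : (#|[set a | P a]| = \sum_a P a)%N.
    by rewrite -sum1_card big_mkcond; apply: eq_bigr => a _; rewrite inE; case: (P a).
  by rewrite /m0 /m1 !cE big_distrr /= !big_split /= sum1_card card_ord.
rewrite !big_distrr /=; apply: leq_sum => a _; rewrite /g.
have [->|z0] := eqVneq (zeros alpha a) n.
  (* Weight 0: the two halves contribute 1 each, that is [4 = 1 + 3] after doubling. *)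
  by rewrite /= [_ == p.+2]gtn_eqF //; lia.
have [-> ->] : (n - h = h' /\ n - h' = h)%N by lia.
have [z1|z1] := eqVneq (zeros alpha a) n.-1.
  (* One nonzero coordinate: the contributions [(n - k) / n] of the halves add up
     to 1. *)
  by rewrite -mulnDr addnC nn muln0 addn0 /=; lia.
rewrite !muln0 !addn0 muln1; have [l hE] : exists l, h = l.+1 by exists h.-1; lia.
have -> : (p.+3 * p.+2 = (h + h') * (h + h').-1)%N by rewrite nn.
by rewrite hE; case: nh => ->; rewrite hE /=; lia.
Qed.

Lemma gap_bound_of_counts :
  ((n.+1 * m0 <= d)%N /\ m1 = 0%N) \/ (m0 = 0%N /\ (n.+1 * m1 <= 2 * d)%N) ->
  (2 * n.+1 * (q n./2 + q n.+1./2) <= (n + 4) * d)%N.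
Proof.
have := vanishing_halves_le; move: (q _ + q _)%N m0 m1 => s k0 k1 H h.
have := leq_mul (leqnn n.+1) H; rewrite mulnCA !mulnDr !mulnDl mulnA.
by case: h => [[h ->]|[-> h]]; lia.
Qed.

End GapBound.

(** * The dimension bound *)

Section WeightedGap.
Variable K : numClosedFieldType.

Lemma map_conjK m q : involutive (map_mx Num.conj : 'M[K]_(m, q) -> 'M[K]_(m, q)).
Proof. by move=> A; apply/matrixP=> i j; rewrite !mxE conjCK. Qed.

Lemma conj_irreducible_family T d (f : T -> 'M[K]_d) :
  irreducible_family f -> irreducible_family (fun t => map_mx Num.conj (f t)).
Proof.
move=> [d0 irr]; split=> // V stV.
have [t||] := irr (map_mx Num.conj V).
- have := stV t; rewrite -(map_submx (Num.conj : {rmorphism K -> K})) map_mxM.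
  suff -> : map_mx Num.conj ((map_mx Num.conj (f t))^T) = (f t)^T by [].
  by apply/matrixP=> i j; rewrite !mxE conjCK.
- move=> V0; left; apply/matrixP=> i j; have /matrixP/(_ i j) := V0.
  by rewrite !mxE => /eqP; rewrite conjC_eq0 => /eqP.
by rewrite /row_full mxrank_map; right.
Qed.

Variables (p d : nat).
Local Notation n := p.+3.

(** The derivative along the scalar matrices commutes with the representation; it is
    diagonal, with the coordinate sums as entries, and scalar by Schur's lemma. *)
Lemma sum_weights_const (pi : 'M[K]_n -> 'M[K]_d) alpha :
  urep pi -> weighted pi alpha ->
  irreducible_family (fun u : {u : 'M[K]_n | u \is unitarymx} => pi (sval u)) ->
  exists N, forall a, \sum_i alpha a i = N.
Proof.
move=> rpi wpi irr.
have d1 : diag_mx (const_mx 1) = 1%:M :> 'M[K]_n by rewrite diag_const_mx.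
have [u|c cE] := schur_scalar (J := der pi alpha (diag_mx (const_mx 1))) irr.
  have uu := svalP u; have := derJ rpi wpi (diag_mx (const_mx 1)) uu.
  rewrite d1 mulmx1 unitarymx_mulC // -d1 => E.
  rewrite [in RHS]E -[RHS]mulmxA unitarymx_Cmul ?mulmx1 //.
  exact: (urep_unitary rpi uu).
have dE a : (\sum_i alpha a i)%:~R = c.
  have /matrixP/(_ a a) := cE; rewrite (der_diag rpi wpi) !mxE eqxx !mulr1n => <-.
  by rewrite rmorph_sum; apply: eq_bigr => i _; rewrite mxE mulr1.
case: irr => d0 _; exists (\sum_i alpha (Ordinal d0) i) => a.
by apply: (@intr_inj K); rewrite !dE.
Qed.

Lemma weighted_gap_nonneg (pi : 'M[K]_n -> 'M[K]_d) alpha N :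
  urep pi -> weighted pi alpha ->
  irreducible_family (fun u : {u : 'M[K]_n | u \is unitarymx} => pi (sval u)) ->
  ~ (forall u, u \is unitarymx -> pi u = 1%:M) ->
  (forall J : 'M[K]_(d, n), (forall u, u \is unitarymx -> pi u *m J = J *m u) -> J = 0) ->
  0 <= N -> (forall a, \sum_i alpha a i = N) ->
  (2 * n.+1 * (vanishing alpha (initial n n./2) + vanishing alpha (initial n n.+1./2))
    <= (n + 4) * d)%N.
Proof.
move=> rpi wpi irr ntriv nosig N0 sN; apply: (gap_bound_of_counts rpi wpi).
have [NE|Nn0] := eqVneq N 0.
  left; split; first exact: (weight0_count rpi wpi irr).
  apply: eq_card0 => a; rewrite !inE; apply/negbTE/zero_sum_zeros.
  by rewrite sN NE.
right; split.
  by apply: eq_card0 => a; rewrite !inE; apply/negbTE/nonzero_sum_zeros; rewrite sN.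
have [N1|N1] := eqVneq N 1.
  by apply: (weight1_count rpi wpi) => // a; rewrite sN N1.
by apply: (weight_ge2_count rpi wpi (N := N)) => //; lia.
Qed.

(** Conjugation negates the weights and exchanges the defining representation with
    its conjugate, so the coordinate sum may be taken nonnegative. *)
Lemma weighted_gap (pi : 'M[K]_n -> 'M[K]_d) alpha :
  urep pi -> weighted pi alpha ->
  irreducible_family (fun u : {u : 'M[K]_n | u \is unitarymx} => pi (sval u)) ->
  ~ (forall u, u \is unitarymx -> pi u = 1%:M) ->
  (forall J : 'M[K]_(d, n), (forall u, u \is unitarymx -> pi u *m J = J *m u) -> J = 0) ->
  (forall J : 'M[K]_(d, n),
     (forall u, u \is unitarymx -> pi u *m J = J *m map_mx Num.conj u) -> J = 0) ->
  (2 * n.+1 * (vanishing alpha (initial n n./2) + vanishing alpha (initial n n.+1./2))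
    <= (n + 4) * d)%N.
Proof.
move=> rpi wpi irr ntriv nosig nosigC.
have [N sN] := sum_weights_const rpi wpi irr.
have [N0|N0] := lerP 0 N; first by exact: (weighted_gap_nonneg rpi wpi irr ntriv nosig N0 sN).
pose piC u : 'M[K]_d := map_mx Num.conj (pi u).
pose alphaC a i := - alpha a i.
have conj_inj m q : injective (map_mx Num.conj : 'M[K]_(m, q) -> _).
  by move=> A B AB; rewrite -[A]map_conjK AB map_conjK.
have rpiC : urep piC.
  split=> [u uu|u v uu vu]; first by rewrite /piC conjC_unitary (urep_unitary rpi).
  by rewrite /piC (urepM rpi) // map_mxM.
have wpiC : weighted piC alphaC.
  move=> z z1; rewrite /piC wpi // map_diag_mx; congr diag_mx; apply/rowP=> a.
  rewrite !mxE rmorph_prod; apply: eq_bigr => i _ /=.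
  have zi0 : z 0 i != 0 by rewrite -normr_gt0 z1.
  rewrite /alphaC -exprz_inv rmorphXz ?unitfE //; congr exprz.
  by apply: (mulfI zi0); rewrite divff // -normCK z1 expr1n.
have vE S : vanishing alpha S = vanishing alphaC S.
  apply: eq_card => a; rewrite !inE.
  suff -> : zero_set alpha a = zero_set alphaC a by [].
  by apply/setP=> i; rewrite !inE /alphaC oppr_eq0.
rewrite !vE; apply: (weighted_gap_nonneg (N := - N) rpiC wpiC).
- exact: conj_irreducible_family irr.
- move=> H; apply: ntriv => u uu; apply: (@conj_inj _ _); rewrite map_mx1.
  exact: H.
- move=> J HJ; apply: (@conj_inj _ _); rewrite map_mx0; apply: nosigC => u uu.
  apply: (@conj_inj _ _); rewrite !map_mxM !map_conjK.
  exact: HJ.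
- by rewrite oppr_ge0 ltW.
by move=> a; rewrite sumrN sN.
Qed.

End WeightedGap.

(** * Unitary equivalence *)

Section UnitaryEquivalence.
Variables (K : numClosedFieldType) (T : Type).

Definition unitary_equivalent d e (f : T -> 'M[K]_d) (g : T -> 'M[K]_e) : Prop :=
  exists u : 'M[K]_(d, e),
    [/\ u \is unitarymx, u^t* \is unitarymx & forall t, f t *m u = u *m g t].

Lemma coisometryK d e (u : 'M[K]_(d, e)) : u^t* \is unitarymx -> u^t* *m u = 1%:M.
Proof. by move/unitarymxP; rewrite trmxCK. Qed.

Lemma unitary_equivalent_sym d e (f : T -> 'M[K]_d) (g : T -> 'M[K]_e) :
  unitary_equivalent f g -> unitary_equivalent g f.
Proof.
move=> [u [uu uC fu]]; exists (u^t*); split; rewrite ?trmxCK // => t.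
have /(congr1 (fun A => u^t* *m A *m u^t*)) := fu t.
rewrite /= !mulmxA coisometryK // mul1mx => <-.
by rewrite -!mulmxA (unitarymxP uu) mulmx1.
Qed.

Lemma unitary_equivalent_trans d e q (f : T -> 'M[K]_d) (g : T -> 'M[K]_e)
    (h : T -> 'M[K]_q) :
  unitary_equivalent f g -> unitary_equivalent g h -> unitary_equivalent f h.
Proof.
move=> [u [uu uC fu]] [v [vu vC gv]]; exists (u *m v); split.
- exact: mul_unitarymx.
- by rewrite trmxC_mul mul_unitarymx.
by move=> t; rewrite mulmxA fu -mulmxA gv mulmxA.
Qed.

Lemma unitary_equivalent_conj d e (f : T -> 'M[K]_d) (g : T -> 'M[K]_e) :
  unitary_equivalent f g ->
  unitary_equivalent (fun t => map_mx Num.conj (f t)) (fun t => map_mx Num.conj (g t)).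
Proof.
move=> [u [uu uC fu]]; exists (map_mx Num.conj u); split.
- by rewrite conjC_unitary.
- by rewrite map_trmx conjC_unitary.
by move=> t; rewrite -!map_mxM fu.
Qed.

Lemma unitary_equivalent_dim d e (f : T -> 'M[K]_d) (g : T -> 'M[K]_e) :
  unitary_equivalent f g -> d = e.
Proof.
move=> [u [uu uC _]]; apply/eqP; rewrite eqn_leq.
rewrite -{1}(mxrank_unitary uu) rank_leq_col -{1}(mxrank_unitary uC).
exact: rank_leq_col.
Qed.

Lemma unitary_equivalentE d e (f : T -> 'M[K]_d) (g : T -> 'M[K]_e) (u : 'M[K]_(d, e)) :
  u \is unitarymx -> (forall t, f t *m u = u *m g t) ->
  forall t, f t = u *m g t *m u^t*.
Proof. by move=> uu fu t; rewrite -fu -mulmxA (unitarymxP uu) mulmx1. Qed.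

Lemma unitary_equivalent_trace d e (f : T -> 'M[K]_d) (g : T -> 'M[K]_e) :
  unitary_equivalent f g -> forall t, \tr (f t) = \tr (g t).
Proof.
move=> [u [uu uC fu]] t; rewrite (unitary_equivalentE uu fu) mxtrace_mulC mulmxA.
by rewrite coisometryK // mul1mx.
Qed.

Lemma unitary_equivalent_irreducible d e (f : T -> 'M[K]_d) (g : T -> 'M[K]_e) :
  unitary_equivalent f g -> irreducible_family g -> irreducible_family f.
Proof.
move=> fg; have de := unitary_equivalent_dim fg; subst e.
have [u [uu uC fu]] := fg.
move=> [d0 irr]; split=> // V stV.
pose c := map_mx Num.conj u; have cu : c \is unitarymx by rewrite conjC_unitary.
have cuT : c *m u^T = 1%:M.
  have /(congr1 trmx) := unitarymx_mulC uu.
  by rewrite trmx_mul trmx1 -map_trmx trmxK.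
have uTc : u^T *m c = 1%:M.
  have /(congr1 trmx) := coisometryK uC.
  by rewrite trmx_mul trmx1 -map_trmx trmxK.
have comm t : (f t)^T *m c = c *m (g t)^T.
  have /(congr1 (fun A => c *m A^T *m c)) := fu t.
  by rewrite /= !trmx_mul !mulmxA cuT mul1mx -!mulmxA uTc mulmx1.
have [t|Vc0|] := irr (V *m c).
- by rewrite -mulmxA -comm mulmxA submxMr ?stV.
- by left; rewrite -[V]mulmx1 -cuT mulmxA Vc0 mul0mx.
by rewrite !row_full_unit unitmx_mul => /andP[Vu _]; right.
Qed.

Lemma unitary_conjM d (Q A B : 'M[K]_d) : Q \is unitarymx ->
  Q *m (A *m B) *m Q^t* = (Q *m A *m Q^t*) *m (Q *m B *m Q^t*).
Proof.
move=> uQ; rewrite !mulmxA -[_ *m Q^t* *m Q]mulmxA.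
by rewrite (unitarymx_Cmul uQ) mulmx1.
Qed.

Lemma unitary_conj_unitary d (Q A : 'M[K]_d) : Q \is unitarymx -> A \is unitarymx ->
  Q *m A *m Q^t* \is unitarymx.
Proof. by move=> uQ uA; rewrite !mul_unitarymx // unitarymxC. Qed.

Lemma unitary_conj_eq d e (Q : 'M[K]_d) A (J : 'M[K]_(d, e)) B : Q \is unitarymx ->
  Q *m A *m Q^t* *m J = J *m B -> A *m (Q^t* *m J) = Q^t* *m J *m B.
Proof.
move=> uQ /(congr1 (mulmx (Q^t*))); rewrite !mulmxA (unitarymx_Cmul uQ) mul1mx.
by move=> ->.
Qed.

Lemma unitary_conj_eq1 d (Q A : 'M[K]_d) : Q \is unitarymx ->
  Q *m A *m Q^t* = 1%:M -> A = 1%:M.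
Proof.
move=> uQ /(congr1 (fun B => Q^t* *m B *m Q)); rewrite /= mulmx1 !mulmxA.
by rewrite (unitarymx_Cmul uQ) mul1mx -mulmxA (unitarymx_Cmul uQ) mulmx1.
Qed.

Lemma unitary_Cmul_eq0 d e (Q : 'M[K]_d) (J : 'M[K]_(d, e)) : Q \is unitarymx ->
  Q^t* *m J = 0 -> J = 0.
Proof.
by move=> uQ QJ; rewrite -[J]mul1mx -(unitarymx_mulC uQ) -mulmxA QJ mulmx0.
Qed.

Lemma unitary_equivalent_conjugate d (f : T -> 'M[K]_d) (Q : 'M[K]_d) :
  Q \is unitarymx -> unitary_equivalent (fun t => Q *m f t *m Q^t*) f.
Proof.
move=> uQ; exists Q; split=> [||t]; rewrite ?unitarymxC //.
by rewrite -!mulmxA (unitarymx_Cmul uQ) mulmx1.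
Qed.

Lemma mxtrace_unitary_conj d (Q A : 'M[K]_d) : Q \is unitarymx ->
  \tr (Q *m A *m Q^t*) = \tr A.
Proof.
by move=> uQ; rewrite mxtrace_mulC mulmxA (unitarymx_Cmul uQ) mul1mx.
Qed.

End UnitaryEquivalence.

Section DefiningRepresentation.
Variables (K : numClosedFieldType) (n : nat).

(** A nonzero invariant subspace contains a basis vector, obtained from any of its
    vectors by flipping one sign and subtracting, and then all of them by
    permuting. *)
Lemma defining_irreducible : (0 < n)%N ->
  irreducible_family (fun u : {u : 'M[K]_n | u \is unitarymx} => sval u).
Proof.
move=> n0; split=> // V stV.
have [->|/matrix0Pn[i [j Vij]]] := eqVneq V 0; [by left|right].
have st (u : 'M[K]_n) : u \is unitarymx -> (V *m u^T <= V)%MS.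
  by move=> uu; have := stV (exist _ u uu).
pose z : 'rV[K]_n := \row_k (if k == j then -1 else 1).
have uz : diag_mx z \is unitarymx.
  by apply: diag_unitarymx => k; rewrite mxE; case: ifP; rewrite ?normrN normr1.
have ej : ((delta_mx 0 j : 'rV[K]_n) <= V)%MS.
  have : (row i (V - V *m (diag_mx z)^T) <= V)%MS.
    rewrite (submx_trans (row_sub i _)) // addmx_sub //.
    by rewrite -scaleN1r scalemx_sub ?st.
  suff -> : row i (V - V *m (diag_mx z)^T) = (2 * V i j) *: delta_mx 0 j.
    have nz : 2 * V i j != 0 by rewrite mulf_neq0 // pnatr_eq0.
    by move=> h; rewrite -[_ 0 j](scalerK nz) scalemx_sub.
  apply/rowP=> k; rewrite tr_diag_mx mul_mx_diag !mxE eqxx /=.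
  by case: eqP => [->|_]; rewrite ?mulr1n ?mulr0n; ring.
rewrite -sub1mx; apply/row_subP => k; rewrite rowE mulmx1.
have -> : delta_mx 0 k = delta_mx 0 j *m (perm_mx (tperm j k))^T :> 'rV[K]_n.
  rewrite tr_perm_mx tpermV -rowE; apply/rowP=> l; rewrite !mxE.
  by rewrite eqxx tpermL eq_sym.
by apply: submx_trans (submxMr _ ej) _; rewrite st ?perm_mx_unitary.
Qed.

End DefiningRepresentation.

Local Open Scope classical_set_scope.
Local Open Scope ring_scope.

(** * Diagonalization of the torus *)

Section SimultaneousDiagonalization.
Variable K : numClosedFieldType.

(** Add members of the family as long as the rank of their span grows. *)
Lemma finite_spanning (T : Type) m (f : T -> 'rV[K]_m) :
  exists ts : seq T, forall t,
    (f t <= \sum_(s <- ts) <<f s>>)%MS.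
Proof.
suff H k : (exists ts : seq T, forall t, (f t <= \sum_(s <- ts) <<f s>>)%MS) \/
    (exists ts : seq T, (k <= \rank (\sum_(s <- ts) <<f s>>)%MS)%N).
  have [//|[ts]] := H m.+1.
  by move=> h; have := leq_trans h (rank_leq_row _); rewrite ltnn.
elim: k => [|k [IH|[ts IH]]]; [by right; exists [::]|by left|].
have [all_in|/existsNP[t nt]] := pselect (forall t, (f t <= \sum_(s <- ts) <<f s>>)%MS).
  by left; exists ts.
right; exists (t :: ts); rewrite (leq_ltn_trans IH) // big_cons ltnNge; apply/negP => h; apply: nt.
have := mxrank_leqif_sup (addsmxSr <<f t>>%MS (\sum_(s <- ts) <<f s>>)%MS).
case=> le /esym; rewrite eqn_leq le h /= => sub.
by rewrite (submx_trans _ sub) // (submx_trans _ (addsmxSl _ _)) // genmxE.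
Qed.

(** Finitely many members span the family. In a common orthonormal triangular form of
    these and of their adjoints, each of them is both upper and lower triangular. *)
Lemma simultaneous_diagonalization (T : eqType) d (S : T -> 'M[K]_d) (inv : T -> T) :
  (forall s t, S s *m S t = S t *m S s) -> (forall t, S (inv t) = (S t)^t*) ->
  exists2 Q : 'M[K]_d, Q \is unitarymx &
    forall t i j, i != j -> (Q *m S t *m Q^t*) i j = 0.
Proof.
move=> Scomm Sinv; have [ts span] := finite_spanning (fun t => mxvec (S t)).
have [|Q uQ /allP Qtrig] := @cotrigonalization K d
    ([seq S t | t <- ts] ++ [seq S (inv t) | t <- ts]).
  move=> A B; rewrite !mem_cat => /orP[]/mapP[s _ ->] /orP[]/mapP[t _ ->];
  exact: Scomm.
exists Q => // t i j ij.
have Qu := unitarymx_unit uQ.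
have trigP A (k l : 'I_d) : similar_trig Q A -> (k < l)%N -> (Q *m A *m Q^t*) k l = 0.
  by move=> /is_trig_mxP H kl; have := H k l kl; rewrite /= conjymx.
have dS s : s \in ts -> (Q *m S s *m Q^t*) i j = 0.
  move=> sts; case: (ltngtP i j) => [lt|gt|/val_inj E].
  - by apply: trigP => //; apply: Qtrig; rewrite mem_cat map_f.
  - have := trigP (S (inv s)) j i _ gt.
    have -> : Q *m S (inv s) *m Q^t* = (Q *m S s *m Q^t*)^t*.
      by rewrite Sinv !trmxC_mul trmxCK mulmxA.
    rewrite [LHS]mxE [X in X^*]mxE => H; apply/eqP; rewrite -conjC_eq0; apply/eqP/H.
    apply: Qtrig; rewrite mem_cat; apply/orP; right.
    exact: (map_f (fun u => S (inv u))).
  by rewrite E eqxx in ij.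
(* The off-diagonal entry is a linear form [c] on matrices, which vanishes on a
   spanning set. *)
pose c : 'cV[K]_(d * d) :=
  lin_mx (mulmxr (Q^t*) \o mulmx Q) *m delta_mx (mxvec_index i j) 0.
have cE A : (mxvec A *m c) 0 0 = (Q *m A *m Q^t*) i j.
  rewrite mulmxA mul_vec_lin /= mxE (bigD1 (mxvec_index i j)) //= big1 => [|k ki].
    by rewrite mxE !eqxx mulr1 addr0 mxvecE.
  by rewrite mxE (negPf ki) mulr0.
have : (mxvec (S t) <= kermx c)%MS.
  apply: submx_trans (span t) _; rewrite big_seq.
  apply: (big_ind (fun A => A <= kermx c)%MS) => [|A B|s sts].
  - exact: sub0mx.
  - by rewrite addsmx_sub => -> ->.
  rewrite genmxE; apply/sub_kermxP/matrixP=> k l.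
  by rewrite !ord1 [RHS]mxE cE dS.
by move/sub_kermxP/matrixP/(_ 0 0); rewrite cE [RHS]mxE.
Qed.

(** The images of the diagonal unitary matrices commute with each other and with
    their adjoints, so they have a common orthonormal eigenbasis. *)
Lemma torus_characters n d (pi : 'M[K]_n -> 'M[K]_d) : urep pi ->
  exists2 Q : 'M[K]_d, Q \is unitarymx &
    exists chi : 'I_d -> 'rV[K]_n -> K,
    [/\ forall z : 'rV[K]_n, (forall i, `|z 0 i| = 1) ->
           Q *m pi (diag_mx z) *m Q^t* = diag_mx (\row_a chi a z),
        forall a (z w : 'rV[K]_n), (forall i, `|z 0 i| = 1) ->
           (forall i, `|w 0 i| = 1) -> chi a (\row_i (z 0 i * w 0 i)) = chi a z * chi a w,
        forall a (z : 'rV[K]_n), (forall i, `|z 0 i| = 1) -> `|chi a z| = 1 &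
        forall a z, chi a z = (Q *m pi (diag_mx z) *m Q^t*) a a].
Proof.
move=> rpi; case: (rpi) => piu piM.
(* Row vectors which are not unimodular are sent to the identity, to obtain a family
   indexed by a whole type. *)
pose tz (z : 'rV[K]_n) := if [forall i, `|z 0 i| == 1] then diag_mx z else 1%:M.
have tzE (z : 'rV[K]_n) : (forall i, `|z 0 i| = 1) -> tz z = diag_mx z.
  by move=> z1; rewrite /tz; case: forallP => // h; case: h => i; rewrite z1.
have tzu z : tz z \is unitarymx.
  by rewrite /tz; case: forallP => h; rewrite ?unitarymx1 // diag_unitarymx // => i; apply/eqP.
have [z w|z|Q uQ diagQ] := @simultaneous_diagonalization _ d (fun z => pi (tz z))
    (map_mx Num.conj).
- rewrite -!piM //; congr pi; rewrite /tz.
  by case: ifP => _; case: ifP => _; rewrite ?mulmx1 ?mul1mx // diag_mxC.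
- rewrite -urepV //; congr pi; rewrite /tz.
  have -> : [forall i, `|map_mx Num.conj z 0 i| == 1] = [forall i, `|z 0 i| == 1].
    by apply: eq_forallb => i; rewrite mxE norm_conjC.
  by case: ifP => _; rewrite ?trmxC_diag ?trmxC1.
exists Q => //; exists (fun a z => (Q *m pi (diag_mx z) *m Q^t*) a a).
have piD (z : 'rV[K]_n) : (forall i, `|z 0 i| = 1) -> Q *m pi (diag_mx z) *m Q^t* =
    diag_mx (\row_a (Q *m pi (diag_mx z) *m Q^t*) a a).
  move=> z1; apply/matrixP=> a b; rewrite [RHS]mxE.
  case: (eqVneq a b) => [<-|ab]; first by rewrite [in RHS]mxE.
  by have := diagQ z a b ab; rewrite tzE.
have [piuQ piMQ] := urep_conjugate uQ rpi.
have diag_entry (v : 'rV[K]_d) a : diag_mx v a a = v 0 a by rewrite mxE eqxx mulr1n.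
split=> // [a z w z1 w1|a z z1].
  have /= E := piMQ _ _ (diag_unitarymx z1) (diag_unitarymx w1).
  rewrite -mulmx_diag E.
  move: (piD z z1) (piD w w1); move: (_ *m _ *m _) (_ *m _ *m _) => A B -> ->.
  by rewrite mulmx_diag !diag_entry !mxE.
have := unitarymx_mulC (piuQ _ (diag_unitarymx z1)); move: (piD z z1).
move: (_ *m _ *m _) => A ->; rewrite trmxC_diag mulmx_diag => /matrixP/(_ a a).
rewrite !diag_entry !mxE eqxx mulr1n -normCK => /eqP.
by rewrite sqrp_eq1 ?normr_ge0 // => /eqP.
Qed.

End SimultaneousDiagonalization.

(** * Characters of the line *)

Section Circle.
Variable R : realType.

Definition circ (t : R) : C R := Complex (cos t) (sin t).

Lemma circD a b : circ (a + b) = circ a * circ b.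
Proof.
apply/eqP; rewrite eq_complex /= cosD sinD; apply/andP; split; apply/eqP => //.
by rewrite addrC.
Qed.

Lemma norm_complexE (z : C R) :
  `|z| = Complex (Num.sqrt (complex.Re z ^+ 2 + complex.Im z ^+ 2)) 0 :> C R.
Proof. by case: z. Qed.

Lemma norm_circ t : `|circ t| = 1.
Proof. by rewrite norm_complexE /= cos2Dsin2 sqrtr1. Qed.

Lemma circ0 : circ 0 = 1.
Proof. by rewrite /circ cos0 sin0. Qed.

Lemma circ_neq0 t : circ t != 0.
Proof. by rewrite -normr_gt0 norm_circ. Qed.

Lemma circN t : circ (- t) = (circ t)^-1.
Proof.
by apply: (mulfI (circ_neq0 t)); rewrite -circD subrr circ0 divff ?circ_neq0.
Qed.

Lemma circMn t k : circ (t *+ k) = circ t ^+ k.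
Proof. by elim: k => [|k IH]; rewrite ?circ0 // mulrS circD IH exprS. Qed.

Lemma circMz t (m : int) : circ (t *~ m) = exprz (circ t) m.
Proof.
by case: m => m; rewrite ?NegzE -?exprnN ?mulrNz ?circN circMn.
Qed.

Lemma normC1_Re_Im (z : C R) : `|z| = 1 -> complex.Re z ^+ 2 + complex.Im z ^+ 2 = 1.
Proof.
rewrite norm_complexE => -[] /(congr1 (fun x => x ^+ 2)).
by rewrite sqr_sqrtr ?addr_ge0 ?sqr_ge0 // expr1n.
Qed.

Lemma circ_right_half (z : C R) : `|z| = 1 -> 0 < complex.Re z ->
  exists2 psi, `|psi| <= pi / 2 & z = circ psi.
Proof.
move=> /normC1_Re_Im z1 Re0.
have Im1 : -1 <= complex.Im z <= 1.
  by move: z1; move: (complex.Re z) (complex.Im z) => x y xy; apply/andP; split; nra.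
exists (asin (complex.Im z)).
  by rewrite ler_norml asin_geNpi2 ?asin_lepi2.
apply/eqP; rewrite eq_complex /= asinK // cos_asin //.
rewrite (_ : 1 - _ = complex.Re z ^+ 2); last by rewrite -z1 addrK.
by rewrite sqrtr_sqr gtr0_norm ?eqxx.
Qed.

Lemma circ_surj (z : C R) : `|z| = 1 -> exists t, z = circ t.
Proof.
move=> /normC1_Re_Im z1.
have Re1 : -1 <= complex.Re z <= 1.
  by move: z1; move: (complex.Re z) (complex.Im z) => x y xy; apply/andP; split; nra.
have E : 1 - complex.Re z ^+ 2 = complex.Im z ^+ 2 by rewrite -z1 addrC addKr.
have [Im0|Im0] := lerP 0 (complex.Im z).
  exists (acos (complex.Re z)); apply/eqP; rewrite eq_complex /= acosK // sin_acos //.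
  by rewrite E sqrtr_sqr ger0_norm ?eqxx.
exists (- acos (complex.Re z)); apply/eqP.
rewrite eq_complex /= cosN sinN acosK // sin_acos //.
by rewrite E sqrtr_sqr ltr0_norm ?opprK ?eqxx.
Qed.

Lemma circ_pi : circ pi = -1.
Proof. by apply/eqP; rewrite /circ cospi sinpi eq_complex /= oppr0 !eqxx. Qed.

Lemma circ2pi : circ (pi *+ 2) = 1.
Proof. by rewrite /circ cos2pi sin2pi. Qed.

(** Removing the integer part leaves [0 <= a < 1], where [sin (pi a)] vanishes
    at 0 only. *)
Lemma circ_period a : circ (a * pi *+ 2) = 1 -> exists m : int, a = m%:~R.
Proof.
move=> a1; set m := Num.floor a; exists m.
pose r := a - m%:~R.
have r0 : 0 <= r by rewrite subr_ge0 floor_le.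
have r1 : r < 1 by rewrite ltrBlDl -intrD1 floorD1_gt.
have : circ (r * pi *+ 2) = 1.
  have -> : r * pi *+ 2 = a * pi *+ 2 + (pi *+ 2) *~ (- m).
    by rewrite /r; move: pi => q; rewrite mulrNz -mulrzr; ring.
  by rewrite circD a1 mul1r circMz circ2pi exp1rz.
rewrite circMn => h.
have : complex.Re (circ (r * pi) ^+ 2) = 1 by rewrite h.
rewrite expr2 /= -!expr2 cos2sin2 => h2.
have sin0 : sin (r * pi) = 0.
  by apply/eqP; rewrite -sqrf_eq0; apply/eqP; lra.
have [rpos|] := ltrP 0 r; last first.
  by move=> rle; apply/eqP; rewrite -subr_eq0 -/r; apply/eqP/le_anti; rewrite rle r0.
have : 0 < sin (r * pi).
  by apply: sin_gt0_pi; rewrite mulr_gt0 ?pi_gt0 //= gtr_pMl ?pi_gt0.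
by rewrite sin0 ltxx.
Qed.

Lemma Re_leC (z : C R) (e : R) : `|z| < Complex e 0 -> `|complex.Re z| < e.
Proof.
rewrite norm_complexE ltcE /= eqxx /=; apply: le_lt_trans.
rewrite -sqrtr_sqr ler_sqrt ?addr_ge0 ?sqr_ge0 //.
by rewrite lerDl sqr_ge0.
Qed.

Lemma circ_continuous0 (e : R) : 0 < e -> exists2 eta : R, 0 < eta &
  forall t, `|t| < eta -> `|circ t - 1| < Complex e 0.
Proof.
move=> e0; have /cvgrPdist_lt H := @continuous_cos R 0.
have e2 : 0 < e ^+ 2 / 2 by rewrite divr_gt0 ?exprn_gt0.
have /nbhs_ballP[eta /= eta0 h] := H _ e2; exists eta => // t tle.
have := h t; rewrite /ball /= sub0r normrN => /(_ tle).
rewrite cos0 ger0_norm ?subr_ge0 ?cos_le1 // => ct.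
rewrite norm_complexE ltcE /= eqxx /= -[X in _ < X](gtr0_norm e0) -sqrtr_sqr.
rewrite ltr_sqrt ?exprn_gt0 // subr0 sin2cos2.
have -> : (cos t - 1) ^+ 2 + (1 - cos t ^+ 2) = 2 * (1 - cos t) by ring.
by rewrite mulrC -ltr_pdivlMr.
Qed.

Section Character.
Variable f : R -> C R.
Hypothesis fD : forall a b, f (a + b) = f a * f b.
Hypothesis f1 : forall a, `|f a| = 1.
Hypothesis fc : forall e : C R, 0 < e -> exists2 del : R, 0 < del &
  forall t, `|t| < del -> `|f t - 1| < e.

Lemma char_neq0 a : f a != 0.
Proof. by rewrite -normr_gt0 f1. Qed.

Lemma char0 : f 0 = 1.
Proof. by apply: (mulfI (char_neq0 0)); rewrite -fD addr0 mulr1. Qed.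

Lemma charMn a k : f (a *+ k) = f a ^+ k.
Proof. by elim: k => [|k IH]; rewrite ?char0 // mulrS fD IH exprS. Qed.

(** Near 0 the values have positive real part, so the values at [del / 2^j] are
    the successive principal square roots of [f del]; the group law and
    continuity then determine [f]. *)
Lemma character_line : exists a, forall t, f t = circ (a * t).
Proof.
have [|del del0 fdel] := fc (e := 1); first exact: ltr01.
have Repos t : `|t| < del -> 0 < complex.Re (f t).
  move=> /fdel; rewrite -[X in _ < X]/(Complex (1 : R) 0) => /Re_leC.
  rewrite (_ : complex.Re (f t - 1) = complex.Re (f t) - 1); last by case: (f t).
  by rewrite ltr_norml; lra.
pose s := del / 2.
have s0 : 0 < s by rewrite divr_gt0.
have sdel : s < del by rewrite ltr_pdivrMr // ltr_pMr // ltr1n.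
have [psi psile fs] : exists2 psi, `|psi| <= pi / 2 & f s = circ psi.
  by apply: circ_right_half => //; apply: Repos; rewrite gtr0_norm.
(* A value at half the argument is one of two opposite square roots; positivity of
   the real part selects the principal one. *)
have dyadic j : f (s / 2 ^+ j) = circ (psi / 2 ^+ j).
  elim: j => [|j IH]; first by rewrite expr0 !divr1.
  set x := s / 2 ^+ j.+1; set y := psi / 2 ^+ j.+1.
  have xE : s / 2 ^+ j = x *+ 2 by rewrite /x exprS; field; rewrite expf_neq0.
  have yE : psi / 2 ^+ j = y *+ 2 by rewrite /y exprS; field; rewrite expf_neq0.
  move: IH; rewrite xE yE charMn circMn => /eqP; rewrite eqf_sqr => /orP[/eqP //|/eqP fx].
  have j1 : 1 <= 2 ^+ j.+1 :> R by rewrite exprn_ege1 // ler1n.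
  have jp : 0 < 2 ^+ j.+1 :> R by rewrite exprn_gt0.
  have : 0 < complex.Re (f x).
    apply: Repos; rewrite gtr0_norm ?divr_gt0 // (le_lt_trans _ sdel) //.
    by rewrite ler_pdivrMr // ler_peMr // ltW.
  rewrite fx /= oppr_gt0 => cosneg.
  have : 0 <= cos y.
    apply: cos_ge0_pihalf; rewrite -ler_norml (le_trans _ psile) //.
    rewrite normrM [X in _ * X]ger0_norm ?invr_ge0 ?(ltW jp) //.
    by rewrite ler_pdivrMr // ler_peMr.
  by rewrite leNgt cosneg.
pose a := psi / s; exists a.
pose g t := f t * circ (- (a * t)).
have gD u v : g (u + v) = g u * g v.
  by rewrite /g fD mulrDr opprD circD mulrACA.
(* The quotient [g] of the two characters is trivial on a dense subgroup. *)
have gdy j k : g (s / 2 ^+ j *+ k) = 1.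
  rewrite /g charMn dyadic mulrnAr -mulNrn circMn -exprMn circN.
  rewrite /a mulrA divfK ?gt_eqF // divff ?circ_neq0 // expr1n //.
have gclose (e : R) : 0 < e -> exists2 eta, 0 < eta &
    forall t, `|t| < eta -> `|g t - 1| < Complex e 0.
  move=> e0; have e20 : 0 < e / 2 by rewrite divr_gt0.
  have ce : 0 < Complex (e / 2) 0 :> C R by rewrite ltcE /= eqxx.
  have [eta1 eta10 h1] := fc ce; have [eta2 eta20 h2] := circ_continuous0 e20.
  exists (Num.min eta1 (eta2 / (`|a| + 1))) => [|t].
    by rewrite lt_min eta10 divr_gt0 // ltr_wpDl.
  rewrite lt_min => /andP[t1 t2].
  have -> : g t - 1 = f t * (circ (- (a * t)) - 1) + (f t - 1).
    by rewrite mulrBr mulr1 addrA subrK.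
  rewrite (le_lt_trans (ler_normD _ _)) // normrM f1 mul1r.
  have -> : Complex e 0 = Complex (e / 2) 0 + Complex (e / 2) 0 :> C R.
    by apply/eqP; rewrite eq_complex /= addr0 -splitr !eqxx.
  rewrite ltrD ?h1 ?h2 // normrN normrM.
  move: t2; rewrite ltr_pdivlMr ?ltr_wpDl // mulrDr mulr1 mulrC.
  by apply: le_lt_trans; rewrite lerDl.
suff g1 t : 0 <= t -> g t = 1.
  have gall t : g t = 1.
    have [t0|t0] := lerP 0 t; first exact: g1.
    have := gD t (- t); rewrite subrr (g1 0) // (g1 (- t)) ?mulr1 //.
    by rewrite oppr_ge0 ltW.
  move=> t; have := gall t; rewrite /g circN => /(congr1 (fun x => x * circ (a * t))).
  by rewrite mulfVK ?circ_neq0 // mul1r.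
move=> t0; apply/eqP/contraT; rewrite -subr_eq0 -normr_gt0 norm_complexE.
set e := Num.sqrt _; rewrite ltcE /= eqxx /= => e0.
have [eta eta0 H] := gclose e e0.
have [j jlt] : exists j : nat, s / eta < 2 ^+ j.
  exists (Num.truncn (s / eta)).+1; have := truncnS_gt (s / eta).
  by move/lt_trans; apply; rewrite -natrX ltr_nat ltn_expl.
have sj : 0 < s / 2 ^+ j by rewrite divr_gt0 // exprn_gt0.
pose k := Num.truncn (t / (s / 2 ^+ j)).
pose r := t - s / 2 ^+ j *+ k.
have /andP[k1 k2] : (k%:R <= t / (s / 2 ^+ j) < k.+1%:R).
  by apply: truncn_itv; rewrite divr_ge0 // ltW.
have r0 : 0 <= r.
  by rewrite subr_ge0 -[X in X <= _]mulr_natl; move: k1; rewrite ler_pdivlMr.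
have r1 : r < s / 2 ^+ j.
  by rewrite ltrBlDr -mulrS -[X in _ < X]mulr_natl; move: k2; rewrite ltr_pdivrMr.
have : `|r| < eta.
  rewrite ger0_norm // (lt_trans r1) // ltr_pdivrMr ?exprn_gt0 //.
  by have := jlt; rewrite ltr_pdivrMr // mulrC.
move=> /H; have -> : g r = g t.
  have := gD r (s / 2 ^+ j *+ k); rewrite gdy mulr1 => <-.
  by rewrite /r subrK.
by rewrite norm_complexE -/e ltxx.
Qed.

End Character.
End Circle.

(** * Weights of continuous unitary representations *)

Section Continuity.
Variable R : realType.

Lemma pos_complexP (e : C R) : 0 < e -> exists2 r : R, 0 < r & e = Complex r 0.
Proof.
case: e => r s; rewrite ltcE /= => /andP[/eqP -> r0]; by exists r.
Qed.

Lemma circ_continuous : continuous (@circ R).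
Proof.
move=> x; apply/cvgrPdist_lt => e /pos_complexP[r r0 ->].
have [eta eta0 h] := circ_continuous0 r0.
apply/nbhs_ballP; exists eta => //= y; rewrite /ball /= => xy.
have -> : circ x - circ y = - (circ x * (circ (y - x) - 1)).
  by rewrite mulrBr -circD mulr1 opprB [x + _]addrC subrK.
by rewrite normrN normrM norm_circ mul1r h // distrC.
Qed.

Lemma continuous_mulmx_entry (T : topologicalType) p q r
    (F : T -> 'M[C R]_(p, q)) (G : T -> 'M[C R]_(q, r)) :
  (forall i j, continuous (fun x => F x i j)) ->
  (forall i j, continuous (fun x => G x i j)) ->
  forall i j, continuous (fun x => (F x *m G x) i j).
Proof.
move=> cF cG i j.
have -> : (fun y => (F y *m G y) i j) = (fun y => \sum_k F y i k * G y k j).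
  by apply/funext => y; rewrite mxE.
move=> x; apply: cvg_big; first exact: pseudometric_normed_Zmodule.add_continuous.
by move=> k _; apply: cvgM; [exact: cF|exact: cG].
Qed.

Variable n : nat.
Local Notation U := (unitary_group R n).

(** The trivial value outside the unitary matrices makes representations of the group
    into functions of all matrices. *)
Definition unitary_of (M : 'M[C R]_n) : U := insubd (1%g : U) M.

Lemma unitary_ofK M : M \is unitarymx -> sval (unitary_of M) = M.
Proof. by move=> uM; rewrite /unitary_of -[sval]/val insubdK. Qed.

Lemma svalK_unitary (g : U) : unitary_of (sval g) = g.
Proof. by apply: val_inj; rewrite /= unitary_ofK // (svalP g). Qed.

Lemma unitary_ofM A B : A \is unitarymx -> B \is unitarymx ->
  unitary_of (A *m B) = (unitary_of A * unitary_of B)%g.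
Proof.
move=> uA uB.
apply: val_inj.
exact: (etrans (unitary_ofK (mul_unitarymx uA uB))
  (esym (congr2 mulmx (unitary_ofK uA) (unitary_ofK uB)))).
Qed.

Section Rep.
Variables (d : nat) (rho : U -> 'M[C R]_d).
Hypothesis rrho : unitary_rep rho.

Lemma unitary_repV g : rho g^-1%g = (rho g)^t*.
Proof.
case: rrho => ru r1 rM _.
by rewrite -[LHS]mulmx1 -(unitarymx_mulC (ru g)) mulmxA -rM mulVg r1 mul1mx.
Qed.

Lemma urep_of_unitary_rep : urep (fun M => rho (unitary_of M)).
Proof.
case: rrho => ru r1 rM _; split=> [u _|u v uu uv]; first exact: ru.
by rewrite unitary_ofM // rM.
Qed.

Definition coord_curve (i : 'I_n) (t : R) : 'rV[C R]_n :=
  \row_j if j == i then circ t else 1.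

Lemma norm_coord_curve i t j : `|coord_curve i t 0 j| = 1.
Proof. by rewrite mxE; case: ifP => _; rewrite ?norm_circ ?normr1. Qed.

Lemma coord_curve_continuous i :
  continuous (fun t => unitary_of (diag_mx (coord_curve i t))).
Proof.
apply: continuous_comp_initial; apply: continuous_mx => a b.
have -> : (fun t => sval (unitary_of (diag_mx (coord_curve i t))) a b) =
    (fun t => (if a == i then circ t else 1) *+ (a == b)).
  apply/funext => t; rewrite unitary_ofK ?mxE ?mxE //.
  by apply: diag_unitarymx => j; exact: norm_coord_curve.
case: (a == b); case: (a == i); rewrite ?mulr1n ?mulr0n.
- exact: circ_continuous.
- exact: cst_continuous.
- exact: cst_continuous.
exact: cst_continuous.
Qed.

Lemma rep_entry_continuous a b : continuous (fun g => rho g a b).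
Proof.
case: rrho => _ _ _ rc g.
have c : continuous (fun M : 'M[C R]_d => M a b) by exact: coord_continuous.
exact: (continuous_comp (rc g) (c (rho g))).
Qed.

Lemma conj_entry_continuous (Q : 'M[C R]_d) a b :
  continuous (fun g => (Q *m rho g *m Q^t*) a b).
Proof.
apply: continuous_mulmx_entry => [i j|i j]; last exact: cst_continuous.
apply: continuous_mulmx_entry => [k l|k l]; first exact: cst_continuous.
exact: rep_entry_continuous.
Qed.

(** In a common eigenbasis the torus acts by characters. Along each coordinate circle
    such a character is [t |-> exp(i c t)], and its period [2 pi] makes [c] an
    integer. *)
Lemma unitary_rep_weighted : exists2 Q : 'M[C R]_d, Q \is unitarymx &
  exists alpha, weighted (fun M => Q *m rho (unitary_of M) *m Q^t*) alpha.
Proof.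
have rpi := urep_of_unitary_rep.
have [Q uQ [chi [piD chiM chi1 chiE]]] := torus_characters rpi.
exists Q => //.
have coordD i s t : coord_curve i (s + t) =
    \row_j (coord_curve i s 0 j * coord_curve i t 0 j).
  apply/rowP=> j; rewrite !mxE.
  by case: ifP => _; rewrite ?circD ?mulr1.
have chi_1 a : chi a (const_mx 1) = 1.
  by rewrite chiE diag_const_mx (urep1 rpi) mulmx1 unitarymx_mulC // mxE eqxx.
have coord1 i t : circ t = 1 -> coord_curve i t = const_mx 1.
  by move=> t1; apply/rowP=> j; rewrite !mxE t1 if_same.
have char a i : exists m : int, forall t, chi a (coord_curve i t) = exprz (circ t) m.
  pose f t := chi a (coord_curve i t).
  have f0 : f 0 = 1 by rewrite /f coord1 ?circ0.
  have fD s t : f (s + t) = f s * f t.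
    by rewrite /f coordD chiM // => j; exact: norm_coord_curve.
  have f1 t : `|f t| = 1 by apply: chi1 => j; exact: norm_coord_curve.
  have cont : continuous f.
    have -> : f = (fun g => (Q *m rho g *m Q^t*) a a) \o
        (fun t => unitary_of (diag_mx (coord_curve i t))).
      by apply/funext => t; rewrite /f chiE.
    move=> t; exact: (continuous_comp (@coord_curve_continuous i t)
        (@conj_entry_continuous Q a a _)).
  have [|c fE] := @character_line R f fD f1.
    move=> e e0.
    have /cvgrPdist_lt/(_ _ e0)/nbhs_ballP[eta /= eta0 h] := cont 0.
    exists eta => // t tlt; have := h t; rewrite f0 distrC; apply.
    by rewrite /ball /= sub0r normrN.
  have [m cE] : exists m : int, c = m%:~R.
    by apply: circ_period; rewrite -mulrnAr -fE /f coord1 ?circ2pi.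
  by exists m => t; rewrite -/(f t) fE cE mulrzl circMz.
have [alpha alphaE] := fin_all_exists (fun a => fin_all_exists (char a)).
exists alpha => z z1; rewrite piD //; congr diag_mx; apply/rowP=> a; rewrite !mxE.
have [th thE] := fin_all_exists (fun i => circ_surj (z1 i)).
pose zs (s : seq 'I_n) : 'rV[C R]_n := \row_j if j \in s then z 0 j else 1.
have zs1 s j : `|zs s 0 j| = 1 by rewrite mxE; case: ifP => _; rewrite ?z1 ?normr1.
have zsE s : uniq s ->
    chi a (zs s) = \prod_(i <- s) exprz (z 0 i) (alpha a i).
  elim: s => [_|i s IH /= /andP[is_ us]].
    by rewrite big_nil -[RHS](chi_1 a); congr chi; apply/rowP=> j; rewrite !mxE.
  rewrite big_cons -IH // [in RHS]thE -alphaE -chiM //; last first.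
    by move=> j; exact: norm_coord_curve.
  congr chi; apply/rowP=> j; rewrite !mxE in_cons.
  have [->|ji] /= := eqVneq j i; first by rewrite (negPf is_) mulr1.
  by rewrite mul1r.
rewrite -zsE ?index_enum_uniq //; congr chi.
by apply/rowP=> j; rewrite mxE mem_index_enum.
Qed.

End Rep.
End Continuity.

(** * Borel sets of the unitary group *)

Section BorelUnitary.
Variable R : realType.

Lemma norm_complex_lt (z : C R) (r : R) :
  `|complex.Re z| < r / 2 -> `|complex.Im z| < r / 2 -> `|z| < Complex r 0.
Proof.
move=> h1 h2; rewrite norm_complexE ltcE /= eqxx /=.
have r0 : 0 < r by have := le_lt_trans (normr_ge0 _) h1; lra.
rewrite -[X in _ < X](gtr0_norm r0) -sqrtr_sqr ltr_sqrt ?exprn_gt0 //.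
move: h1 h2; rewrite !ltr_norml => /andP[a b] /andP[c d].
move: (complex.Re z) (complex.Im z) a b c d => x y; nra.
Qed.

Lemma Re_continuous : continuous (fun z : C R => complex.Re z).
Proof.
move=> z A [e /= e0 sA].
have ce : 0 < Complex e 0 :> C R by rewrite ltcE /= eqxx.
exists (Complex e 0) => //= w /= /Re_leC h; apply: sA => /=.
by move: h; case: z => ? ?; case: w.
Qed.

Lemma Im_continuous : continuous (fun z : C R => complex.Im z).
Proof.
move=> z A [e /= e0 sA].
have ce : 0 < Complex e 0 :> C R by rewrite ltcE /= eqxx.
exists (Complex e 0) => //= w /= h; apply: sA => /=.
have : `|complex.Re ((z - w) * Complex 0 (-1))| < e.
  apply: Re_leC; rewrite normrM (_ : `|Complex 0 (-1)| = 1) ?mulr1 //.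
  by rewrite norm_complexE /= expr0n add0r sqrrN expr1n sqrtr1.
by case: z w {h} => a b [a' b'] /=; rewrite mulr0 mulrN1 opprK add0r.
Qed.

Lemma continuous_borel_measurable (G : topologicalGroupType) (f : G -> R) :
  continuous f -> measurable_fun setT (f : borel G -> R).
Proof.
move=> /continuousP cf; apply: (measurability _ (measurable_realfun.RGenOpens.measurableE R)).
move=> _ [_ [a [b ->] <-]]; rewrite setTI.
by apply: sub_sigma_algebra; apply: cf; exact: interval_open.
Qed.

Variable n : nat.
Local Notation U := (unitary_group R n).

Definition rat_box (q : 'M[rat]_n * 'M[rat]_n * nat) : set U :=
  [set u : U | forall i j, `|complex.Re (sval u i j) - ratr (q.1.1 i j)| < q.2.+1%:R^-1 /\
                       `|complex.Im (sval u i j) - ratr (q.1.2 i j)| < q.2.+1%:R^-1].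

Lemma rat_box_refine (A : set U) u : open A -> A u ->
  exists q, rat_box q u /\ rat_box q `<=` A.
Proof.
move=> [B oB <-] Bu; have [P Pn PB] : nbhs (sval u) B by exact: open_nbhs_nbhs.
have /fin_all_exists[k kP] : forall i, exists k : 'I_n -> nat, forall j,
    forall w, `|complex.Re (sval u i j) - complex.Re w| < 2 / (k j).+1%:R ->
    `|complex.Im (sval u i j) - complex.Im w| < 2 / (k j).+1%:R -> P i j w.
  move=> i; apply: (fin_all_exists (P := fun j k => forall w,
    `|complex.Re (sval u i j) - complex.Re w| < 2 / k.+1%:R ->
    `|complex.Im (sval u i j) - complex.Im w| < 2 / k.+1%:R -> P i j w)) => j.
  have /nbhs_ballP[e /= /pos_complexP[r r0 ->] er] := Pn i j.
  exists (Num.truncn (4 / r)) => w h1 h2; apply: er; rewrite /ball /=.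
  have k4 : 2 / (Num.truncn (4 / r)).+1%:R < r / 2.
    have := truncnS_gt (4 / r); rewrite ltr_pdivrMr // => h.
    by rewrite ltr_pdivrMr ?ltr0n //; lra.
  apply: norm_complex_lt.
    by rewrite (_ : complex.Re _ = complex.Re (sval u i j) - complex.Re w) ?(lt_trans h1) //; case: (sval u i j); case: (w).
  by rewrite (_ : complex.Im _ = complex.Im (sval u i j) - complex.Im w) ?(lt_trans h2) //; case: (sval u i j); case: (w).
pose K := \max_i \max_j k i j.
have kK i j : (k i j <= K)%N.
  exact: leq_trans (leq_bigmax (F := k i) j) (leq_bigmax (F := fun i => \max_j k i j) i).
have K0 : 0 < K.+1%:R^-1 :> R by rewrite invr_gt0 ltr0n.
have approx (x : R) : exists q : rat, `|x - ratr q| < K.+1%:R^-1.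
  move: (K.+1%:R^-1) K0 => e e0.
  have [|q] := @rat_in_itvoo R (x - e) (x + e).
    by rewrite ltrD2l (lt_trans _ e0) // oppr_lt0.
  by rewrite in_itv /= => /andP[a b]; exists q; rewrite ltr_norml; apply/andP; split; lra.
have /fin_all_exists[q1 q1P] i := fin_all_exists (fun j => approx (complex.Re (sval u i j))).
have /fin_all_exists[q2 q2P] i := fin_all_exists (fun j => approx (complex.Im (sval u i j))).
exists (\matrix_(i, j) q1 i j, \matrix_(i, j) q2 i j, K); split.
  by move=> i j; rewrite !mxE.
move=> v vq; apply: PB => i j; have := vq i j; rewrite !mxE => -[v1 v2].
have le2 : 2 / K.+1%:R <= 2 / (k i j).+1%:R :> R.
  by rewrite ler_pM2l // lef_pV2 ?posrE ?ltr0n // ler_nat ltnS.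
have close (x y c : R) : `|x - c| < K.+1%:R^-1 -> `|y - c| < K.+1%:R^-1 ->
    `|x - y| < 2 / K.+1%:R.
  move=> h1 h2; rewrite -(subrK c x) -addrA (le_lt_trans (ler_normD _ _)) //.
  by rewrite mulr_natl mulr2n ltrD // distrC.
by apply: kP; apply: lt_le_trans le2; [exact: close (q1P i j) v1|exact: close (q2P i j) v2].
Qed.

(** Every open set is a union of boxes with rational centres and radii [1 / (k + 1)];
    there are countably many of these, and each is cut out by the entries. *)
Lemma measurable_to_unitary d (T : measurableType d) (f : T -> borel U) :
  (forall i j, measurable_fun setT (fun x => complex.Re (sval (f x) i j))) ->
  (forall i j, measurable_fun setT (fun x => complex.Im (sval (f x) i j))) ->
  measurable_fun setT f.
Proof.
move=> mRe mIm; apply: (@measurability _ _ T (borel U) setT f (@open U)) => // _ [A oA <-].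
rewrite setTI.
have mbox q : measurable (f @^-1` rat_box q).
  have -> : f @^-1` rat_box q = \bigcap_(p in [set: 'I_n * 'I_n])
      [set x | `|complex.Re (sval (f x) p.1 p.2) - ratr (q.1.1 p.1 p.2)| < q.2.+1%:R^-1 /\
               `|complex.Im (sval (f x) p.1 p.2) - ratr (q.1.2 p.1 p.2)| < q.2.+1%:R^-1].
    by apply/seteqP; split => x h => [[i j] _|i j]; [exact: h|exact: (h (i, j))].
  have mball (h : T -> R) c r : measurable_fun setT h ->
      measurable [set x | `|h x - c| < r].
    move=> mh; rewrite -[X in measurable X]setTI.
    have -> : [set x | `|h x - c| < r] = h @^-1` `]c - r, c + r[.
      apply/seteqP; split => x /=; rewrite in_itv /= ltr_norml => /andP[a b];
      by apply/andP; split; lra.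
    by apply: mh => //; exact: measurable_itv.
  apply: fin_bigcap_measurable => [|[i j] _ /=]; first exact: finite_finset.
  by apply: measurableI; apply: mball; [exact: mRe|exact: mIm].
pose B k := if unpickle k is Some q then
    (if pselect (rat_box q `<=` A) then f @^-1` rat_box q else set0) else set0.
have -> : f @^-1` A = \bigcup_k B k.
  apply/seteqP; split => x.
    move=> Afx; have [q [xq qA]] := rat_box_refine oA Afx; exists (pickle q); first exact: I.
    by rewrite /B pickleK; case: (pselect _).
  move=> [k _]; rewrite /B; case: (unpickle k) => // q.
  by case: (pselect _) => // qA xq; exact: (qA _ xq).
apply: bigcupT_measurable => k; rewrite /B.
case: (unpickle k) => [q|]; last exact: measurable0.
by case: (pselect _) => qA /=; [exact: mbox|exact: measurable0].
Qed.

End BorelUnitary.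

Section MeasurableOperations.
Variable R : realType.

Lemma Re_add (x y : C R) : complex.Re (x + y) = complex.Re x + complex.Re y.
Proof. by case: x; case: y. Qed.

Lemma Im_add (x y : C R) : complex.Im (x + y) = complex.Im x + complex.Im y.
Proof. by case: x; case: y. Qed.

Lemma Re_mul (x y : C R) : complex.Re (x * y) =
  complex.Re x * complex.Re y - complex.Im x * complex.Im y.
Proof. by case: x; case: y. Qed.

Lemma Im_mul (x y : C R) : complex.Im (x * y) =
  complex.Re x * complex.Im y + complex.Im x * complex.Re y.
Proof. by case: x => a b; case: y => c d /=; rewrite addrC. Qed.

Lemma Re_sum (I : Type) (r : seq I) (F : I -> C R) :
  complex.Re (\sum_(i <- r) F i) = \sum_(i <- r) complex.Re (F i).
Proof. exact: (big_morph _ Re_add). Qed.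

Lemma Im_sum (I : Type) (r : seq I) (F : I -> C R) :
  complex.Im (\sum_(i <- r) F i) = \sum_(i <- r) complex.Im (F i).
Proof. exact: (big_morph _ Im_add). Qed.

Lemma Re_conjC (x : C R) : complex.Re x^* = complex.Re x.
Proof. by case: x. Qed.

Lemma Im_conjC (x : C R) : complex.Im x^* = - complex.Im x.
Proof. by case: x. Qed.

Definition cmeasurable d (T : measurableType d) (f : T -> C R) : Prop :=
  measurable_fun setT (fun x => complex.Re (f x)) /\
  measurable_fun setT (fun x => complex.Im (f x)).

Lemma eq_cmeasurable d (T : measurableType d) (f g : T -> C R) :
  (forall x, f x = g x) -> cmeasurable g -> cmeasurable f.
Proof. by move=> /funext ->. Qed.

Lemma cmeasurable_cst d (T : measurableType d) (c : C R) :
  cmeasurable (fun _ : T => c).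
Proof. by split; exact: measurable_cst. Qed.

Lemma cmeasurableM d (T : measurableType d) (f g : T -> C R) :
  cmeasurable f -> cmeasurable g -> cmeasurable (fun x => f x * g x).
Proof.
move=> [fr fi] [gr gi]; split.
  by under eq_fun do rewrite Re_mul; apply: measurable_funB; exact: measurable_funM.
by under eq_fun do rewrite Im_mul; apply: measurable_funD; exact: measurable_funM.
Qed.

Lemma cmeasurable_sum d (T : measurableType d) (I : Type) (r : seq I) (F : I -> T -> C R) :
  (forall i, cmeasurable (F i)) -> cmeasurable (fun x => \sum_(i <- r) F i x).
Proof.
move=> mF; split.
  under eq_fun do rewrite Re_sum.
  by apply: measurable_sum => i; case: (mF i).
under eq_fun do rewrite Im_sum.
by apply: measurable_sum => i; case: (mF i).
Qed.

Lemma cmeasurable_conj d (T : measurableType d) (f : T -> C R) :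
  cmeasurable f -> cmeasurable (fun x => (f x)^*).
Proof.
move=> [fr fi]; split; first by under eq_fun do rewrite Re_conjC.
by under eq_fun do rewrite Im_conjC; exact: measurable_funN.
Qed.

Lemma continuous_cmeasurable (G : topologicalGroupType) (f : G -> C R) :
  continuous f -> cmeasurable (f : borel G -> C R).
Proof.
move=> cf; split; apply: continuous_borel_measurable => x.
  exact: (continuous_comp (cf x) (@Re_continuous R (f x))).
exact: (continuous_comp (cf x) (@Im_continuous R (f x))).
Qed.

Section Operations.
Variable n : nat.
Local Notation U := (unitary_group R n).

Lemma cmeasurable_to_unitary d (T : measurableType d) (f : T -> borel U) :
  (forall i j, cmeasurable (fun x => sval (f x) i j)) -> measurable_fun setT f.
Proof. by move=> mf; apply: measurable_to_unitary => i j; case: (mf i j). Qed.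

Lemma cmeasurable_entry d (T : measurableType d) (f : T -> borel U) i j :
  measurable_fun setT f -> cmeasurable (fun x => sval (f x) i j).
Proof.
move=> mf; have [mr mi] := continuous_cmeasurable (@entry_continuous R n i j).
by split; [exact: (measurableT_comp mr mf)|exact: (measurableT_comp mi mf)].
Qed.

Lemma measurable_unitaryM d (T : measurableType d) (f g : T -> borel U) :
  measurable_fun setT f -> measurable_fun setT g ->
  measurable_fun setT (fun x => (f x * g x)%g : borel U).
Proof.
move=> mf mg; apply: cmeasurable_to_unitary => i j.
have -> : (fun x => sval (f x * g x)%g i j) =
    (fun x => \sum_k sval (f x) i k * sval (g x) k j).
  by apply/funext => x; rewrite mxE.
apply: cmeasurable_sum => k; apply: cmeasurableM; exact: cmeasurable_entry.
Qed.

Lemma measurable_unitaryV d (T : measurableType d) (f : T -> borel U) :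
  measurable_fun setT f -> measurable_fun setT (fun x => (f x)^-1%g : borel U).
Proof.
move=> mf; apply: cmeasurable_to_unitary => i j.
have -> : (fun x => sval (f x)^-1%g i j) = (fun x => (sval (f x) j i)^*).
  by apply/funext => x; rewrite !mxE.
by apply: cmeasurable_conj; exact: cmeasurable_entry.
Qed.

End Operations.

Lemma measurable_embed k n (le_kn : (k <= n)%N) :
  measurable_fun setT
    (embed le_kn : borel (unitary_group R k) -> borel (unitary_group R n)).
Proof.
apply: cmeasurable_to_unitary => i j.
pose e := subnKC le_kn.
have E (x : unitary_group R k) : sval (embed le_kn x) i j =
    block_mx (sval x) 0 0 1%:M (cast_ord (esym e) i) (cast_ord (esym e) j).
  by rewrite /= castmxE.
apply: (@eq_cmeasurable _ (borel (unitary_group R k)) _ _ E).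
case: (split_ordP (cast_ord (esym e) i)) => i' ->;
  case: (split_ordP (cast_ord (esym e) j)) => j' ->.
- under eq_fun do rewrite block_mxEul.
  by apply: cmeasurable_entry; exact: measurable_id.
- under eq_fun do rewrite block_mxEur; exact: cmeasurable_cst.
- under eq_fun do rewrite block_mxEdl; exact: cmeasurable_cst.
under eq_fun do rewrite block_mxEdr; exact: cmeasurable_cst.
Qed.

End MeasurableOperations.

(** * Haar measure on the unitary group *)

Section HaarUnitary.
Variables (R : realType) (n : nat) (m : probability (borel (unitary_group R n)) R).
Hypothesis mP : is_haar m.
Local Notation U := (unitary_group R n).

Lemma preimage_mul (G : groupType) (g : G) (A : set G) :
  [set y | A (g * y)%g] = [set (g^-1 * x)%g | x in A].
Proof.
apply/seteqP; split => y.
  by move=> Agy; exists (g * y)%g => //; rewrite mulgA mulVg mul1g.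
by move=> [x Ax <-] /=; rewrite mulgA mulgV mul1g.
Qed.

Lemma haar_left (g : U) (A : set (borel U)) : measurable A ->
  m [set y : borel U | A (g * y)%g] = m A.
Proof. by move=> mA; rewrite preimage_mul; exact: mP. Qed.

(** For independent [x] and [y], the law of [x^-1 y] is [m] when integrated in [y]
    first, and the image of [m] under inversion when integrated in [x] first. *)
Lemma haar_inv (A : set (borel U)) : measurable A ->
  m [set y : borel U | A y^-1%g] = m A.
Proof.
move=> mA; pose B := [set z : borel U * borel U | A (z.1^-1 * z.2)%g].
have mB : measurable B.
  rewrite -[B]setTI.
  have : measurable_fun setT (fun z : borel U * borel U => (z.1^-1 * z.2)%g : borel U).
    apply: measurable_unitaryM; last exact: measurable_snd.
    by apply: measurable_unitaryV; exact: measurable_fst.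
  by move=> /(_ measurableT A mA).
have E1 : (m \x m)%E B = m A.
  rewrite /product_measure1 /=.
  rewrite (eq_integral (fun _ => m A)).
    by rewrite integral_cst // [X in (_ * X)%E]probability_setT mule1.
  move=> x _ /=; rewrite -(haar_left x^-1%g mA); congr (m _).
  by apply/seteqP; split => y; rewrite /xsection /B /= inE.
have E2 : (m \x^ m)%E B = m [set y : borel U | A y^-1%g].
  rewrite /product_measure2 /=.
  have mA' : measurable [set y : borel U | A y^-1%g].
    have := measurable_unitaryV (@measurable_id _ (borel U) setT).
    by move=> /(_ measurableT A mA); rewrite setTI.
  rewrite (eq_integral (fun _ => m [set y : borel U | A y^-1%g])).
    by rewrite integral_cst // [X in (_ * X)%E]probability_setT mule1.
  move=> y _ /=; rewrite -(haar_left y^-1%g mA'); congr (m _).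
  by apply/seteqP; split => x; rewrite /ysection /B /= inE /= invgM invgK.
rewrite -E1 -E2; apply/esym; apply: product_measure_unique => //= A1 A2 mA1 mA2.
exact: product_measure2E.
Qed.

End HaarUnitary.

(** * The law of a random conjugate *)

Section SetFunctionIntegral.
Context d (T : measurableType d) (R : realType).
Import HBNNSimple.

(** Integrals are suprema of integrals of simple functions, which evaluate the set
    function on measurable sets only. *)
Lemma integral_eq_set_function (m1 m2 : set T -> \bar R) D (f : T -> \bar R) :
  (forall A, measurable A -> m1 A = m2 A) ->
  (\int[m1]_(x in D) f x = \int[m2]_(x in D) f x)%E.
Proof.
move=> m12; rewrite /integral.
have E (g : T -> \bar R) :
    [set sintegral m1 h | h in [set h : {nnsfun T >-> R} | forall x, ((h x)%:E <= g x)%E]] =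
    [set sintegral m2 h | h in [set h : {nnsfun T >-> R} | forall x, ((h x)%:E <= g x)%E]].
  have S (h : {nnsfun T >-> R}) : sintegral m1 h = sintegral m2 h.
    by rewrite /sintegral; apply: eq_fsbigr => x _; rewrite m12.
  by apply/seteqP; split => y [h hg <-]; exists h.
by rewrite !E.
Qed.

End SetFunctionIntegral.

Section Law.
Context d d' (T : measurableType d) (T' : measurableType d') (R : realType).

Definition law (P : probability T R) (f : T -> T') (mf : measurable_fun setT f) :
  probability T' R := distribution P (mfun_Sub (mem_set mf)).

Lemma lawE P f mf A : @law P f mf A = P (f @^-1` A).
Proof. by []. Qed.

End Law.

Section ConjugateLaw.
Variable R : realType.

Section Conjugate.
Variable n : nat.
Local Notation U := (unitary_group R n).

Lemma measurable_unitary_mul_l (g : U) :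
  measurable_fun setT (fun y : borel U => (g * y)%g : borel U).
Proof.
by apply: measurable_unitaryM; [exact: measurable_cst|exact: measurable_id].
Qed.

Lemma measurable_unitary_mul_r (g : U) :
  measurable_fun setT (fun y : borel U => (y * g)%g : borel U).
Proof.
by apply: measurable_unitaryM; [exact: measurable_id|exact: measurable_cst].
Qed.

Lemma measurable_preimageT d d' (T : measurableType d) (T' : measurableType d')
    (f : T -> T') (A : set T') :
  measurable_fun setT f -> measurable A -> measurable (f @^-1` A).
Proof. by move=> mf mA; rewrite -[X in measurable X]setTI; exact: mf. Qed.

Lemma convolution_dirac_l (m : probability (borel U) R) (g : U) (B : set (borel U)) :
  measurable B ->
  convolution (@dirac _ (borel U) g R) m B = m [set y : borel U | B (g * y)%g].
Proof.
move=> mB; rewrite /convolution.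
pose S := [set z : borel U * borel U | B (z.1 * z.2)%g].
have mS : measurable S.
  apply: (@measurable_preimageT _ _ _ _
    (fun z : borel U * borel U => (z.1 * z.2)%g : borel U)) => //.
  by apply: measurable_unitaryM; [exact: measurable_fst|exact: measurable_snd].
have SE (x : borel U) : [set y : borel U | B (x * y)%g] = xsection S x.
  by apply/seteqP; split => y; rewrite /xsection /S /= inE.
under eq_integral do rewrite SE.
rewrite integral_dirac //; last exact: measurable_fun_xsection.
by rewrite diracT mul1e SE.
Qed.

(** The inner convolution by a Dirac mass is the image of [m] under translation; it
    is only a set function, but it may be replaced by that measure in the outer
    integral. *)
Lemma conjugateE (m : probability (borel U) R) (g : U) (A : set (borel U)) :
  measurable A -> conjugate g m A = m [set y : borel U | A (g * y * g^-1)%g].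
Proof.
move=> mA; rewrite /conjugate {1}/convolution.
rewrite (@integral_eq_set_function _ _ _ _ (law m (measurable_unitary_mul_l g))); last first.
  by move=> B mB; rewrite convolution_dirac_l.
have mr : measurable [set x : borel U | A (x * g^-1)%g].
  exact: (measurable_preimageT (measurable_unitary_mul_r g^-1%g) mA).
have fE (x : borel U) : \d_(g^-1%g : borel U) [set y : borel U | A (x * y)%g] =
    (\1_[set x : borel U | A (x * g^-1)%g] x)%:E :> \bar R.
  rewrite diracE indicE.
  by have [h|h] := pselect (A (x * g^-1)%g); [rewrite !mem_set|rewrite !memNset].
under eq_integral do rewrite fE.
by rewrite integral_indic // setIT lawE.
Qed.

End Conjugate.

Lemma embedM n k (le_kn : (k <= n)%N) (a b : unitary_group R k) :
  embed le_kn (a * b)%g = (embed le_kn a * embed le_kn b)%g.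
Proof.
apply: val_inj => /=; move: (subnKC le_kn); move: (n - k)%N => q e.
case: _ / e; rewrite !castmx_id mulmx_block !mulmx0 !mul0mx !addr0 add0r.
by rewrite mulmx1.
Qed.

Lemma embed1 n k (le_kn : (k <= n)%N) : embed le_kn (1%g : unitary_group R k) = 1%g.
Proof. by apply: (@mulgI _ (embed le_kn 1%g)); rewrite -embedM !mulg1. Qed.

Lemma embedV n k (le_kn : (k <= n)%N) (a : unitary_group R k) :
  embed le_kn a^-1%g = (embed le_kn a)^-1%g.
Proof.
by apply: (@mulgI _ (embed le_kn a)); rewrite -embedM !mulgV embed1.
Qed.

Section Law.
Variables (n k : nat) (le_kn : (k <= n)%N).
Variables (mn : probability (borel (unitary_group R n)) R)
          (mk : probability (borel (unitary_group R k)) R).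
Local Notation U := (unitary_group R n).
Local Notation V := (unitary_group R k).

Definition conj_embed (z : borel U * borel V) : borel U :=
  (z.1 * embed le_kn z.2 * z.1^-1)%g.

Lemma measurable_conj_embed : measurable_fun setT conj_embed.
Proof.
apply: measurable_unitaryM; last by apply: measurable_unitaryV; exact: measurable_fst.
apply: measurable_unitaryM; first exact: measurable_fst.
by apply: measurableT_comp; [exact: measurable_embed|exact: measurable_snd].
Qed.

(** The law of [s a s^-1] for independent [s] in the large group and [a] in the
    small one. *)
Definition conj_law : probability (borel U) R :=
  law (product_measure1 mn mk) measurable_conj_embed.

Lemma conj_lawE A : conj_law A =
  (\int[mn]_s mk [set a : borel V | A (s * embed le_kn a * s^-1)%g])%E.
Proof.
rewrite /conj_law lawE /product_measure1 /=; apply: eq_integral => s _ /=.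
by congr (mk _); apply/seteqP; split => a; rewrite /xsection /conj_embed /= inE.
Qed.

Hypotheses (mnP : is_haar mn) (mkP : is_haar mk).

Lemma measurable_section (A : set (borel U)) (g : U) : measurable A ->
  measurable [set a : borel V | A (g * embed le_kn a * g^-1)%g].
Proof.
move=> mA; apply: (measurable_preimageT _ mA).
apply: measurable_unitaryM; last exact: measurable_cst.
apply: measurable_unitaryM; first exact: measurable_cst.
exact: measurable_embed.
Qed.

Lemma measurable_fun_section (A : set (borel U)) : measurable A ->
  measurable_fun setT (fun s : borel U => mk [set a : borel V | A (s * embed le_kn a * s^-1)%g]).
Proof.
move=> mA.
have mB : measurable (conj_embed @^-1` A).
  exact: measurable_preimageT measurable_conj_embed mA.
have -> : (fun s : borel U => mk [set a : borel V | A (s * embed le_kn a * s^-1)%g]) =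
    mk \o xsection (conj_embed @^-1` A).
  apply/funext => s /=; congr (mk _).
  by apply/seteqP; split => a; rewrite /xsection /conj_embed /= inE.
exact: measurable_fun_xsection.
Qed.

Lemma haar_integral_left (g : U) (f : borel U -> \bar R) :
  measurable_fun setT f -> (forall x, 0 <= f x)%E ->
  (\int[mn]_s f (g * s)%g = \int[mn]_s f s)%E.
Proof.
move=> mf f0; have mg := measurable_unitary_mul_l g.
transitivity (\int[law mn mg]_s f s)%E.
  rewrite (@integral_eq_set_function _ _ _ (law mn mg)
    (pushforward mn (fun y : borel U => (g * y)%g : borel U))) //.
  by rewrite ge0_integral_pushforward.
by apply: integral_eq_set_function => A mA; rewrite lawE haar_left.
Qed.

Lemma conj_law_central : central conj_law.
Proof.
move=> g A mA; rewrite conjugateE // !conj_lawE.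
rewrite -[RHS](haar_integral_left g) //; last exact: measurable_fun_section.
apply: eq_integral => s _; congr (mk _); apply/seteqP.
by split => a /=; rewrite invgM !mulgA.
Qed.

Lemma conj_law_symmetric : symmetric_measure conj_law.
Proof.
move=> A mA; have -> : [set x^-1%g | x in A] = [set x : borel U | A x^-1%g].
  apply/seteqP; split => x; first by move=> [y Ay <-] /=; rewrite invgK.
  by move=> Ax; exists x^-1%g => //; rewrite invgK.
rewrite !conj_lawE; apply: eq_integral => s _.
rewrite -[RHS](haar_inv mkP (measurable_section s mA)); congr (mk _); apply/seteqP.
by split => a /=; rewrite embedV !invgM invgK !mulgA.
Qed.

End Law.

Lemma mu_E (haar : forall n, probability (borel (unitary_group R n)) R) k n
    (le_kn : (k <= n)%N) (A : set (borel (unitary_group R n))) : measurable A ->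
  mu_ haar k n le_kn A = conj_law le_kn (haar n) (haar k) A.
Proof.
move=> mA; rewrite conj_lawE /mu_; apply: eq_integral => s _.
rewrite -[haar_Gamma _ _]/(law (haar k) (@measurable_embed R k n le_kn) : set _ -> _).
by rewrite conjugateE.
Qed.

End ConjugateLaw.

(** * Integrals of bounded complex functions *)

Section Mixture.
Context d (T : measurableType d) (R : realType) (P1 P2 : probability T R).

Definition half : {nonneg R} := (2^-1)%:nng.

Definition mixture : set T -> \bar R := measure_add (mscale half P1) (mscale half P2).

HB.instance Definition _ := Measure.on mixture.

Lemma mixtureE A : mixture A = ((2^-1)%:E * (P1 A + P2 A))%E.
Proof.
by rewrite /mixture measure_addE /mscale /= ge0_muleDr.
Qed.

Lemma mixture_setT : mixture setT = 1%E.
Proof.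
by rewrite mixtureE !probability_setT -EFinD -EFinM; congr EFin; field.
Qed.

HB.instance Definition _ := Measure_isProbability.Build _ _ _ mixture mixture_setT.

End Mixture.

Section BoundedIntegrals.
Context d (T : measurableType d) (R : realType).

Definition rbounded (f : T -> R) : Prop :=
  measurable_fun setT f /\ exists M : R, forall x, `|f x| <= M.

Lemma rbounded_integrable (mu : {measure set T -> \bar R}) (f : T -> R) :
  (mu setT < +oo)%E -> rbounded f -> mu.-integrable setT (EFin \o f).
Proof.
move=> muT [mf [M fM]]; apply: measurable_bounded_integrable => //.
exists M; split; first exact: num_real.
by move=> x Mx y _ /=; apply: le_trans (fM y) _; exact: ltW.
Qed.

Lemma probability_lty (P : probability T R) : (P setT < +oo)%E.
Proof. by rewrite probability_setT ltry. Qed.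

Lemma Rintegral_mscale (k : {nonneg R}) (P : probability T R) (f : T -> R) :
  rbounded f ->
  Rintegral (mscale k P) setT f = k%:num * Rintegral P setT f.
Proof.
move=> bf; have intf := rbounded_integrable (probability_lty P) bf.
have mf : measurable_fun setT (EFin \o f) by apply/measurable_EFinP; case: bf.
rewrite /Rintegral integralE [X in _ = _ * fine X]integralE.
rewrite !ge0_integral_mscale //; last 2 first.
  exact: measurable_funeneg.
  exact: measurable_funepos.
have fp := integrable_pos_fin_num measurableT intf.
have fn := integrable_neg_fin_num measurableT intf.
rewrite -(fineK fp) -(fineK fn) -!EFinM -!EFinB /=.
by rewrite mulrBr.
Qed.

Lemma Rintegral_mixture (P1 P2 : probability T R) (f : T -> R) :
  rbounded f -> Rintegral (mixture P1 P2) setT f =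
    2^-1 * (Rintegral P1 setT f + Rintegral P2 setT f).
Proof.
move=> bf; have mf : measurable_fun setT (EFin \o f) by apply/measurable_EFinP; case: bf.
have sc_lty (P : probability T R) : (mscale (half R) P setT < +oo)%E.
  by rewrite /mscale /= probability_setT mule1 ltry.
have i1 := rbounded_integrable (sc_lty P1) bf.
have i2 := rbounded_integrable (sc_lty P2) bf.
rewrite mulrDr -!(Rintegral_mscale (half R)) // /Rintegral integral_measure_add //.
by rewrite fineD // integrable_fin_num.
Qed.

End BoundedIntegrals.

Section ComplexIntegral.
Variable R : realType.

Section Def.
Context d (T : measurableType d).
Implicit Types (P : probability T R) (f g : T -> C R).

(** This is [complex_integral] over an arbitrary measurable space, for use with images
    of measures. *)
Definition cint P f : C R :=
  Complex (Rintegral P setT (fun t => complex.Re (f t)))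
          (Rintegral P setT (fun t => complex.Im (f t))).

Definition cbounded f : Prop :=
  rbounded (fun x => complex.Re (f x)) /\ rbounded (fun x => complex.Im (f x)).

Lemma cbounded_unit f : cmeasurable f -> (forall x, `|f x| <= 1) -> cbounded f.
Proof.
move=> [mr mi] f1.
have sq x : complex.Re (f x) ^+ 2 + complex.Im (f x) ^+ 2 <= 1.
  have := f1 x; rewrite norm_complexE lecE /= eqxx /=.
  rewrite -[X in _ <= X]sqrtr1 ler_sqrt //.
split; split => //; exists 1 => x; have := sq x.
  move=> h; rewrite -(@expr_le1 _ 2) ?normr_ge0 // real_normK ?num_real //.
  by rewrite (le_trans _ h) // lerDl sqr_ge0.
move=> h; rewrite -(@expr_le1 _ 2) ?normr_ge0 // real_normK ?num_real //.
by rewrite (le_trans _ h) // lerDr sqr_ge0.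
Qed.

Lemma rboundedD (f g : T -> R) : rbounded f -> rbounded g ->
  rbounded (fun x => f x + g x).
Proof.
move=> [mf [M fM]] [mg [N gN]]; split; first exact: measurable_funD.
by exists (M + N) => x; rewrite (le_trans (ler_normD _ _)) // lerD.
Qed.

Lemma rboundedZ (c : R) (f : T -> R) : rbounded f -> rbounded (fun x => c * f x).
Proof.
move=> [mf [M fM]]; split; first exact: measurable_funM.
by exists (`|c| * M) => x; rewrite normrM ler_wpM2l.
Qed.

Lemma cbounded_cst (c : C R) : cbounded (fun=> c).
Proof.
split; split; try exact: measurable_cst.
  by exists `|complex.Re c|.
by exists `|complex.Im c|.
Qed.

Lemma cboundedD f g : cbounded f -> cbounded g -> cbounded (fun x => f x + g x).
Proof.
move=> [fr fi] [gr gi]; split.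
  by under eq_fun do rewrite Re_add; exact: rboundedD.
by under eq_fun do rewrite Im_add; exact: rboundedD.
Qed.

Lemma cboundedZ c f : cbounded f -> cbounded (fun x => c * f x).
Proof.
move=> [fr fi]; split.
  under eq_fun do rewrite Re_mul -mulNr.
  by apply: rboundedD; exact: rboundedZ.
under eq_fun do rewrite Im_mul.
by apply: rboundedD; exact: rboundedZ.
Qed.

Lemma cbounded_sum (I : Type) (r : seq I) (F : I -> T -> C R) :
  (forall i, cbounded (F i)) -> cbounded (fun x => \sum_(i <- r) F i x).
Proof.
move=> bF; elim: r => [|i r IH].
  by under eq_fun do rewrite big_nil; exact: cbounded_cst.
by under eq_fun do rewrite big_cons; exact: cboundedD.
Qed.

Lemma cintD P f g : cbounded f -> cbounded g ->
  cint P (fun x => f x + g x) = cint P f + cint P g.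
Proof.
move=> [fr fi] [gr gi]; have PT := probability_lty P.
apply/eqP; rewrite eq_complex /=.
under eq_Rintegral do rewrite Re_add.
under [X in _ && (X == _)]eq_Rintegral do rewrite Im_add.
by rewrite !RintegralD ?eqxx //; apply: rbounded_integrable.
Qed.

Lemma cintZ P c f : cbounded f -> cint P (fun x => c * f x) = c * cint P f.
Proof.
move=> [fr fi]; have PT := probability_lty P.
have ir := rbounded_integrable PT fr; have ii := rbounded_integrable PT fi.
have irc a := rbounded_integrable PT (rboundedZ a fr).
have iic a := rbounded_integrable PT (rboundedZ a fi).
apply/eqP; rewrite eq_complex Re_mul Im_mul /=.
under eq_Rintegral do rewrite Re_mul.
under [X in _ && (X == _)]eq_Rintegral do rewrite Im_mul.
by rewrite RintegralB // RintegralD // !RintegralZl ?eqxx.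
Qed.

Lemma cint_cst P c : cint P (fun=> c) = c.
Proof.
rewrite /cint !Rintegral_cst //.
have -> : fine (P setT) = 1 by rewrite probability_setT.
by rewrite !mulr1; case: c.
Qed.

Lemma cint_sum P (I : Type) (r : seq I) (F : I -> T -> C R) :
  (forall i, cbounded (F i)) ->
  cint P (fun x => \sum_(i <- r) F i x) = \sum_(i <- r) cint P (F i).
Proof.
move=> bF; elim: r => [|i r IH].
  by rewrite big_nil -[RHS](cint_cst P); congr cint; apply/funext => x; rewrite big_nil.
rewrite big_cons -IH -cintD //; last exact: cbounded_sum.
by congr cint; apply/funext => x; rewrite big_cons.
Qed.

Lemma cbounded_conj f : cbounded f -> cbounded (fun x => (f x)^*).
Proof.
move=> [fr fi]; split; first by under eq_fun do rewrite Re_conjC.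
under eq_fun do rewrite Im_conjC -mulN1r; exact: rboundedZ.
Qed.

Lemma cint_conj P f : cbounded f -> cint P (fun x => (f x)^*) = (cint P f)^*.
Proof.
move=> [fr fi]; have PT := probability_lty P.
apply/eqP; rewrite eq_complex Re_conjC Im_conjC /=.
under eq_Rintegral do rewrite Re_conjC.
under [X in _ && (X == _)]eq_Rintegral do rewrite Im_conjC -mulN1r.
by rewrite RintegralZl ?mulN1r ?eqxx //; exact: rbounded_integrable.
Qed.

Lemma cint_mixture (P1 P2 : probability T R) f : cbounded f ->
  cint (mixture P1 P2) f = 2^-1 * (cint P1 f + cint P2 f).
Proof.
move=> [fr fi].
have -> : (2^-1 : C R) = Complex 2^-1 0.
  apply: (@mulfI _ 2); first by rewrite pnatr_eq0.
  rewrite divff ?pnatr_eq0 //; apply/eqP; rewrite eq_complex Re_mul Im_mul /=.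
  by apply/andP; split; apply/eqP; field.
apply/eqP; rewrite eq_complex Re_mul Im_mul /= !Rintegral_mixture //.
by rewrite !mul0r subr0 addr0 !eqxx.
Qed.

End Def.

Lemma cint_pushforward d d' (T : measurableType d) (T' : measurableType d')
    (P : probability T R) (P' : probability T' R) (phi : T -> T') (f : T' -> C R) :
  measurable_fun setT phi -> (forall A, measurable A -> P' A = P (phi @^-1` A)) ->
  cbounded f -> cint P' f = cint P (fun x => f (phi x)).
Proof.
move=> mphi P'E [fr fi].
have H (g : T' -> R) : rbounded g -> Rintegral P' setT g = Rintegral P setT (g \o phi).
  move=> bg; have [mg [M gM]] := bg; congr fine.
  rewrite (@integral_eq_set_function _ _ _ P' (pushforward P phi)) //.
  rewrite integral_pushforward //; first exact/measurable_EFinP.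
  rewrite preimage_setT; apply: rbounded_integrable (probability_lty P) _.
  split; first exact: measurableT_comp.
  by exists M => x; exact: gM.
by rewrite /cint (H _ fr) (H _ fi).
Qed.

End ComplexIntegral.

(** * Averages of representations *)

Section MatrixAverages.
Variable R : realType.

Section Matrix.
Context d (T : measurableType d) (P : probability T R).

Definition mxint p q (F : T -> 'M[C R]_(p, q)) : 'M[C R]_(p, q) :=
  \matrix_(i, j) cint P (fun t => F t i j).

Definition mxbounded p q (F : T -> 'M[C R]_(p, q)) : Prop :=
  forall i j, cbounded (fun t => F t i j).

Lemma mxbounded_mull p q r (A : 'M[C R]_(p, q)) (F : T -> 'M[C R]_(q, r)) :
  mxbounded F -> mxbounded (fun t => A *m F t).
Proof.
move=> bF i j; have -> : (fun t => (A *m F t) i j) = (fun t => \sum_k A i k * F t k j).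
  by apply/funext => t; rewrite mxE.
by apply: cbounded_sum => k; exact: cboundedZ.
Qed.

Lemma mxbounded_mulr p q r (A : 'M[C R]_(q, r)) (F : T -> 'M[C R]_(p, q)) :
  mxbounded F -> mxbounded (fun t => F t *m A).
Proof.
move=> bF i j; have -> : (fun t => (F t *m A) i j) = (fun t => \sum_k A k j * F t i k).
  by apply/funext => t; rewrite mxE; apply: eq_bigr => k _; exact: mulrC.
by apply: cbounded_sum => k; exact: cboundedZ.
Qed.

Lemma mxint_mull p q r (A : 'M[C R]_(p, q)) (F : T -> 'M[C R]_(q, r)) :
  mxbounded F -> mxint (fun t => A *m F t) = A *m mxint F.
Proof.
move=> bF; apply/matrixP=> i j; rewrite !mxE.
have -> : (fun t => (A *m F t) i j) = (fun t => \sum_k A i k * F t k j).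
  by apply/funext => t; rewrite mxE.
rewrite cint_sum; last by move=> k; exact: cboundedZ.
by apply: eq_bigr => k _; rewrite mxE cintZ.
Qed.

Lemma mxint_mulr p q r (A : 'M[C R]_(q, r)) (F : T -> 'M[C R]_(p, q)) :
  mxbounded F -> mxint (fun t => F t *m A) = mxint F *m A.
Proof.
move=> bF; apply/matrixP=> i j; rewrite !mxE.
have -> : (fun t => (F t *m A) i j) = (fun t => \sum_k A k j * F t i k).
  by apply/funext => t; rewrite mxE; apply: eq_bigr => k _; exact: mulrC.
rewrite cint_sum; last by move=> k; exact: cboundedZ.
by apply: eq_bigr => k _; rewrite mxE cintZ // mulrC.
Qed.

Lemma mxint_cst p q (A : 'M[C R]_(p, q)) : mxint (fun=> A) = A.
Proof. by apply/matrixP=> i j; rewrite mxE cint_cst. Qed.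

Lemma mxtrace_mxint p (F : T -> 'M[C R]_p) :
  mxbounded F -> \tr (mxint F) = cint P (fun t => \tr (F t)).
Proof.
move=> bF; rewrite /mxtrace cint_sum; last by move=> i; exact: bF.
by apply: eq_bigr => i _; rewrite mxE.
Qed.

Lemma cbounded_mxtrace p (F : T -> 'M[C R]_p) :
  mxbounded F -> cbounded (fun t => \tr (F t)).
Proof. by move=> bF; apply: cbounded_sum => i; exact: bF. Qed.

Lemma mxbounded_unitary p (F : T -> 'M[C R]_p) :
  (forall i j, cmeasurable (fun t => F t i j)) -> (forall t, F t \is unitarymx) ->
  mxbounded F.
Proof.
by move=> mF uF i j; apply: cbounded_unit => // t; exact: unitarymx_entry_le1.
Qed.

End Matrix.

Section HaarAverage.
Variables (k d : nat) (m : probability (borel (unitary_group R k)) R).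
Hypothesis mP : is_haar m.
Local Notation V := (unitary_group R k).

Lemma haar_cint_left (g : V) (f : borel V -> C R) : cbounded f ->
  cint m (fun a => f (g * a)%g) = cint m f.
Proof.
move=> bf; symmetry; apply: cint_pushforward => //.
  exact: measurable_unitary_mul_l.
by move=> A mA; rewrite -(haar_left mP g mA).
Qed.

Variable F : borel V -> 'M[C R]_d.
Hypothesis bF : mxbounded F.
Hypothesis FM : forall a b : V, F (a * b)%g = F a *m F b.

(** Left invariance of the Haar measure. *)
Lemma mxint_absorb (g : V) : F g *m mxint m F = mxint m F.
Proof.
rewrite -mxint_mull //; apply/matrixP=> i j; rewrite !mxE.
rewrite -[RHS](haar_cint_left g) //; congr cint; apply/funext => a.
by rewrite FM.
Qed.

(** The average absorbs every value of the representation, so it is idempotent: it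
    projects onto the fixed vectors. *)
Lemma mxtrace_haar_mxint : \tr (mxint m F) = (\rank (mxint m F))%:R.
Proof.
apply: mxtrace_idempotent; rewrite -mxint_mulr // -[RHS](mxint_cst m).
by congr mxint; apply/funext => a; rewrite mxint_absorb.
Qed.

Lemma mxint_row_eq0 (g : V) (z : 'rV[C R]_d) i : F g = diag_mx z -> z 0 i != 1 ->
  row i (mxint m F) = 0.
Proof.
move=> Fg zi; apply/rowP=> j; have /matrixP/(_ i j) := mxint_absorb g.
rewrite Fg mul_diag_mx [LHS]mxE => h; rewrite [LHS]mxE [RHS]mxE.
have : (z 0 i - 1) * mxint m F i j = 0 by rewrite mulrBl mul1r h subrr.
by move/eqP; rewrite mulf_eq0 subr_eq0 (negPf zi) => /eqP.
Qed.

End HaarAverage.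

Lemma rank_le_support (K : fieldType) p q (A : 'M[K]_(p, q)) (S : {set 'I_p}) :
  (forall i, i \notin S -> row i A = 0) -> (\rank A <= #|S|)%N.
Proof.
move=> A0; have -> : A = \sum_(i in S) delta_mx i i *m A.
  apply/row_matrixP => i; rewrite linear_sum /=.
  have rE j : row i (delta_mx j j *m A) = if j == i then row i A else 0.
    rewrite row_mul rowE mul_delta_mx_cond eq_sym.
    by case: eqP => [->|_]; rewrite ?mulr1n -?rowE // mulr0n mul0mx.
  under eq_bigr do rewrite rE.
  have [iS|iS] := boolP (i \in S).
    rewrite (bigD1 i) //= eqxx big1 ?addr0 // => j /andP[_ /negPf ->].
    by [].
  rewrite A0 // big1 // => j jS; case: eqP => // ji.
rewrite -sum1_card; apply: (big_ind2 (fun B c => (\rank B <= c)%N)).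
- by rewrite mxrank0.
- by move=> B b D c Bb Dc; rewrite (leq_trans (mxrank_add _ _)) // leq_add.
by move=> i _; rewrite (leq_trans (mxrankM_maxl _ _)) // mxrank_delta.
Qed.

End MatrixAverages.

(** * Fourier coefficients of central measures *)

Section FourierScalar.
Variables (R : realType) (n : nat) (nu : probability (borel (unitary_group R n)) R).
Local Notation U := (unitary_group R n).

Lemma cint_central (g : U) (f : borel U -> C R) : central nu -> cbounded f ->
  cint nu (fun t => f (g * t * g^-1)%g) = cint nu f.
Proof.
move=> cnu bf; symmetry; apply: cint_pushforward => //.
  apply: measurable_unitaryM; last exact: measurable_cst.
  exact: measurable_unitary_mul_l.
by move=> A mA; rewrite -(cnu g A mA) conjugateE.
Qed.

Variables (d : nat) (rho : U -> 'M[C R]_d).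

Lemma unitary_rep_mxbounded : unitary_rep rho -> mxbounded (rho : borel U -> 'M[C R]_d).
Proof.
move=> rrho; apply: mxbounded_unitary => [i j|t]; last by case: rrho.
exact: (continuous_cmeasurable (@rep_entry_continuous _ _ _ _ rrho i j)).
Qed.

Lemma irreducible_rep_family : irreducible_rep rho -> irreducible_family rho.
Proof. by case. Qed.

(** Centrality makes the Fourier coefficient commute with the conjugate
    representation; by Schur's lemma it is a scalar, read off from the trace. *)
Lemma fourier_central : central nu -> irreducible_rep rho ->
  exists2 c : C R, fourier nu rho = c%:M &
    c *+ d = (cint nu (fun t : borel U => \tr (rho t)))^*.
Proof.
move=> cnu irho; have [rrho d0 _] := irho.
pose F (t : borel U) : 'M[C R]_d := map_mx Num.conj (rho t).
have fE : fourier nu rho = mxint nu F.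
  by apply/matrixP=> i j; rewrite !mxE; congr cint; apply/funext => t; rewrite mxE.
have bF : mxbounded F.
  move=> i j; have -> : (fun t => F t i j) = (fun t => (rho t i j)^*).
    by apply/funext => t; rewrite mxE.
  exact: cbounded_conj (unitary_rep_mxbounded rrho i j).
have FM a b : F (a * b)%g = F a *m F b.
  by case: rrho => _ _ rM _; rewrite /F rM map_mxM.
have F1 : F 1%g = 1%:M by case: rrho => _ r1 _ _; rewrite /F r1 map_mx1.
have comm g : F g *m mxint nu F = mxint nu F *m F g.
  have H : F g *m mxint nu F *m F g^-1%g = mxint nu F.
    rewrite -mxint_mull // -mxint_mulr; last exact: mxbounded_mull.
    apply/matrixP=> i j; rewrite [LHS]mxE [RHS]mxE.
    rewrite -[RHS](cint_central g cnu) //; congr cint; apply/funext => t.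
    by rewrite !FM.
  by rewrite -[in RHS]H -mulmxA -FM mulVg F1 mulmx1.
have [c cE] := schur_scalar (conj_irreducible_family (irreducible_rep_family irho)) comm.
exists c; first by rewrite fE cE.
rewrite -mxtrace_scalar -cE mxtrace_mxint //.
rewrite -cint_conj; last exact: cbounded_mxtrace (unitary_rep_mxbounded rrho).
by congr cint; apply/funext => t; rewrite /F trace_map_mx.
Qed.

End FourierScalar.

Lemma opnorm_scalar_le (R : realType) d (c : C R) (gamma : R) :
  0 <= gamma -> `|c| <= gamma%:C%C :> C R -> opnorm (c%:M : 'M[C R]_d) <= gamma.
Proof.
move=> g0 cg; rewrite /opnorm.
have cg' : Normc.normc c <= gamma by move: cg; rewrite lecE /= => /andP[].
have c0 : 0 <= Normc.normc c by case: (c) => a b /=; exact: sqrtr_ge0.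
apply: ge_sup.
  exists (hermitian_norm (c%:M *m (0 : 'cV[C R]_d))); exists 0 => //=.
  rewrite /hermitian_norm big1 ?sqrtr0 // => i _.
  by rewrite mxE /= expr0n /= addr0 sqrtr0 expr0n.
move=> _ [v /= v1 <-].
have -> : hermitian_norm (c%:M *m v) = Normc.normc c * hermitian_norm v.
  rewrite /hermitian_norm -[X in X * _](ger0_norm c0) -sqrtr_sqr -sqrtrM ?sqr_ge0 //.
  congr Num.sqrt; rewrite mulr_sumr; apply: eq_bigr => i _.
  by rewrite mul_scalar_mx mxE Normc.normcM exprMn.
have v0 : 0 <= hermitian_norm v by exact: sqrtr_ge0.
by rewrite -[gamma]mulr1 ler_pM.
Qed.

Lemma cbounded_comp (R : realType) d d' (T : measurableType d) (T' : measurableType d')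
    (f : T' -> C R) (phi : T -> T') :
  measurable_fun setT phi -> cbounded f -> cbounded (fun x => f (phi x)).
Proof.
move=> mphi [[fr [M frM]] [fi [N fiN]]].
by split; split; [exact: (measurableT_comp fr mphi)|exists M|
  exact: (measurableT_comp fi mphi)|exists N].
Qed.

(** * Traces averaged over the embedded subgroup *)

Section SubgroupAverage.
Variables (R : realType) (n k : nat) (le_kn : (k <= n)%N).
Variables (mn : probability (borel (unitary_group R n)) R)
          (mk : probability (borel (unitary_group R k)) R).
Hypothesis mkP : is_haar mk.
Local Notation U := (unitary_group R n).
Local Notation V := (unitary_group R k).

(** A class function does not see the conjugation. *)
Lemma cint_conj_law (f : borel U -> C R) : cbounded f ->
  (forall s a : U, f (s * a * s^-1)%g = f a) ->
  cint (conj_law le_kn mn mk) f = cint mk (fun a => f (embed le_kn a)).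
Proof.
move=> bf fclass; have me := @measurable_embed R k n le_kn.
rewrite (cint_pushforward (P := product_measure1 mn mk) (measurable_conj_embed le_kn)) //.
have -> : (fun z => f (conj_embed le_kn z)) = (fun z => f (embed le_kn z.2)).
  by apply/funext => z; rewrite /conj_embed fclass.
symmetry; apply: (@cint_pushforward R _ _ _ _ (product_measure1 mn mk) mk snd
  (fun a => f (embed le_kn a))); first exact: measurable_snd.
  move=> A mA; have -> : snd @^-1` A = [set: borel U] `*` A.
    by apply/seteqP; split => -[x y] //= [].
  rewrite [RHS](product_measure1E mn mk measurableT mA).
  by rewrite [X in (X * _)%E]probability_setT mul1e.
exact: (cbounded_comp me bf).
Qed.

Lemma embed_coord_curve (i : 'I_k) t :
  embed le_kn (unitary_of (diag_mx (coord_curve i t))) =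
  unitary_of (diag_mx (coord_curve (widen_ord le_kn i) t)) :> U.
Proof.
apply: val_inj; rewrite /= !unitary_ofK; last 2 first.
- by apply: diag_unitarymx => j; exact: norm_coord_curve.
- by apply: diag_unitarymx => j; exact: norm_coord_curve.
apply/matrixP=> a b; rewrite castmxE !mxE.
set e := subnKC le_kn.
have aE : a = cast_ord e (cast_ord (esym e) a) by rewrite cast_ordKV.
have bE : b = cast_ord e (cast_ord (esym e) b) by rewrite cast_ordKV.
have abE : (a == b) = (cast_ord (esym e) a == cast_ord (esym e) b).
  by rewrite (inj_eq (@cast_ord_inj _ _ _)).
rewrite abE; clear abE bE.
have aiE : (a == widen_ord le_kn i) = (cast_ord (esym e) a == lshift _ i).
  by apply/eqP/eqP => [|] /(congr1 val) h; apply: val_inj.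
rewrite aiE; clear aiE aE.
case: (split_ordP (cast_ord (esym e) a)) => a' ->;
  case: (split_ordP (cast_ord (esym e) b)) => b' ->.
- by rewrite row_mxEl !mxE !eq_lshift.
- by rewrite row_mxEr mxE eq_lrshift mulr0n.
- by rewrite row_mxEl mxE !eq_rlshift mulr0n.
by rewrite row_mxEr mxE eq_rshift eq_rlshift.
Qed.

Section TraceBound.
Variables (d : nat) (rho : U -> 'M[C R]_d) (Q : 'M[C R]_d) (alpha : 'I_d -> 'I_n -> int).
Hypotheses (rrho : unitary_rep rho) (uQ : Q \is unitarymx).
Hypothesis walpha : weighted (fun M => Q *m rho (unitary_of M) *m Q^t*) alpha.

Let F (a : borel V) : 'M[C R]_d := Q *m rho (embed le_kn a) *m Q^t*.

(** A weight vector whose weight does not vanish on the first [k] coordinates is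
    moved by a diagonal element of the small group, so the averaging projection
    kills it. *)
Lemma trace_average_le : exists2 r : nat,
  cint mk (fun a : borel V => \tr (rho (embed le_kn a))) = r%:R &
  (r <= vanishing alpha (initial n k))%N.
Proof.
have bF : mxbounded F.
  apply: mxbounded_mulr; apply: mxbounded_mull => i j.
  exact: (cbounded_comp (@measurable_embed R k n le_kn) (unitary_rep_mxbounded rrho i j)).
have FM (a b : V) : F (a * b)%g = F a *m F b.
  case: rrho => _ _ rM _; rewrite /F embedM rM.
  exact: unitary_conjM.
exists (\rank (mxint mk F)).
  rewrite -(mxtrace_haar_mxint mkP bF FM) mxtrace_mxint //.
  by congr cint; apply/funext => a; exact/esym/mxtrace_unitary_conj.
apply: rank_le_support => a; rewrite inE => /fintype.subsetPn; case=> i.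
rewrite !inE => ik ai.
pose i' := Ordinal ik.
(* The angle is chosen so that the weight takes the value [-1]. *)
pose t : R := pi / (alpha a i)%:~R.
have ai0 : (alpha a i)%:~R != 0 :> R by rewrite intr_eq0.
have iE : widen_ord le_kn i' = i by apply: val_inj.
apply: (mxint_row_eq0 mkP bF FM (g := unitary_of (diag_mx (coord_curve i' t)))).
  by rewrite /F embed_coord_curve iE; apply: walpha => j; exact: norm_coord_curve.
rewrite mxE (bigD1 i) //= big1 => [|j ji]; last first.
  by rewrite mxE (negPf ji) exp1rz.
rewrite mxE eqxx mulr1 -circMz -mulrzr /t divfK // circ_pi.
by rewrite eq_sym -subr_eq0 opprK -[_ + _]/(2 : C R) pnatr_eq0.
Qed.

End TraceBound.

(** Left translation by [-1] changes the sign of the trace of the small block. *)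
Lemma trace_embed_average :
  cint mk (fun a : borel V => \tr (sval (embed le_kn a))) = (n - k)%:R.
Proof.
have bV : mxbounded (fun a : borel V => sval a).
  apply: mxbounded_unitary => [i j|a]; last exact: svalP a.
  by apply: cmeasurable_entry; exact: measurable_id.
have trE (a : V) : \tr (sval (embed le_kn a)) = \tr (sval a) + (n - k)%:R.
  rewrite /=; move: (subnKC le_kn); move: (n - k)%N => q e; case: _ / e.
  by rewrite castmx_id mxtrace_block mxtrace1.
under [X in cint _ X]eq_fun do rewrite trE.
have btr := cbounded_mxtrace bV.
rewrite cintD ?cint_cst //; last exact: cbounded_cst.
suff -> : cint mk (fun a : borel V => \tr (sval a)) = 0 by rewrite add0r.
have uN : (- 1%:M : 'M[C R]_k) \is unitarymx.
  by apply/unitarymxP; rewrite trmxC_opp trmxC1 mulmxN mulNmx opprK mulmx1.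
have /= := haar_cint_left mkP (unitary_of (- 1%:M)) btr.
under [X in cint _ X]eq_fun => a.
  rewrite unitary_ofK // mulNmx mul1mx linearN /= -mulN1r; over.
rewrite cintZ // mulN1r => /eqP; rewrite eq_sym -subr_eq0 opprK -mulr2n.
by rewrite mulrn_eq0 /= => /eqP.
Qed.

End SubgroupAverage.

(** * The defining representation and its conjugate in the dual *)

Section DualSubset.
Variables (R : realType) (n : nat).
Local Notation U := (unitary_group R n).

Lemma equivalent_irreducible_rep d e (pi : U -> 'M[C R]_d) (rho : U -> 'M[C R]_e) :
  equivalent_rep pi rho -> irreducible_rep rho -> irreducible_rep pi.
Proof.
move=> eqv [rrho e0 irr].
have [] := unitary_equivalent_irreducible eqv (conj e0 irr).
have de := unitary_equivalent_dim eqv; subst e.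
have [u [uu uC piu]] := eqv.
have piE := unitary_equivalentE uu piu.
move=> d0 irr'; split; [|exact: d0|exact: irr'].
have [ru r1 rM _] := rrho; split.
- by move=> g; exact: (eq_ind_r (fun A => is_true (A \is unitarymx)) (unitary_conj_unitary uu (ru g)) (piE g)).
- by rewrite piE r1 mulmx1 (unitarymxP uu).
- by move=> g h; rewrite !piE rM; exact: unitary_conjM.
apply: continuous_mx => i j.
have -> : (fun g => pi g i j) = (fun g => (u *m rho g *m u^t*) i j).
  by apply/funext => g; rewrite piE.
exact: (@conj_entry_continuous _ _ _ _ rrho u i j).
Qed.

Lemma conj_irreducible_rep d (rho : U -> 'M[C R]_d) :
  irreducible_rep rho -> irreducible_rep (conj_rep rho).
Proof.
move=> [rrho d0 irr]; have [] := conj_irreducible_family (conj d0 irr).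
move=> _ irr'; split; [|exact: d0|exact: irr'].
have [ru r1 rM _] := rrho; split.
- by move=> g; rewrite /conj_rep conjC_unitary.
- by rewrite /conj_rep r1 map_mx1.
- by move=> g h; rewrite /conj_rep rM map_mxM.
apply: continuous_mx => i j.
have -> : (fun g => conj_rep rho g i j) = (fun g => (rho g i j)^*).
  by apply/funext => g; rewrite mxE.
move=> g; exact: (continuous_comp (@rep_entry_continuous _ _ _ _ rrho i j g) (@conj_continuous _ _)).
Qed.

Lemma sigma_irreducible_rep : (0 < n)%N -> irreducible_rep (@sigma R n).
Proof.
move=> n0; have [_ irr] := defining_irreducible (C R) n0; split; [split|exact: n0|exact: irr].
- by move=> g; exact: svalP g.
- by [].
- by [].
exact: sval_continuous.
Qed.

Lemma S_dual_subset : (0 < n)%N -> dual_subset (S_ R n).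
Proof.
move=> n0; have irr := sigma_irreducible_rep n0; split.
  move=> d pi [] eqv; apply: (equivalent_irreducible_rep eqv).
    exact: irr.
  exact: conj_irreducible_rep.
move=> d e pi rho /unitary_equivalent_sym eqv [] eqv'; [left|right];
  exact: unitary_equivalent_trans eqv eqv'.
Qed.

Lemma S_symmetric_subset : symmetric_subset (S_ R n).
Proof.
move=> d pi [] /unitary_equivalent_conj eqv; [by right|left].
have sE : (fun t : U => map_mx Num.conj (conj_rep (@sigma R n) t)) = @sigma R n.
  by apply/funext => g; exact: map_conjK.
by move: eqv; rewrite sE.
Qed.

Lemma intertwiner_equivalent d e (rho : U -> 'M[C R]_d) (tau : U -> 'M[C R]_e)
    (J : 'M[C R]_(d, e)) :
  irreducible_rep rho -> irreducible_rep tau ->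
  (forall g, rho g *m J = J *m tau g) -> J != 0 -> equivalent_rep rho tau.
Proof.
move=> irho itau rJ J0.
have [rrho _ _] := irho; have [rtau _ _] := itau.
exact: (schur_unitary (inv := fun g : U => g^-1%g) (irreducible_rep_family irho)
  (irreducible_rep_family itau) (unitary_repV rrho) (unitary_repV rtau) rJ J0).
Qed.

End DualSubset.

(** * The spectral gap *)

Section SpectralGap.
Variable R : realType.

(** A nonzero intertwiner with the defining representation or its conjugate would be
    a multiple of an equivalence, so [rho] satisfies the hypotheses of
    [weighted_gap]. *)
Lemma rep_vanishing_gap p d (rho : unitary_group R p.+3 -> 'M[C R]_d) Q
    (alpha : 'I_d -> 'I_p.+3 -> int) :
  irreducible_rep rho -> ~ trivial_rep rho -> ~ S_ R p.+3 d rho ->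
  Q \is unitarymx ->
  weighted (fun M => Q *m rho (unitary_of M) *m Q^t*) alpha ->
  (2 * p.+4 * (vanishing alpha (initial p.+3 p.+3./2) +
     vanishing alpha (initial p.+3 p.+4./2)) <= (p.+3 + 4) * d)%N.
Proof.
move=> irho ntriv nS uQ walpha; have [rrho _ _] := irho.
have isigma := sigma_irreducible_rep R (ltn0Sn p.+2).
apply: (weighted_gap (urep_conjugate uQ (urep_of_unitary_rep rrho)) walpha).
- have -> : (fun u : {u : 'M[C R]_p.+3 | u \is unitarymx} =>
      Q *m rho (unitary_of (sval u)) *m Q^t*) = (fun u => Q *m rho u *m Q^t*).
    by apply/funext => u; rewrite svalK_unitary.
  exact: unitary_equivalent_irreducible (unitary_equivalent_conjugate rho uQ)
    (irreducible_rep_family irho).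
- move=> triv; apply: ntriv => g; apply: (unitary_conj_eq1 uQ).
  by rewrite -(svalK_unitary g); exact: triv (svalP g).
- move=> J HJ; apply: (unitary_Cmul_eq0 uQ); apply/eqP/contraT => J0.
  case: nS; left; apply: (intertwiner_equivalent irho isigma _ J0) => g.
  by apply: (unitary_conj_eq uQ); rewrite -{1}(svalK_unitary g); exact: HJ (svalP g).
move=> J HJ; apply: (unitary_Cmul_eq0 uQ); apply/eqP/contraT => J0.
case: nS; right; apply: (intertwiner_equivalent irho (conj_irreducible_rep isigma) _ J0) => g.
by apply: (unitary_conj_eq uQ); rewrite -{1}(svalK_unitary g); exact: HJ (svalP g).
Qed.

Variable haar : forall n, probability (borel (unitary_group R n)) R.
Hypothesis haarP : forall n, is_haar (haar n).

(** For even [n] the two halves coincide, so that one formula serves both parities. *)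
Definition half_mixture n : probability (borel (unitary_group R n)) R :=
  mixture (conj_law (half_le n) (haar n) (haar n./2))
          (conj_law (half_succ_le n) (haar n) (haar n.+1./2)).

Lemma half_mixtureE n A : measurable A -> half_mixture n A = nu_ haar n A.
Proof.
move=> mA; rewrite [LHS]mixtureE -!mu_E // /nu_; case: ifP => // en.
have muE k k' (h : (k <= n)%N) (h' : (k' <= n)%N) : k = k' ->
    mu_ haar k n h A = mu_ haar k' n h' A.
  by move=> kk; subst k'; rewrite (bool_irrelevance h h').
rewrite (muE _ _ (half_succ_le n) (half_le n)); last by rewrite -uphalfE uphalf_half en.
rewrite mu_E //.
have /fineK <- : conj_law (half_le n) (haar n) (haar n./2) A \is a fin_num.
  exact: fin_num_measure.
by rewrite -EFinD -EFinM; congr EFin; field.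
Qed.

Lemma half_mixture_central n : central (half_mixture n).
Proof.
move=> g A mA; rewrite conjugateE // [LHS]mixtureE [RHS]mixtureE.
by rewrite -!conjugateE // !(conj_law_central _ _ (@haarP n) g mA).
Qed.

Lemma half_mixture_symmetric n : symmetric_measure (half_mixture n).
Proof.
move=> A mA; rewrite [LHS]mixtureE [RHS]mixtureE.
by rewrite !(conj_law_symmetric _ _ (@haarP _) mA).
Qed.

Lemma cint_half_mixture n (f : borel (unitary_group R n) -> C R) : cbounded f ->
  (forall s a : unitary_group R n, f (s * a * s^-1)%g = f a) ->
  cint (half_mixture n) f =
    2^-1 * (cint (haar n./2) (fun a => f (embed (half_le n) a)) +
            cint (haar n.+1./2) (fun a => f (embed (half_succ_le n) a))).
Proof. by move=> bf cf; rewrite cint_mixture // !cint_conj_law. Qed.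

Lemma rep_trace_class n d (rho : unitary_group R n -> 'M[C R]_d) : unitary_rep rho ->
  forall s a : unitary_group R n, \tr (rho (s * a * s^-1)%g) = \tr (rho a).
Proof.
move=> [_ r1 rM _] s a.
by rewrite rM mxtrace_mulC -rM mulgA mulVg mul1g.
Qed.

(** The fixed vectors of [Gamma k] in the defining representation have dimension
    [n - k], and the two halves add up to [n]. *)
Lemma fourier_S n d (pi : unitary_group R n -> 'M[C R]_d) : (0 < n)%N ->
  S_ R n d pi -> fourier (half_mixture n) pi = ((1 / 2)%:C)%C%:M.
Proof.
move=> n0 Spi; have [irr _] := S_dual_subset R n0; have ipi := irr _ _ Spi.
have [c -> cE] := fourier_central (@half_mixture_central n) ipi; congr (_%:M).
have rsigma : unitary_rep (@sigma R n) by have [] := sigma_irreducible_rep R n0.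
have bs := cbounded_mxtrace (unitary_rep_mxbounded rsigma).
have sE : cint (half_mixture n) (fun t : borel (unitary_group R n) => \tr (sigma t)) =
    2^-1 * n%:R.
  rewrite cint_half_mixture //; last exact: rep_trace_class.
  rewrite !trace_embed_average // -natrD; congr (_ * _%:R); lia.
have conjE : (2^-1 * n%:R : C R)^* = 2^-1 * n%:R.
  by rewrite rmorphM fmorphV !rmorph_nat.
have n0' : n%:R != 0 :> C R by rewrite pnatr_eq0 -lt0n.
have dn : d = n by case: Spi => /unitary_equivalent_dim.
have {cE sE} : c *+ d = 2^-1 * n%:R.
  rewrite {}cE -[RHS]conjE -sE; congr (_^*); case: Spi => eqv.
    by congr cint; apply/funext => t; exact: unitary_equivalent_trace eqv t.
  transitivity (cint (half_mixture n)
      (fun t : borel (unitary_group R n) => (\tr (sigma t))^*)).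
    congr cint; apply/funext => t; rewrite (unitary_equivalent_trace eqv t).
    by rewrite /conj_rep trace_map_mx.
  by rewrite cint_conj // sE.
rewrite dn -(mulr_natr c) => /(mulIf n0') ->.
by rewrite mul1r fmorphV rmorph_nat.
Qed.

(** The Fourier scalar is half the sum of the two dimensions of fixed vectors, divided
    by [d]. *)
Lemma fourier_nonmember p d (rho : unitary_group R p.+3 -> 'M[C R]_d) (gamma : R) :
  irreducible_rep rho -> ~ trivial_rep rho -> ~ S_ R p.+3 d rho ->
  (p.+3 + 4)%:R <= gamma * (4 * p.+4)%:R ->
  opnorm (fourier (half_mixture p.+3) rho) <= gamma.
Proof.
move=> irho ntriv nS gammaP; have [rrho d0 _] := irho.
have [Q uQ [alpha walpha]] := unitary_rep_weighted rrho.
have gap := rep_vanishing_gap irho ntriv nS uQ walpha.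
have [c -> cE] := fourier_central (@half_mixture_central p.+3) irho.
have [r1 r1E r1v] := trace_average_le (half_le p.+3) (@haarP _) rrho uQ walpha.
have [r2 r2E r2v] := trace_average_le (half_succ_le p.+3) (@haarP _) rrho uQ walpha.
move: cE; rewrite cint_half_mixture; last 2 first.
- exact: cbounded_mxtrace (unitary_rep_mxbounded rrho).
- exact: rep_trace_class.
rewrite r1E r2E => cE.
have d0R : (0 : R) < d%:R by rewrite ltr0n.
pose x : R := (r1 + r2)%:R / (2 * d%:R).
have x0 : 0 <= x by rewrite divr_ge0 // mulr_ge0.
have cx : c = Complex x 0.
  have -> : Complex x 0 = (r1 + r2)%:R / (2 * d%:R) :> C R.
    rewrite -[Complex x 0]/(real_complex R x) /x rmorphM fmorphV rmorphM !rmorph_nat.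
    by [].
  have d0C : d%:R != 0 :> C R by rewrite pnatr_eq0 -lt0n.
  apply: (mulIf d0C); rewrite (mulr_natr c) cE -[r1%:R + _]natrD rmorphM fmorphV !rmorph_nat.
  by field.
have q0 : (0 : R) < (4 * p.+4)%:R by rewrite ltr0n.
have g0 : 0 <= gamma.
  by rewrite -(pmulr_lge0 _ q0); apply: le_trans gammaP; exact: ler0n.
apply: opnorm_scalar_le => //.
rewrite norm_complexE cx /= expr0n addr0 sqrtr_sqr ger0_norm // lecE /= eqxx /=.
rewrite /x ler_pdivrMr ?mulr_gt0 // -(ler_pM2r q0).
apply: (@le_trans _ _ ((p.+3 + 4)%:R * (2 * d%:R))); last first.
  by rewrite mulrAC ler_wpM2r // mulr_ge0.
have : (2 * p.+4 * (r1 + r2) <= (p.+3 + 4) * d)%N.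
  by apply: leq_trans gap; rewrite leq_mul2l leq_add // orbT.
rewrite -(ler_nat R) => h; have {}h := ler_wpM2l (ler0n R 2) h.
apply: le_trans (le_trans _ h) _; rewrite -!natrM -?natrM ler_nat; lia.
Qed.

Lemma half_mixture_gap p (gamma : R) : gamma < 1 / 2 ->
  (p.+3 + 4)%:R <= gamma * (4 * p.+4)%:R ->
  has_spectral_gap (half_mixture p.+3) (1 / 2) gamma (S_ R p.+3).
Proof.
move=> g12 gammaP.
have q0 : (0 : R) < (4 * p.+4)%:R by rewrite ltr0n.
have g0 : 0 <= gamma.
  by rewrite -(pmulr_lge0 _ q0); apply: le_trans gammaP; exact: ler0n.
split.
- by split=> //; lra.
- exact: S_dual_subset.
- exact: S_symmetric_subset.
- by move=> d pi; exact: fourier_S.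
by move=> d rho irho ntriv nS; exact: fourier_nonmember.
Qed.

End SpectralGap.

Theorem theorem2p1 (R : realType)
    (haar : forall n, probability (borel (unitary_group R n)) R)
    (haarP : forall n, is_haar (haar n)) :
  (exists gamma : R, 0 < gamma < 1 / 2 /\
     forall n : nat, (4 <= n)%N ->
       exists nu : probability (borel (unitary_group R n)) R,
         [/\ forall A, measurable A -> nu A = nu_ haar n A,
             symmetric_measure nu,
             central nu
           & has_spectral_gap nu (1 / 2) gamma (S_ R n)]) /\
  (forall gamma : R, 1 / 4 < gamma < 1 / 2 ->
     exists N : nat, forall n : nat, (4 <= n)%N -> (N <= n)%N ->
       exists nu : probability (borel (unitary_group R n)) R,
         (forall A, measurable A -> nu A = nu_ haar n A) /\
         has_spectral_gap nu (1 / 2) gamma (S_ R n)).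
Proof.
split.
  (* [(n + 4) / (4 (n + 1))] decreases, with value [2/5] at [n = 4]. *)
  exists (2 / 5); split; first by apply/andP; split; lra.
  move=> n n4; exists (half_mixture haar n); split.
  - by move=> A mA; exact: half_mixtureE.
  - exact: half_mixture_symmetric.
  - exact: half_mixture_central.
  case: n n4 => [|[|[|p]]] // p1; apply: half_mixture_gap; [exact: haarP|lra|].
  have : (1 : R) <= p%:R by rewrite ler1n; lia.
  by rewrite natrD natrM -[p.+4]addn4 -[p.+3]addn3 !natrD; lra.
move=> gamma /andP[g14 g12].
have e0 : 0 < gamma - 1 / 4 by rewrite subr_gt0.
(* [(n + 4) / (4 (n + 1)) = 1/4 + 3 / (4 (n + 1))]. *)
exists (Num.bound (3 / (gamma - 1 / 4))) => n n4 Nn.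
exists (half_mixture haar n); split; first by move=> A mA; exact: half_mixtureE.
have : 3 <= (gamma - 1 / 4) * n%:R.
  rewrite mulrC -ler_pdivrMr //; apply: le_trans (ltW (archi_boundP _)) _.
    by rewrite divr_ge0 // ltW.
  by rewrite ler_nat.
case: n n4 {Nn} => [|[|[|p]]] // p1 h; apply: half_mixture_gap; [exact: haarP|lra|].
have pp : (0 : R) <= p%:R by [].
move: h; rewrite natrD natrM -[p.+4]addn4 -[p.+3]addn3 !natrD => h.
nra.
Qed.
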